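(* Let $\bar M^{m+1}=I\times_hP^m$ be of constant sectional curvature $\kappa\ge0$ and let $\psi:M^m\to\bar M^{m+1}$ be a complete, non-compact, orientable codimension one mean curvature flow soliton with respect to $X=h(t)\partial_t$, with constant $c$, and such that $H=\langle\mathbf H,N\rangle$ does not change sign with respect to the unit normal vector field $N$. Assume that the function $$\frac{\eta}{|H|}(x)\to+\infty\quad\text{as }x\to\infty\text{ in }M,$$ and suppose $$\limsup_{x\to\infty}\frac1{|H|}\big(m\,h'(\pi\circ\psi)+c\,h^2(\pi\circ\psi)\big)<+\infty.$$ Furthermore assume $$\limsup_{x\to\infty}\big(c\,h'(\pi\circ\psi)+|A|^2\big)<0$$ and $$\sup_M\frac{|A|^2}{H^2}<+\infty.$$ (i) If $\kappa>0$, then either $H\equiv0$ or the immersion is totally umbilical (and hence $H>0$ is constant). (ii) If $\kappa=0$, then $$|\nabla H\otimes A-H\,\nabla A|^2=0.$$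
   Context: $I\subset\mathbb R$ is an open interval, $h:I\to(0,\infty)$ is smooth, $(P^m,g_0)$ is a Riemannian manifold, and $\bar M^{m+1}=I\times_hP$ is $I\times P$ with metric $dt^2+h(t)^2g_0$; $\pi(t,p)=t$. An isometric immersion $\psi:M^m\to\bar M^{m+1}$ is a mean curvature flow soliton with respect to $X$ if $c\,X^\perp=\mathbf H$ along $\psi$ for some constant $c\in\mathbb R$, where $\perp$ is projection on the normal bundle and $\mathbf H=HN$ is the non-normalized mean curvature vector (the trace of the second fundamental form). $A$ is the Weingarten operator in the direction $N$, also viewed as a bilinear form. Fix $t_0\in I$; $\eta(x)=\int_{t_0}^{\pi(\psi(x))}h(s)\,ds$. Complete means $M$ with the induced metric is complete; $x\to\infty$ means leaving every compact subset of $M$. ''Does not change sign'' means $H\ge0$ everywhere or $H\le0$ everywhere. The tensor $\nabla H\otimes A-H\nabla A$ is $(U,V,W)\mapsto U(H)A(V,W)-H(\nabla_UA)(V,W)$. *)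

(* Defs.v *)
From mathcomp Require Import all_boot all_order all_algebra.
From mathcomp Require Import all_classical all_reals all_analysis.
Export numFieldNormedType.Exports.

Set Implicit Arguments.
Unset Strict Implicit.
Unset Printing Implicit Defensive.

Import Order.TTheory GRing.Theory Num.Theory.

Local Open Scope classical_set_scope.
Local Open Scope ring_scope.

(* Manifolds are given by charts, vectors and tensors by their components in
   each chart.  Component vectors are rows, and row a of [jac f v] is the a-th
   partial derivative of f, so that a vector u is pushed forward to
   [u *m jac f v]. *)

Section Calculus.
Context {R : realType}.

Definition partial n (a : 'I_n) (f : 'rV[R]_n -> R) (v : 'rV[R]_n) : R :=
  'D_(delta_mx 0 a) f v.

Definition iter_partial n (s : seq 'I_n) (f : 'rV[R]_n -> R) : 'rV[R]_n -> R :=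
  foldr (@partial n) f s.

(* For open U: all iterated partial derivatives exist and are continuous. *)
Definition smooth_on n (U : set 'rV[R]_n) (f : 'rV[R]_n -> R) : Prop :=
  forall (s : seq 'I_n) (v : 'rV[R]_n), U v ->
    {for v, continuous (iter_partial s f)} /\
    forall a : 'I_n, derivable (iter_partial s f) v (delta_mx 0 a).

Definition smooth_map_on n p (U : set 'rV[R]_n) (f : 'rV[R]_n -> 'rV[R]_p) :
    Prop :=
  forall k : 'I_p, smooth_on U (fun v => f v 0 k).

Definition jac n p (f : 'rV[R]_n -> 'rV[R]_p) (v : 'rV[R]_n) : 'M[R]_(n, p) :=
  \matrix_(a < n, k < p) partial a (fun w => f w 0 k) v.

Definition smooth_fun_on (I : set R) (h : R -> R) : Prop :=
  forall (k : nat) (t : R), I t -> derivable (derive1n k h) t 1.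

Definition oriented_integral (a b : R) (f : R -> R) : R :=
  if a <= b then \int[lebesgue_measure]_(s in `[a, b]) f s
  else - \int[lebesgue_measure]_(s in `[b, a]) f s.

Definition inner n (G : 'M[R]_n) (u v : 'rV[R]_n) : R := (u *m G *m v^T) 0 0.

(* Here G is the Gram matrix of the metric as a function of the coordinates;
   [christoffel G k i j] is $\Gamma^k_{ij}$. *)
Definition christoffel n (G : 'rV[R]_n -> 'M[R]_n) (k i j : 'I_n)
    (v : 'rV[R]_n) : R :=
  2^-1 * \sum_(l < n) invmx (G v) k l *
    (partial i (fun w => G w j l) v + partial j (fun w => G w i l) v
     - partial l (fun w => G w i j) v).

(* $R(\partial_i,\partial_j)\partial_k = \sum_l R^l_{ijk}\,\partial_l$ with
   $R(X,Y)Z = \nabla_X\nabla_Y Z - \nabla_Y\nabla_X Z - \nabla_{[X,Y]}Z$. *)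
Definition riemann n (G : 'rV[R]_n -> 'M[R]_n) (l i j k : 'I_n)
    (v : 'rV[R]_n) : R :=
  partial i (christoffel G l j k) v - partial j (christoffel G l i k) v
  + \sum_(a < n) (christoffel G l i a v * christoffel G a j k v
                  - christoffel G l j a v * christoffel G a i k v).

(* $\langle R(u,w)w,u\rangle / (|u|^2|w|^2-\langle u,w\rangle^2)$ *)
Definition sectional n (G : 'rV[R]_n -> 'M[R]_n) (v u w : 'rV[R]_n) : R :=
  let Ruww := \row_(l < n) \sum_(i < n) \sum_(j < n) \sum_(k < n)
                u 0 i * w 0 j * w 0 k * riemann G l i j k v in
  inner (G v) Ruww u /
  (inner (G v) u u * inner (G v) w w - inner (G v) u w ^+ 2).

(* Squared norms of covariant 2- and 3-tensors; [g] is the Gram matrix. *)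
Definition sqnorm2 n (g B : 'M[R]_n) : R :=
  let q := invmx g in
  \sum_(a < n) \sum_(b < n) \sum_(a' < n) \sum_(b' < n)
    q a a' * q b b' * B a b * B a' b'.

Definition sqnorm3 n (g : 'M[R]_n) (T : 'I_n -> 'I_n -> 'I_n -> R) : R :=
  let q := invmx g in
  \sum_(a < n) \sum_(b < n) \sum_(c < n)
  \sum_(a' < n) \sum_(b' < n) \sum_(c' < n)
    q a a' * q b b' * q c c' * T a b c * T a' b' c'.

End Calculus.

Definition at_infinity (T : topologicalType) : set_system T :=
  [set S | exists2 K : set T, compact K & ~` K `<=` S].
Arguments at_infinity : clear implicits.

(* A family of charts.  Only the values of [coord i] on [cdom i] and of
   [param i] on the image of [cdom i] are meaningful; [chart_at x] is some chart
   around x, used to evaluate quantities that do not depend on the chart. *)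
Record charted (R : realType) (n : nat) := Charted {
  pts :> topologicalType;
  idx : Type;
  cdom : idx -> set pts;
  coord : idx -> pts -> 'rV[R]_n;
  param : idx -> 'rV[R]_n -> pts;
  chart_at : pts -> idx }.

Section Manifolds.
Context {R : realType}.

Definition is_chart n (M : charted R n) (i : idx M) : Prop :=
  [/\ open (cdom i), open (coord i @` cdom i),
      {in cdom i, continuous (coord i)},
      {in coord i @` cdom i, continuous (param i)}
    & forall x, cdom i x -> param i (coord i x) = x].

Definition transition n (M : charted R n) (i j : idx M) : 'rV[R]_n -> 'rV[R]_n :=
  coord j \o param i.

Definition smooth_manifold n (M : charted R n) : Prop :=
  [/\ hausdorff_space M, @second_countable M,
      (forall x : M, cdom (chart_at x) x),
      (forall i : idx M, is_chart i)
    & forall i j : idx M,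
        smooth_map_on (coord i @` (cdom i `&` cdom j)) (transition i j)].

(* A choice of orientation of each tangent space: [o i x] tells whether chart i
   is positively oriented at x. *)
Definition orientable n (M : charted R n) : Prop :=
  exists o : idx M -> M -> bool,
    (forall i x, cdom i x -> \forall y \near x, o i y = o i x) /\
    (forall i j x, cdom i x -> cdom j x ->
       (o i x == o j x) = (0 < \det (jac (transition i j) (coord i x)))).

(* Components indexed by the chart; the transformation law under a change of
   chart is part of [riemannian], respectively [unit_normal]. *)
Definition gram_field n (M : charted R n) := idx M -> M -> 'M[R]_n.
Definition vector_field n (M : charted R n) := idx M -> M -> 'rV[R]_n.

Definition riemannian n (M : charted R n) (g : gram_field M) : Prop :=
  [/\ (forall i x, cdom i x -> (g i x)^T = g i x),
      (forall i x, cdom i x -> forall u, u != 0 -> 0 < inner (g i x) u u),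
      (forall i a b, smooth_on (coord i @` cdom i) (fun v => g i (param i v) a b))
    & forall i j x, cdom i x -> cdom j x ->
        let J := jac (transition i j) (coord i x) in
        g i x = J *m g j x *m J^T].

Definition gram n (M : charted R n) (g : gram_field M) (i : idx M)
    (v : 'rV[R]_n) : 'M[R]_n := g i (param i v).

(* Constant sectional curvature at all points covered by the charts. *)
Definition constant_curvature n (M : charted R n) (g : gram_field M) (kappa : R) :
    Prop :=
  forall (i : idx M) (x : M), cdom i x ->
  forall u w : 'rV[R]_n, row_free (col_mx u w) ->
    sectional (gram g i) (coord i x) u w = kappa.

(* Curves that are C^1 but not necessarily regular: a piecewise C^1 curve can be
   reparametrized as one, so the distance below is the usual one. *)
Definition C1_curve n (M : charted R n) (gam : R -> M) : Prop :=
  continuous gam /\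
  forall (i : idx M) (t : R), cdom i (gam t) ->
    derivable (coord i \o gam) t 1 /\
    {for t, continuous (derive1 (coord i \o gam))}.

Definition speed n (M : charted R n) (g : gram_field M) (gam : R -> M) (t : R) :
    R :=
  let i := chart_at (gam t) in
  let v := derive1 (coord i \o gam) t in
  Num.sqrt (inner (g i (gam t)) v v).

Definition curve_length n (M : charted R n) (g : gram_field M) (gam : R -> M) :
    R :=
  \int[lebesgue_measure]_(t in `[0, 1]) speed g gam t.

Definition riem_dist n (M : charted R n) (g : gram_field M) (x y : M) : R :=
  inf [set curve_length g gam |
        gam in [set gam | [/\ C1_curve gam, gam 0 = x & gam 1 = y]]].

Definition riem_complete n (M : charted R n) (g : gram_field M) : Prop :=
  forall u : nat -> M,
    (forall e : R, 0 < e -> exists N : nat, forall i j : nat,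
       (N <= i)%N -> (N <= j)%N -> riem_dist g (u i) (u j) < e) ->
    exists l : M, (fun k => riem_dist g (u k) l) @ \oo --> (0 : R).

(* The open submanifold $I\times P$ of $\mathbb R\times P$: the carrier is
   [R * P], and the charts cover exactly the points (t, p) with t in I. *)
Definition interval_prod n (I : set R) (P : charted R n) : charted R (1 + n) :=
  {| pts := (R * P)%type;
     idx := idx P;
     cdom := fun d => I `*` cdom d;
     coord := fun d q => row_mx (q.1)%:M (coord d q.2);
     param := fun d v => (lsubmx v 0 0, param d (rsubmx v));
     chart_at := fun q => chart_at q.2 |}.

(* $dt^2 + h(t)^2 g_0$ *)
Definition warped_metric n (I : set R) (h : R -> R) (P : charted R n)
    (g0 : gram_field P) : gram_field (interval_prod I P) :=
  fun d q => block_mx 1%:M 0 0 (h q.1 ^+ 2 *: g0 d q.2).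

(* $h(t)\,\partial_t$ *)
Definition h_dt n (I : set R) (h : R -> R) (P : charted R n) :
    vector_field (interval_prod I P) :=
  fun d q => h q.1 *: row_mx 1%:M 0.

End Manifolds.

Arguments warped_metric {R n} I h {P} g0.
Arguments h_dt {R n} I h P.

Section Immersions.
Context {R : realType} {m q : nat} {M : charted R m} {Q : charted R q}.
Variables (gM : gram_field M) (gQ : gram_field Q) (psi : M -> Q).

Definition loc (i : idx M) (d : idx Q) : 'rV[R]_m -> 'rV[R]_q :=
  coord d \o psi \o param i.

Definition smooth_map : Prop :=
  continuous psi /\
  forall i d,
    smooth_map_on (coord i @` (cdom i `&` psi @^-1` cdom d)) (loc i d).

(* The rows are the vectors $d\psi(\partial_a)$. *)
Definition dpsi (i : idx M) (d : idx Q) (x : M) : 'M[R]_(m, q) :=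
  jac (loc i d) (coord i x).

(* Since [gM] is positive definite, this forces the differential of psi to be
   injective. *)
Definition isometric_immersion : Prop :=
  [/\ forall x, exists d, cdom d (psi x), smooth_map
    & forall i d x, cdom i x -> cdom d (psi x) ->
        gM i x = dpsi i d x *m gQ d (psi x) *m (dpsi i d x)^T].

(* A vector field along psi: components in the charts of the target. *)
Definition field_along := idx Q -> M -> 'rV[R]_q.

Definition unit_normal (N : field_along) : Prop :=
  [/\ forall d d' x, cdom d (psi x) -> cdom d' (psi x) ->
        N d' x = N d x *m jac (transition d d') (coord d (psi x)),
      forall i d,
        smooth_map_on (coord i @` (cdom i `&` psi @^-1` cdom d)) (N d \o param i),
      forall d x, cdom d (psi x) -> inner (gQ d (psi x)) (N d x) (N d x) = 1
    & forall i d x, cdom i x -> cdom d (psi x) ->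
        dpsi i d x *m gQ d (psi x) *m (N d x)^T = 0].

(* Orthogonal projection onto the normal space: with J := dpsi and G the metric
   of the target, the tangential part of w is $w G J^T (J G J^T)^{-1} J$. *)
Definition normal_part (i : idx M) (d : idx Q) (x : M) (w : 'rV[R]_q) :
    'rV[R]_q :=
  let J := dpsi i d x in
  let G := gQ d (psi x) in
  w - w *m G *m J^T *m invmx (J *m G *m J^T) *m J.

(* $\bar\nabla_{\partial_a}\, d\psi(\partial_b)$ *)
Definition ambient_hessian (i : idx M) (d : idx Q) (x : M) (a b : 'I_m) :
    'rV[R]_q :=
  let J := dpsi i d x in
  \row_(k < q)
    (partial a (partial b (fun v => loc i d v 0 k)) (coord i x)
     + \sum_(r < q) \sum_(s < q)
         J a r * J b s * christoffel (gram gQ d) k r s (coord d (psi x))).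

Definition second_form (i : idx M) (d : idx Q) (x : M) (a b : 'I_m) : 'rV[R]_q :=
  normal_part i d x (ambient_hessian i d x a b).

(* The non-normalized mean curvature vector, in the chart [chart_at (psi x)]. *)
Definition mean_curvature_vector (x : M) : 'rV[R]_q :=
  let i := chart_at x in
  let d := chart_at (psi x) in
  \sum_(a < m) \sum_(b < m) invmx (gM i x) a b *: second_form i d x a b.

Definition mcf_soliton (X : vector_field Q) (c : R) : Prop :=
  forall x,
    c *: normal_part (chart_at x) (chart_at (psi x)) x
           (X (chart_at (psi x)) (psi x))
    = mean_curvature_vector x.

Variable N : field_along.

Definition mean_curvature (x : M) : R :=
  let d := chart_at (psi x) in
  inner (gQ d (psi x)) (mean_curvature_vector x) (N d x).

(* The Weingarten operator in the direction N as a bilinear form, in chart i. *)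
Definition weingarten (i : idx M) (x : M) : 'M[R]_m :=
  let d := chart_at (psi x) in
  \matrix_(a < m, b < m) inner (gQ d (psi x)) (second_form i d x a b) (N d x).

Definition sqnormA (x : M) : R :=
  sqnorm2 (gM (chart_at x) x) (weingarten (chart_at x) x).

Definition totally_umbilical : Prop :=
  forall x, exists lam : R,
    weingarten (chart_at x) x = lam *: gM (chart_at x) x.

(* $(\nabla_{\partial_u} A)(\partial_a,\partial_b)$ *)
Definition nabla_weingarten (i : idx M) (x : M) (u a b : 'I_m) : R :=
  partial u (fun v => weingarten i (param i v) a b) (coord i x)
  - \sum_(e < m)
      (christoffel (gram gM i) e u a (coord i x) * weingarten i x e b
       + christoffel (gram gM i) e u b (coord i x) * weingarten i x a e).

(* $\nabla H\otimes A - H\,\nabla A$ *)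
Definition gradH_tensor (i : idx M) (x : M) (u a b : 'I_m) : R :=
  partial u (mean_curvature \o param i) (coord i x) * weingarten i x a b
  - mean_curvature x * nabla_weingarten i x u a b.

End Immersions.

(* Main.v *)
Require Import Defs.
From HB Require Import structures.
From mathcomp Require Import all_boot all_order all_algebra.
From mathcomp Require Import all_classical all_reals all_analysis.
From mathcomp Require Import ring lra.
Import Defs.

Set Implicit Arguments.
Unset Strict Implicit.
Unset Printing Implicit Defensive.

Import Order.TTheory GRing.Theory Num.Theory.

Local Open Scope classical_set_scope.
Local Open Scope ring_scope.

(* Let theta be the normal component of X, L = Delta + c <grad eta, .> and
   A the second fundamental form.  The soliton equation says H = c theta.  As X is
   closed and conformal, Hess eta = h' g + theta A and d theta = - A(grad eta), so
   that by the Gauss and Codazzi equations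
     L eta = m h' + c h^2,  L H = - (c h' + |A|^2) H,
   and L A satisfies a Simons formula.  By Hopf's maximum principle H vanishes
   identically or nowhere.  In the latter case the operator
   L' = L + 2 <grad log |H|, .> satisfies, for u = |A|^2 / H^2,
     L' u = 2 |nabla (A / H)|^2 + 2 kappa (m u - 1) >= 0,
     L' (eta / |H|) = (m h' + c h^2) / |H| + (eta / |H|) (c h' + |A|^2),
   and the last expression is negative off a compact set K by assumption.  For
   every e > 0 the function u - e eta / |H| attains its maximum, necessarily in K;
   letting e tend to 0, u is bounded by its maximum over K, hence is constant by
   the maximum principle, and A / H is parallel.  If moreover kappa > 0, then
   A = (H / m) g and H exp (c eta / m) is constant; but h'' = - kappa h bounds eta,
   so |H| is bounded below and eta / |H| is bounded, which is impossible on a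
   non-compact M.  Thus for kappa > 0 only H = 0 remains.

   Tensor identities are proved over an arbitrary commutative ring with commuting
   derivations, and applied to the ring of smooth functions on a coordinate
   region. *)


(** Up to curvature terms, L acts on A and on H with the same zero-order coefficient - (c h' +
    |A|^2). Dividing A by H removes it, which is the origin of L': it gives L' (A / H) = kappa (m A
    / H - g). As A / H has trace 1, Cauchy-Schwarz yields m u >= 1, so the curvature term of L' u
    has the right sign.

    The obstacle is the dependence on charts. The chart of the target at psi x is chosen pointwise
    and may jump with x, so the second fundamental form cannot be differentiated as it is written.
    The support function does not depend on the target chart, and neither does H = c theta. Where
    theta is nonzero, the formula for Hess eta recovers A from eta, theta and g, so A does not
    depend on that chart either. The equations for H and A / H are therefore derived only where H is
    nonzero. For this reason the maximum principle asks for its differential inequality at points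
    with w > 0 only: it can then be applied to |H| across the zeros of H. *)

Lemma addmxE (A : pzRingType) p n (M N : 'M[A]_(p, n)) i j :
  (M + N) i j = M i j + N i j.
Proof. by rewrite mxE. Qed.

Lemma oppmxE (A : pzRingType) p n (M : 'M[A]_(p, n)) i j :
  (- M) i j = - M i j.
Proof. by rewrite mxE. Qed.

Lemma scalemxE (A : pzRingType) p n (c : A) (M : 'M[A]_(p, n)) i j :
  (c *: M) i j = c * M i j.
Proof. by rewrite mxE. Qed.

Lemma trmxE (A : pzRingType) p n (M : 'M[A]_(p, n)) i j : M^T i j = M j i.
Proof. by rewrite mxE. Qed.

Lemma zeromxE (A : pzRingType) p n i j : (0 : 'M[A]_(p, n)) i j = 0.
Proof. by rewrite mxE. Qed.

Lemma trmxD (A : pzRingType) p n (M N : 'M[A]_(p, n)) : (M + N)^T = M^T + N^T.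
Proof. exact: linearD. Qed.

Lemma trmxN (A : pzRingType) p n (M : 'M[A]_(p, n)) : (- M)^T = - M^T.
Proof. exact: linearN. Qed.

Lemma trmxZ (A : comPzRingType) p n (c : A) (M : 'M[A]_(p, n)) :
  (c *: M)^T = c *: M^T.
Proof. exact: linearZ. Qed.

Definition linmxE := (addmxE, oppmxE, scalemxE, zeromxE).

Ltac mxring := apply/matrixP => ? ?; rewrite !linmxE; ring.

Lemma map_mxM_der (A : comNzRingType) (d : {additive A -> A})
    (dM : forall x y, d (x * y) = d x * y + x * d y)
    p n r (M : 'M[A]_(p, n)) (N : 'M[A]_(n, r)) :
  map_mx d (M *m N) = map_mx d M *m N + M *m map_mx d N.
Proof.
apply/matrixP => i j; rewrite !mxE raddf_sum -big_split /=.
by apply: eq_bigr => k _; rewrite dM !mxE.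
Qed.

Lemma map_mxZ_der (A : comNzRingType) (d : {additive A -> A})
    (dM : forall x y, d (x * y) = d x * y + x * d y)
    p n (c : A) (M : 'M[A]_(p, n)) :
  map_mx d (c *: M) = d c *: M + c *: map_mx d M.
Proof. by apply/matrixP => i j; rewrite !mxE dM. Qed.

Lemma der1 (A : comNzRingType) (d : {additive A -> A})
    (dM : forall x y, d (x * y) = d x * y + x * d y) : d 1 = 0.
Proof. by have := dM 1 1; rewrite !mulr1 mul1r => /eqP; rewrite -subr_eq subrr => /eqP. Qed.

Lemma map_mx1_der (A : comNzRingType) (d : {additive A -> A})
    (dM : forall x y, d (x * y) = d x * y + x * d y) n :
  map_mx d (1%:M : 'M[A]_n) = 0.
Proof. by apply/matrixP => i j; rewrite !mxE raddfMn /= der1 // mul0rn. Qed.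

(** * Tensor calculus over a commutative ring with derivations *)

Section TensorCalculus.
Variables (A : comNzRingType) (m : nat) (D : 'I_m -> {additive A -> A}).
Hypothesis DM : forall a x y, D a (x * y) = D a x * y + x * D a y.
Hypothesis DC : forall a b x, D a (D b x) = D b (D a x).

Local Notation d a M := (map_mx (D a) M).

Lemma dmM a p n r (M : 'M[A]_(p, n)) (N : 'M[A]_(n, r)) :
  d a (M *m N) = d a M *m N + M *m d a N.
Proof. exact: map_mxM_der (DM a) _ _ _ _ _. Qed.

Lemma dmC a b p n (M : 'M[A]_(p, n)) : d a (d b M) = d b (d a M).
Proof. by apply/matrixP => i j; rewrite !mxE DC. Qed.

(* Vectors are rows and [C a] is the matrix of the connection in direction [a], with
   entries $(C_a)_{bc} = \Gamma^c_{ab}$. *)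
Definition tcurv n (C : 'I_m -> 'M[A]_n) (i j : 'I_m) : 'M[A]_n :=
  d i (C j) - d j (C i) + C j *m C i - C i *m C j.

Lemma tcurvN n (C : 'I_m -> 'M[A]_n) i j : tcurv C i j = - tcurv C j i.
Proof. rewrite /tcurv; mxring. Qed.

Definition tder n (C : 'I_m -> 'M[A]_n) a p (Y : 'M[A]_(p, n)) : 'M[A]_(p, n) :=
  d a Y + Y *m C a.

Lemma tderC n (C : 'I_m -> 'M[A]_n) a b p (Y : 'M[A]_(p, n)) :
  tder C a (tder C b Y) - tder C b (tder C a Y) = Y *m tcurv C a b.
Proof.
rewrite /tder /tcurv !map_mxD !dmM (dmC a b) /=.
by rewrite !(mulmxDl, mulmxDr, mulmxN, mulNmx, mulmxA); mxring.
Qed.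

Lemma tderD n (C : 'I_m -> 'M[A]_n) a p (Y Z : 'M[A]_(p, n)) :
  tder C a (Y + Z) = tder C a Y + tder C a Z.
Proof. by rewrite /tder map_mxD mulmxDl addrACA. Qed.

Lemma tderMl n (C : 'I_m -> 'M[A]_n) a p r (Y : 'M[A]_(p, r)) (Z : 'M[A]_(r, n)) :
  tder C a (Y *m Z) = d a Y *m Z + Y *m tder C a Z.
Proof. by rewrite /tder dmM mulmxDr mulmxA addrA. Qed.

(** [G] is parallel for [C]; the two terms differentiate the two slots of [G]. *)
Definition tcompat n (C : 'I_m -> 'M[A]_n) (G : 'M[A]_n) :=
  forall a, d a G = C a *m G + G *m (C a)^T.

Lemma tder_pairing n (C : 'I_m -> 'M[A]_n) G a p r (Y : 'M[A]_(p, n))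
    (Z : 'M[A]_(r, n)) : tcompat C G ->
  d a (Y *m G *m Z^T) = tder C a Y *m G *m Z^T + Y *m G *m (tder C a Z)^T.
Proof.
move=> CG; rewrite !dmM CG /tder trmxD trmx_mul -map_trmx.
by rewrite !(mulmxDl, mulmxDr, mulmxA); mxring.
Qed.

(** The mixed derivatives of [G] commute; expanding both orders with [CG] leaves exactly the two
    curvature terms. *)
Lemma tcurv_skew n (C : 'I_m -> 'M[A]_n) G i j : tcompat C G ->
  tcurv C i j *m G + G *m (tcurv C i j)^T = 0.
Proof.
move=> CG; have := dmC i j G.
rewrite !CG !map_mxD !dmM !CG -!map_trmx => /eqP; rewrite -subr_eq0 => /eqP E.
rewrite -[RHS]E /tcurv !(trmxD, trmxN) !trmx_mul !map_trmx.
by rewrite !(mulmxDl, mulmxDr, mulmxN, mulNmx, mulmxA); mxring.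
Qed.

(** The hypothesis on rows says that the connection is torsion-free; with it the derivative terms
    and the products cancel in pairs. *)
Lemma tcurv_bianchi (C : 'I_m -> 'M[A]_m) i j k l :
  (forall a b, row a (C b) = row b (C a)) ->
  tcurv C i j k l + tcurv C j k i l + tcurv C k i j l = 0.
Proof.
move=> CC; rewrite /tcurv.
have E a b : forall c, C a b c = C b a c.
  by move=> c; have /rowP/(_ c) := CC a b; rewrite !mxE.
have F a b c : (C a *m C b) c l = (row c (C a) *m C b) 0 l.
  by rewrite -row_mul !mxE.
rewrite !linmxE !F !mxE.
rewrite (CC j i) (CC k i) (CC k j).
rewrite (E j k) (E k i) (E j i).
ring.
Qed.

Section LeviCivita.
Variables (g q : 'M[A]_m) (half : A).
Hypotheses (gT : g^T = g) (qg : q *m g = 1%:M) (half2 : half + half = 1).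

(** The formula of [christoffel], with [half] and [q] in place of 1/2 and of the inverse matrix,
    since nothing is divided in a general ring. *)
Definition tchris (k i j : 'I_m) : A :=
  half * \sum_(l < m) q k l * (D i (g j l) + D j (g i l) - D l (g i j)).

Definition tgam (i : 'I_m) : 'M[A]_m := \matrix_(j, k) tchris k i j.

Lemma gq1 : g *m q = 1%:M. Proof. exact: mulmx1C. Qed.

Lemma qT : q^T = q.
Proof.
by rewrite -[LHS](mulmx1 _) -gq1 mulmxA -{1}gT -trmx_mul gq1 trmx1 mul1mx.
Qed.

Lemma gsym i j : g i j = g j i. Proof. by rewrite -{1}gT mxE. Qed.

Lemma tgamC a b : row a (tgam b) = row b (tgam a).
Proof.
apply/rowP => k; rewrite !mxE /tchris; congr (_ * _); apply: eq_bigr => l _.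
by rewrite [g b a]gsym (addrC (D b _)).
Qed.

(** Lowering the index cancels [q], so that metric compatibility and uniqueness become linear
    identities in the first derivatives of [g]. *)
Lemma tgam_lower i j l :
  (tgam i *m g) j l = half * (D i (g j l) + D j (g i l) - D l (g i j)).
Proof.
rewrite mxE; under eq_bigr do rewrite mxE /tchris -mulrA mulr_suml.
rewrite -mulr_sumr exchange_big /=; congr (_ * _).
under eq_bigr => p _ do under eq_bigr => k _ do rewrite mulrAC mulrC.
under eq_bigr => p _ do rewrite -mulr_sumr.
rewrite (bigD1 l) //= [X in _ + X]big1 => [|p pl].
  have /matrixP/(_ l l) := qg; rewrite !mxE eqxx addr0 => E.
  rewrite [X in _ * X](_ : _ = 1) ?mulr1 // -[RHS]E; apply: eq_bigr => k _.
  by rewrite -{1}qT mxE.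
have /matrixP/(_ p l) := qg; rewrite !mxE (negbTE pl) => E.
rewrite [X in _ * X](_ : _ = 0) ?mulr0 // -[RHS]E; apply: eq_bigr => k _.
by rewrite -{1}qT mxE.
Qed.

Lemma tgam_compat : tcompat tgam g.
Proof.
move=> a; apply/matrixP => j l.
have -> : g *m (tgam a)^T = (tgam a *m g)^T by rewrite trmx_mul gT.
rewrite addmxE trmxE !tgam_lower !mxE [g l j]gsym [g a l]gsym [g a j]gsym.
have -> : half * (D a (g j l) + D j (g l a) - D l (g j a)) +
   half * (D a (g j l) + D l (g j a) - D j (g l a)) =
   (half + half) * D a (g j l) by ring.
by rewrite half2 mul1r.
Qed.

(** Koszul's uniqueness argument with the index lowered. It identifies the tangential part of the
    ambient connection with the Levi-Civita connection of the induced metric. *)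
Lemma tgam_uniq (W : 'I_m -> 'M[A]_m) :
  (forall a b, row a (W b) = row b (W a)) ->
  (forall a, d a g = W a + (W a)^T) -> forall a, W a = tgam a *m g.
Proof.
move=> WC Wg a; apply/matrixP => b c; rewrite tgam_lower.
have E x y z : W x y z = W y x z.
  by have /rowP/(_ z) := WC y x; rewrite !mxE.
have F x y z : D x (g y z) = W x y z + W x z y.
  by have /matrixP/(_ y z) := Wg x; rewrite !mxE.
rewrite !F (E b a) (E c a) (E c b).
transitivity ((half + half) * W a b c); first by rewrite half2 mul1r.
ring.
Qed.

End LeviCivita.

End TensorCalculus.


(** * The equations of a hypersurface *)

Section Hypersurface.
Variables (A : comNzRingType) (m : nat) (D : 'I_m -> {additive A -> A}).
Hypothesis DM : forall a x y, D a (x * y) = D a x * y + x * D a y.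
Hypothesis DC : forall a b x, D a (D b x) = D b (D a x).
Local Notation d a M := (map_mx (D a) M).

(* [G] and [C r] are the metric and the connection matrices of the ambient space
   along the hypersurface, [J] and [N] the coordinate tangent vectors and the
   unit normal. *)
Variables (G : 'M[A]_(1 + m)) (C : 'I_(1 + m) -> 'M[A]_(1 + m)).
Variables (J : 'M[A]_(m, 1 + m)) (N : 'rV[A]_(1 + m)).
Variables (q : 'M[A]_m) (half : A).

(** The ambient connection pulled back to the hypersurface. The hypothesis [JC] below says that [J]
    is a Jacobian matrix. *)
Let CF (a : 'I_m) : 'M[A]_(1 + m) := \sum_(r < 1 + m) J a r *: C r.
Let g : 'M[A]_m := J *m G *m J^T.

Hypotheses (GT : G^T = G) (CC : forall r s, row r (C s) = row s (C r)).
Hypothesis JC : forall a b r, D a (J b r) = D b (J a r).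
Hypothesis CG : tcompat D CF G.
Hypotheses (qg : q *m g = 1%:M) (half2 : half + half = 1).
Hypotheses (NN : N *m G *m N^T = 1%:M) (JN : J *m G *m N^T = 0).

Local Notation tder := (tder D CF).
Local Notation gam := (tgam D g q half).

Let gT : g^T = g. Proof. by rewrite /g !trmx_mul trmxK GT mulmxA. Qed.

(** Row [b] is $\bar\nabla_{\partial_a}d\psi(\partial_b)$. *)
Definition hess_along a : 'M[A]_(m, 1 + m) := tder a J.

Definition shape_col a : 'cV[A]_m := hess_along a *m G *m N^T.

Definition shape_form : 'M[A]_m := \matrix_(a, b) shape_col a b 0.

Definition shape_op : 'M[A]_m := shape_form *m q.

Lemma hess_alongC a b : row a (hess_along b) = row b (hess_along a).
Proof.
apply/rowP => k; rewrite !mxE JC; congr (_ + _).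
under eq_bigr => r _ do rewrite summxE mulr_sumr.
under [RHS]eq_bigr => r _ do rewrite summxE mulr_sumr.
rewrite exchange_big; apply: eq_bigr => r _; apply: eq_bigr => s _ /=.
have /rowP/(_ k) := CC r s; rewrite !mxE => ->; ring.
Qed.

Lemma shape_formT : shape_form^T = shape_form.
Proof.
apply/matrixP => a b; rewrite !mxE.
have E c e : shape_col c e 0 = (row e (hess_along c) *m G *m N^T) 0 0.
  by rewrite /shape_col -!mulmxA -row_mul !mxE.
by have := E b a; rewrite hess_alongC -E !mxE.
Qed.

Lemma shape_colE a : shape_col a = shape_form *m (delta_mx 0 a)^T.
Proof.
by rewrite trmx_delta -colE; apply/colP => b; rewrite -shape_formT !mxE.
Qed.

(** The square matrix [Phi] of the frame has Gram matrix diag(1, [g]), which [K] inverts. Hence G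
    Phi^T K is a right inverse of [Phi], and for square matrices over a commutative ring also a left
    inverse. *)
Lemma frame_complete : G *m (J^T *m q *m J + N^T *m N) = 1%:M.
Proof.
pose Phi : 'M[A]_(1 + m) := col_mx N J.
pose K : 'M[A]_(1 + m) := block_mx 1%:M 0 0 q.
have NJ : N *m G *m J^T = 0.
  by apply: trmx_inj; rewrite trmx0 -JN !trmx_mul trmxK GT mulmxA.
have gq : g *m q = 1%:M by exact: gq1.
have E : Phi *m (G *m Phi^T *m K) = 1%:M.
  rewrite !mulmxA mul_col_mx tr_col_mx mul_col_row NN JN NJ mulmx_block.
  by rewrite !(mulmx0, mul0mx, mulmx1, addr0, add0r) gq -scalar_mx_block.
have := mulmx1C E.
rewrite -!mulmxA => <-; congr (G *m _).
rewrite tr_col_mx mul_block_col !(mul0mx, mul1mx, addr0, add0r) mul_row_col.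
by rewrite addrC mulmxA.
Qed.

Lemma frame_decomp p (Y : 'M[A]_(p, 1 + m)) :
  Y = Y *m G *m J^T *m q *m J + Y *m G *m N^T *m N.
Proof. by rewrite -{1}[Y]mulmx1 -frame_complete !(mulmxDr, mulmxA). Qed.

(** The left-hand side has the symmetry and the metric property that characterize the Levi-Civita
    connection in [tgam_uniq]. *)
Lemma tangential_hess a : hess_along a *m G *m J^T = gam a *m g.
Proof.
apply: (@tgam_uniq A m D g q half gT qg half2
  (fun b => hess_along b *m G *m J^T)) => [b c|b].
  by rewrite !row_mul hess_alongC.
rewrite /g (tder_pairing DM _ _ _ CG) -/(hess_along b); congr (_ + _).
by rewrite !trmx_mul trmxK GT mulmxA.
Qed.

Lemma gauss_formula a : hess_along a = gam a *m J + shape_col a *m N.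
Proof.
rewrite [LHS]frame_decomp tangential_hess; congr (_ + _).
by rewrite -[gam a *m g *m q]mulmxA (gq1 qg) mulmx1.
Qed.

(** Differentiating <N, J> = 0 gives the tangential part, and differentiating <N, N> = 1 shows that
    there is no normal part. *)
Lemma weingarten_formula a : tder a N = - (row a shape_op *m J).
Proof.
have NJ : N *m G *m J^T = 0.
  by apply: trmx_inj; rewrite trmx0 -JN !trmx_mul trmxK GT mulmxA.
rewrite [LHS]frame_decomp.
have -> : tder a N *m G *m J^T = - (row a shape_form).
  have := tder_pairing DM a N J CG; rewrite NJ map_mx0 => /esym/eqP.
  rewrite addr_eq0 => /eqP ->; congr (- _).
  have -> : row a shape_form = (shape_col a)^T by apply/rowP => b; rewrite !mxE.
  by rewrite /shape_col !trmx_mul trmxK GT mulmxA.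
have -> : tder a N *m G *m N^T = 0.
  have := tder_pairing DM a N N CG; rewrite NN map_mx1_der; last exact: DM.
  set X := _ *m _ *m _; set Y := N *m _ *m _.
  have -> : Y = X^T by rewrite /X /Y !trmx_mul trmxK GT mulmxA.
  have -> : X^T = X by apply/matrixP => i j; rewrite mxE !ord1.
  (* From X + X = 0, dividing by 2 through [half]. *)
  move=> E; rewrite -[X]scale1r -half2 scalerDl -scalerDr -E.
  by apply/matrixP => i j; rewrite !mxE mulr0.
by rewrite mul0mx addr0 /shape_op row_mul !mulNmx.
Qed.

Variable kappa : A.
Hypothesis curvF : forall a b, tcurv D CF a b =
  kappa *: (G *m (row b J)^T *m row a J - G *m (row a J)^T *m row b J).

(** Right multiplication by [K] reads off tangential components: it inverts [J] and kills [N]. *)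
Let K : 'M[A]_(1 + m, m) := G *m J^T *m q.

Let JK : J *m K = 1%:M. Proof. by rewrite /K !mulmxA; exact: gq1. Qed.

Let NK : N *m K = 0.
Proof.
rewrite /K !mulmxA; suff -> : N *m G *m J^T = 0 by rewrite mul0mx.
by apply: trmx_inj; rewrite trmx0 -JN !trmx_mul trmxK GT mulmxA.
Qed.

Let rK c : row c J *m K = delta_mx 0 c.
Proof. by rewrite -row_mul JK row1. Qed.

(** The commutator of two covariant derivatives of [N] is a curvature term, which vanishes in
    constant curvature because [N] is orthogonal to [J]. The tangential part of the commutator is
    then the Codazzi equation. *)
Lemma codazzi_rows a b :
  d b (row a shape_op) + row a shape_op *m gam b =
  d a (row b shape_op) + row b shape_op *m gam a.
Proof.
have key c e : (tder c (tder e N)) *m K =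
    - (d c (row e shape_op) + row e shape_op *m gam c).
  rewrite weingarten_formula -mulNmx tderMl // -/(hess_along c) gauss_formula.
  rewrite !(mulmxDl, mulmxDr) -!mulmxA JK NK !mulmx1 !mulmx0 addr0.
  by rewrite mulNmx map_mxN opprD.
have := tderC DM DC CF b a N => /eqP; rewrite subr_eq => /eqP E.
have := key b a; rewrite E mulmxDl key curvF.
have NGr c : N *m G *m (row c J)^T = 0.
  rewrite rowE trmx_mul trmx_delta.
  apply: trmx_inj; rewrite trmx0 !trmx_mul trmxK GT -!mulmxA.
  by rewrite (mulmxA J) JN mulmx0.
rewrite -scalemxAr mulmxDr mulmxN !mulmxA !NGr !mul0mx subr0.
by rewrite scaler0 !mul0mx add0r => /eqP; rewrite eqr_opp => /eqP ->.
Qed.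

(** The tangential part of the commutator of two covariant derivatives of [J]. *)
Lemma gauss_equation a b :
  tcurv D gam a b = shape_col b *m row a shape_op - shape_col a *m row b shape_op
    + kappa *: (g *m delta_mx b a - g *m delta_mx a b).
Proof.
have key c e : (tder c (tder e J)) *m K =
    d c (gam e) + gam e *m gam c - shape_col e *m row c shape_op.
  rewrite -/(hess_along e) gauss_formula tderD !tderMl // -/(hess_along c).
  rewrite gauss_formula weingarten_formula.
  rewrite !(mulmxDl, mulmxDr) !(mulNmx, mulmxN) -!mulmxA JK NK.
  by rewrite !(mulmx0, mulmx1) !addr0 add0r.
have := congr1 (fun X => X *m K) (tderC DM DC CF a b J).
rewrite !mulmxBl !key curvF.
have Jr c : J *m (G *m (row c J)^T) = g *m delta_mx c 0.
  by rewrite rowE trmx_mul trmx_delta /g !mulmxA.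
have rr c e : J *m (G *m ((row c J)^T *m (row e J *m K))) = g *m delta_mx c e.
  by rewrite rK -(mul_delta_mx (0 : 'I_1) c e) [RHS]mulmxA -Jr -!mulmxA.
have -> : J *m (kappa *: (G *m (row b J)^T *m row a J - G *m (row a J)^T *m row b J))
    *m K = kappa *: (g *m delta_mx b a - g *m delta_mx a b).
  by rewrite -scalemxAr -scalemxAl mulmxBr mulmxBl -!(rr, mulmxA).
move=> <-.
rewrite /tcurv; mxring.
Qed.

Variables (X : 'rV[A]_(1 + m)) (phi : A).
Hypothesis conf : forall a, tder a X = phi *: row a J.

(** [df] is the 1-form dual to the tangential part of [X], later the differential of eta; [theta] is
    the support function. *)
Let df : 'cV[A]_m := J *m G *m X^T.
Let theta : A := (N *m G *m X^T) 0 0.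

Lemma hess_potential a :
  d a df = gam a *m df + theta *: shape_col a + phi *: (g *m delta_mx a 0).
Proof.
rewrite /df (tder_pairing DM _ _ _ CG) -/(hess_along a) conf gauss_formula.
move: (shape_col a) => s.
rewrite !mulmxDl linearZ /= -scalemxAr rowE trmx_mul trmx_delta.
congr (_ + _ + _); rewrite -!mulmxA //.
by rewrite (mulmxA N) [N *m _ *m _]mx11_scalar mul_mx_scalar.
Qed.

Lemma diff_support a : D a theta = - (row a shape_op *m df) 0 0.
Proof.
have -> : D a theta = (d a (N *m G *m X^T)) 0 0 by rewrite [RHS]mxE.
rewrite (tder_pairing DM _ _ _ CG) conf weingarten_formula.
move: (row a shape_op) => s.
have -> : N *m G *m (phi *: row a J)^T = 0.
  rewrite trmxZ -scalemxAr rowE trmx_mul trmx_delta.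
  apply: trmx_inj; rewrite trmx0 trmxZ !trmx_mul !trmxK GT -!mulmxA.
  by rewrite (mulmxA J) JN mulmx0 scaler0.
by rewrite addr0 !mulNmx /df !mulmxA mxE.
Qed.

(** The squared lengths of the tangential and the normal part of [X] add up. In L eta this turns c
    |grad eta|^2 + c theta^2 into c h^2. *)
Lemma conformal_pythagoras :
  (df^T *m q *m df) 0 0 + theta ^+ 2 = (X *m G *m X^T) 0 0.
Proof.
rewrite {1}(frame_decomp X) !mulmxDl addmxE; congr (_ + _).
  by rewrite /df !trmx_mul trmxK GT !mulmxA.
rewrite -!mulmxA [N *m _]mx11_scalar mul_mx_scalar -!scalemxAr [RHS]mxE expr2.
congr (_ * _); first by rewrite /theta mulmxA.
by rewrite -[RHS]trmxE !trmx_mul trmxK GT.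
Qed.

End Hypersurface.


(** * Simons' formula *)

Section Simons.
Variables (A : comNzRingType) (m : nat) (D : 'I_m -> {additive A -> A}).
Hypothesis DM : forall a x y, D a (x * y) = D a x * y + x * D a y.
Hypothesis DC : forall a b x, D a (D b x) = D b (D a x).
Local Notation d a M := (map_mx (D a) M).

Variables (g q : 'M[A]_m) (gam : 'I_m -> 'M[A]_m).
Hypotheses (gT : g^T = g) (qg : q *m g = 1%:M).
Hypothesis gamC : forall a b, row a (gam b) = row b (gam a).
Hypothesis gamg : tcompat D gam g.

Local Notation nab := (tder D gam).

(* Covariant derivative of an endomorphism field. *)
Definition eder a (Y : 'M[A]_m) : 'M[A]_m := d a Y - gam a *m Y + Y *m gam a.

(** The sum is the correction for the covariant derivative of the direction [b]; the same holds for
    [der2], the Hessian of a function. *)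
Definition eder2 a b (Y : 'M[A]_m) : 'M[A]_m :=
  eder a (eder b Y) - \sum_(k < m) gam a b k *: eder k Y.

Definition der2 a b (w : A) : A := D a (D b w) - \sum_(k < m) gam a b k * D k w.

Lemma gamCE a b k : gam a b k = gam b a k.
Proof. by have /rowP/(_ k) := gamC b a; rewrite !mxE. Qed.

Let qTq : q^T = q. Proof. exact: qT gT qg. Qed.
Let gq : g *m q = 1%:M. Proof. exact: gq1. Qed.

Let qsym a b : q a b = q b a. Proof. by rewrite -{1}qTq mxE. Qed.

Lemma inv_compat a : d a q = - (q *m gam a + (gam a)^T *m q).
Proof.
have : d a (q *m g) = 0 by rewrite qg map_mx1_der //; exact: DM.
rewrite dmM // gamg => /(congr1 (fun X => X *m q)); rewrite mul0mx mulmxDl.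
rewrite -!mulmxA gq mulmx1 => /eqP; rewrite addr_eq0 => /eqP ->.
by rewrite mulmxDl -!mulmxA gq mulmx1 mulmxDr [q *m (g *m _)]mulmxA qg mul1mx.
Qed.

Lemma ederD a Y Z : eder a (Y + Z) = eder a Y + eder a Z.
Proof. by rewrite /eder map_mxD mulmxDr mulmxDl; mxring. Qed.

Lemma ederM a Y Z : eder a (Y *m Z) = eder a Y *m Z + Y *m eder a Z.
Proof.
rewrite /eder dmM //.
by rewrite !(mulmxDl, mulmxDr, mulmxN, mulNmx, mulmxA); mxring.
Qed.

Lemma ederZ a (w : A) Y : eder a (w *: Y) = D a w *: Y + w *: eder a Y.
Proof.
rewrite /eder map_mxZ_der; last exact: DM.
by rewrite -scalemxAl -scalemxAr; mxring.
Qed.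

Lemma tr_eder a Y : \tr (eder a Y) = D a (\tr Y).
Proof.
rewrite /eder !mxtraceD raddfN /= [\tr (Y *m _)]mxtrace_mulC subrK.
by rewrite /mxtrace raddf_sum; apply: eq_bigr => i _; rewrite mxE.
Qed.

Lemma tr_eder2 a b Y : \tr (eder2 a b Y) = der2 a b (\tr Y).
Proof.
rewrite /eder2 /der2 mxtraceD raddfN /= !tr_eder; congr (_ - _).
by rewrite raddf_sum; apply: eq_bigr => k _; rewrite -tr_eder -mxtraceZ.
Qed.

Lemma nabM a p (y : 'M[A]_(p, m)) Y :
  nab a (y *m Y) = nab a y *m Y + y *m eder a Y.
Proof.
rewrite /tder /eder dmM //.
by rewrite !(mulmxDl, mulmxDr, mulmxN, mulNmx, mulmxA); mxring.
Qed.

(** The corrections for the direction cancel by the symmetry of [gam], and curvature acts on an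
    endomorphism by a commutator. *)
Lemma eder_ricci a b Y :
  eder2 a b Y - eder2 b a Y = Y *m tcurv D gam a b - tcurv D gam a b *m Y.
Proof.
rewrite /eder2 (eq_bigr (fun k => gam b a k *: eder k Y)); last first.
  by move=> k _; rewrite gamCE.
rewrite opprD opprK addrACA [- _ + _]addrC subrr addr0.
rewrite /eder /tcurv !(map_mxD, map_mxN, dmM DM) (dmC DC a b).
by rewrite !(mulmxDl, mulmxDr, mulmxN, mulNmx, mulmxA); mxring.
Qed.

(* [S] is the shape operator acting on row vectors, [df] the differential of the
   potential of the conformal field, [theta] the support function. *)
Variables (S : 'M[A]_m) (kappa c phi theta : A) (df : 'cV[A]_m).
Hypothesis Ssym : (S *m g)^T = S *m g.
Hypothesis codazzi : forall a b,
  d b (row a S) + row a S *m gam b = d a (row b S) + row b S *m gam a.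
Hypothesis gauss : forall a b, tcurv D gam a b =
  S *m g *m delta_mx b a *m S - S *m g *m delta_mx a b *m S
  + kappa *: (g *m delta_mx b a - g *m delta_mx a b).
Hypothesis hessf : forall a, d a df =
  gam a *m df + theta *: (S *m g *m delta_mx a 0) + phi *: (g *m delta_mx a 0).
Hypothesis dtheta : forall a, D a theta = - (S *m df) a 0.
Hypothesis cK : forall a, D a c = 0.
Hypothesis trS : \tr S = c * theta.

Let x : 'rV[A]_m := df^T *m q.

Lemma STq : S^T *m q = q *m S.
Proof.
have : q *m (S *m g)^T *m q = q *m (S *m g) *m q by rewrite Ssym.
by rewrite trmx_mul gT -!mulmxA gq mulmx1 [q *m (g *m _)]mulmxA qg mul1mx.
Qed.

Lemma row_eder a i Y :
  row i (eder a Y) = d a (row i Y) - row i (gam a) *m Y + row i Y *m gam a.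
Proof.
by rewrite /eder map_row !rowE !(mulmxDr, mulmxN, mulmxA).
Qed.

Lemma codazzi_eder a b : row a (eder b S) = row b (eder a S).
Proof.
by rewrite !row_eder gamC addrAC codazzi addrAC.
Qed.

(** The Codazzi symmetry survives another covariant derivative: the direction term of [eder2]
    supplies the connection term of the second index. *)
Lemma codazzi_eder2 a b e : row e (eder2 a b S) = row b (eder2 a e S).
Proof.
have key i k : row i (eder a (eder k S)) = d a (row i (eder k S))
    - \sum_(l < m) gam a i l *: row l (eder k S) + row i (eder k S) *m gam a.
  rewrite row_eder; congr (_ - _ + _); apply/rowP => j; rewrite !mxE summxE.
  by apply: eq_bigr => l _; rewrite !mxE.
have sr i k : row i (\sum_(l < m) gam a k l *: eder l S) =
    \sum_(l < m) gam a k l *: row l (eder i S).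
  apply/rowP => j; rewrite mxE !summxE; apply: eq_bigr => l _.
  rewrite scalemxE [RHS]scalemxE; congr (_ * _).
  by have /rowP/(_ j) := codazzi_eder i l; rewrite !mxE.
rewrite /eder2 ![row _ (_ - _)]raddfB /= !key !sr (codazzi_eder e b).
by mxring.
Qed.

Lemma grad_nabla a : nab a x = phi *: delta_mx 0 a + theta *: row a S.
Proof.
have -> : nab a x = (d a df)^T *m q - x *m gam a - df^T *m (gam a)^T *m q
    + x *m gam a.
  rewrite /x /tder dmM // inv_compat map_trmx.
  by rewrite !(mulmxDl, mulmxDr, mulmxN, mulNmx, mulmxA); mxring.
rewrite hessf !trmxD !trmxZ.
have -> : (S *m g *m delta_mx a 0 : 'cV_m)^T = delta_mx 0 a *m (S *m g).
  by rewrite trmx_mul Ssym trmx_delta.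
have -> : (g *m delta_mx a 0 : 'cV_m)^T = delta_mx 0 a *m g.
  by rewrite trmx_mul gT trmx_delta.
rewrite trmx_mul !mulmxDl -!scalemxAl -!mulmxA gq !mulmx1 rowE.
mxring.
Qed.

Let T a : 'M[A]_m := eder a S.

Lemma eder_sym a : (T a *m g)^T = T a *m g.
Proof.
have -> : T a *m g = d a (S *m g) - gam a *m (S *m g) - S *m g *m (gam a)^T.
  rewrite /T /eder dmM // gamg.
  by rewrite !(mulmxDl, mulmxDr, mulmxN, mulNmx, mulmxA); mxring.
move: (S *m g) Ssym => F FT.
rewrite !trmxD !trmxN map_trmx !trmx_mul trmxK FT.
mxring.
Qed.

(** By Codazzi and self-adjointness the divergence of [S] is the differential of its trace, here c d
    theta = - c S(df). The free index is then raised. *)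
Lemma divergence_shape :
  \sum_(a < m) \sum_(b < m) q a b *: row b (T a) = - c *: (x *m S).
Proof.
set Y := LHS.
suff E : Y *m g = - c *: (S *m df)^T.
  rewrite -[Y]mulmx1 -gq mulmxA E /x -scalemxAl trmx_mul -!mulmxA STq.
  by rewrite mulmxA.
apply/rowP => e; rewrite scalemxE trmxE mulNr -mulrN -dtheta.
have -> : c * D e theta = D e (\tr S) by rewrite trS DM cK mul0r add0r.
rewrite -tr_eder -/(T e) -[T e]mulmx1 -gq mulmxA /Y mulmx_suml summxE.
rewrite [RHS]/mxtrace; apply: eq_bigr => a _; rewrite mulmx_suml summxE mxE.
apply: eq_bigr => b _; rewrite -scalemxAl scalemxE mulrC qsym; congr (_ * _).
have rE (Z : 'M[A]_m) i j : (row i Z *m g) 0 j = (Z *m g) i j.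
  by rewrite -row_mul [LHS]mxE.
by rewrite rE -eder_sym trmxE -rE codazzi_eder rE.
Qed.

(** The inverse metric is parallel, so covariant differentiation passes through the contraction: the
    derivatives of [q] cancel against the connection terms of the two contracted indices. *)
Lemma nabla_divergence e :
  nab e (\sum_(a < m) \sum_(b < m) q a b *: row b (T a)) =
  \sum_(a < m) \sum_(b < m) q a b *: row b (eder2 e a S).
Proof.
have sumD (F : 'I_m -> 'I_m -> 'rV[A]_m) : nab e (\sum_a \sum_b F a b) =
    \sum_a \sum_b nab e (F a b).
  rewrite /tder !map_mx_sum mulmx_suml -big_split; apply: eq_bigr => a _.
  by rewrite map_mx_sum mulmx_suml -big_split.
have step a b : nab e (q a b *: row b (T a)) =
    q a b *: row b (eder e (T a)) + q a b *: (row b (gam e) *m T a)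
    - ((q *m gam e) a b + ((gam e)^T *m q) a b) *: row b (T a).
  rewrite /tder map_mxZ_der; last exact: DM.
  have -> : D e (q a b) = - ((q *m gam e) a b + ((gam e)^T *m q) a b).
    by have /matrixP/(_ a b) := inv_compat e; rewrite !linmxE mxE.
  rewrite row_eder.
  by rewrite -scalemxAl; mxring.
rewrite sumD; under eq_bigr do under eq_bigr do rewrite step.
have -> : \sum_(a < m) \sum_(b < m) q a b *: row b (eder2 e a S) =
    \sum_(a < m) \sum_(b < m) (q a b *: row b (eder e (T a))
       - \sum_(k < m) (q a b * gam e a k) *: row b (T k)).
  apply: eq_bigr => a _; apply: eq_bigr => b _.
  rewrite /eder2 [row _ (_ - _)]raddfB /= scalerBr raddf_sum scaler_sumr.
  congr (_ - _); apply: eq_bigr => k _; rewrite -scalerA; congr (_ *: _).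
  by apply/rowP => j; rewrite !mxE.
have E1 : \sum_(a < m) \sum_(b < m) q a b *: (row b (gam e) *m T a) =
    \sum_(a < m) \sum_(b < m) (q *m gam e) a b *: row b (T a).
  apply: eq_bigr => a _; apply/rowP => j; rewrite !summxE.
  under eq_bigr => b _ do rewrite scalemxE mxE mulr_sumr.
  under [RHS]eq_bigr => b _ do rewrite scalemxE 2!mxE mulr_suml.
  rewrite exchange_big; apply: eq_bigr => b _; apply: eq_bigr => k _.
  by rewrite !mxE mulrA.
have E2 : \sum_(a < m) \sum_(b < m) ((gam e)^T *m q) a b *: row b (T a) =
    \sum_(a < m) \sum_(b < m) \sum_(k < m) (q a b * gam e a k) *: row b (T k).
  rewrite exchange_big [RHS]exchange_big; apply: eq_bigr => b _.
  rewrite [RHS]exchange_big; apply: eq_bigr => k _ /=; rewrite mxE scaler_suml.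
  by apply: eq_bigr => l _; rewrite mxE mulrC.
have sum2B (F1 F2 : 'I_m -> 'I_m -> 'rV[A]_m) : \sum_a \sum_b (F1 a b - F2 a b) =
    \sum_a \sum_b F1 a b - \sum_a \sum_b F2 a b.
  by rewrite -sumrB; apply: eq_bigr => a _; rewrite -sumrB.
have sum2D (F1 F2 : 'I_m -> 'I_m -> 'rV[A]_m) : \sum_a \sum_b (F1 a b + F2 a b) =
    \sum_a \sum_b F1 a b + \sum_a \sum_b F2 a b.
  by rewrite -big_split; apply: eq_bigr => a _; rewrite -big_split.
rewrite sum2B sum2D E1 sum2B -E2.
under [X in _ - X = _]eq_bigr do under eq_bigr do rewrite scalerDl.
by rewrite sum2D; mxring.
Qed.

Lemma mul_delta_mulE p r (M : 'M[A]_(p, m)) (Z : 'M[A]_(m, r)) i k b j :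
  (M *m delta_mx i k *m Z) b j = M b i * Z k j.
Proof.
rewrite -mulmxA mxE (bigD1 i) //= big1 ?addr0 => [|l li].
  congr (_ * _); rewrite mxE (bigD1 k) //= big1 ?addr0 => [|l lk].
    by rewrite mxE !eqxx mul1r.
  by rewrite mxE (negbTE lk) andbF mul0r.
rewrite mxE big1 ?mulr0 // => l' _; by rewrite mxE (negbTE li) mul0r.
Qed.

(** Metric contraction of the index of the family with the row index; on the covariant derivatives
    of [S] it is the divergence. *)
Definition contr (F : 'I_m -> 'M[A]_m) : 'rV[A]_m :=
  \sum_(a < m) \sum_(b < m) q a b *: row b (F a).

Lemma contrD F G : contr (fun a => F a + G a) = contr F + contr G.
Proof.
rewrite -big_split; apply: eq_bigr => a _; rewrite -big_split.
by apply: eq_bigr => b _; apply/rowP => j; rewrite !(mxE, linmxE) /= mulrDr.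
Qed.

Lemma contrZ k F : contr (fun a => k *: F a) = k *: contr F.
Proof.
rewrite scaler_sumr; apply: eq_bigr => a _; rewrite scaler_sumr.
by apply: eq_bigr => b _; apply/rowP => j; rewrite !(mxE, linmxE) /=; ring.
Qed.

Lemma contrN F : contr (fun a => - F a) = - contr F.
Proof.
rewrite -scaleN1r -contrZ; congr contr.
by apply/funext => a; rewrite scaleN1r.
Qed.

(** The Gauss equation produces two patterns: the contracted index is the column of the elementary
    matrix here, and its row in [contr_delta2]. *)
Lemma contr_delta1 e (M Z : 'M[A]_m) :
  contr (fun a => M *m delta_mx e a *m Z) = row e (M^T *m q *m Z).
Proof.
apply/rowP => j; rewrite summxE !mxE; apply: eq_bigr => a _.
rewrite summxE mxE mulr_suml; apply: eq_bigr => b _.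
by rewrite scalemxE [row _ _ _ _]mxE mul_delta_mulE mxE qsym; ring.
Qed.

Lemma contr_delta2 e (M Z : 'M[A]_m) :
  contr (fun a => M *m delta_mx a e *m Z) = \tr (q *m M) *: row e Z.
Proof.
apply/rowP => j; rewrite summxE [RHS]mxE [\tr _]/mxtrace mulr_suml; apply: eq_bigr => a _.
rewrite summxE mxE mulr_suml; apply: eq_bigr => b _.
by rewrite scalemxE [row _ _ _ _]mxE mul_delta_mulE [row _ _ _ _]mxE mulrA.
Qed.

(** The curvature commutator is made explicit by the Gauss equation: a cubic expression in [S] and a
    term linear in [kappa]. *)
Lemma contr_curv e :
  contr (fun a => S *m tcurv D gam a e - tcurv D gam a e *m S) =
  row e (\tr S *: (S *m S) - \tr (S *m S) *: S
         + kappa *: (m%:R *: S - (\tr S)%:M)).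
Proof.
have -> : (fun a => S *m tcurv D gam a e - tcurv D gam a e *m S) = (fun a =>
    (S *m (S *m g) *m delta_mx e a *m S - S *m (S *m g) *m delta_mx a e *m S
    + kappa *: (S *m g *m delta_mx e a *m 1%:M - S *m g *m delta_mx a e *m 1%:M))
   - (S *m g *m delta_mx e a *m (S *m S) - S *m g *m delta_mx a e *m (S *m S)
    + kappa *: (g *m delta_mx e a *m S - g *m delta_mx a e *m S))).
  apply/funext => a.
  rewrite gauss !(mulmx1, mulmxDr, mulmxDl, mulmxN, mulNmx, mulmxA) -!scalemxAr.
  by rewrite -!scalemxAl !(mulmx1, mulmxDr, mulmxDl, mulmxN, mulNmx, mulmxA).
rewrite !(contrD, contrN, contrZ) !contr_delta1 !contr_delta2.
have -> : (S *m (S *m g))^T *m q = S *m S.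
  by rewrite trmx_mul Ssym -mulmxA STq -!mulmxA [g *m (q *m _)]mulmxA gq mul1mx.
have -> : (S *m g)^T *m q = S by rewrite Ssym -mulmxA gq mulmx1.
have -> : \tr (q *m (S *m (S *m g))) = \tr (S *m S).
  by rewrite mxtrace_mulC -!mulmxA gq mulmx1.
have -> : \tr (q *m (S *m g)) = \tr S by rewrite mxtrace_mulC -!mulmxA gq mulmx1.
have -> : g^T *m q = 1%:M by rewrite gT gq.
rewrite qg mxtrace1 !mulmx1 !mul1mx !mulmxA; apply/rowP => j.
by rewrite !(mxE, linmxE); ring.
Qed.

(** The operator L on endomorphism fields; [x] is the gradient of the potential. *)
Definition elap (Y : 'M[A]_m) : 'M[A]_m :=
  \sum_(a < m) \sum_(b < m) q a b *: eder2 a b Y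
  + c *: \sum_(b < m) x 0 b *: eder b Y.

Definition dlap (w : A) : A :=
  \sum_(a < m) \sum_(b < m) q a b * der2 a b w
  + c * \sum_(b < m) x 0 b * D b w.

(** Codazzi moves the free index into the direction of a derivative, [eder_ricci] exchanges the two
    derivatives, and the inner contraction becomes the divergence - c x S. When this is
    differentiated, the term with the derivative of [S] cancels the drift, and - c theta S^2 cancels
    the term tr(S) S^2 of [contr_curv] because tr S = c theta. *)
Theorem simons :
  elap S = - (c * phi + \tr (S *m S)) *: S + kappa *: (m%:R *: S - (\tr S)%:M).
Proof.
apply/row_matrixP => e.
have sumR (F : 'I_m -> 'I_m -> 'M[A]_m) :
    row e (\sum_(a < m) \sum_(b < m) q a b *: F a b) =
    \sum_(a < m) \sum_(b < m) q a b *: row e (F a b).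
  apply/rowP => j; rewrite mxE !summxE; apply: eq_bigr => a _.
  by rewrite !summxE; apply: eq_bigr => b _; rewrite !mxE.
rewrite [LHS]raddfD /= sumR.
under [X in X + _]eq_bigr => a _ do under eq_bigr => b _ do rewrite codazzi_eder2.
have -> : \sum_(a < m) \sum_(b < m) q a b *: row b (eder2 a e S) =
    nab e (- c *: (x *m S)) +
    contr (fun a => S *m tcurv D gam a e - tcurv D gam a e *m S).
  rewrite -divergence_shape nabla_divergence.
  rewrite -big_split; apply: eq_bigr => a _; rewrite -big_split.
  apply: eq_bigr => b _; rewrite -eder_ricci.
  by apply/rowP => j; rewrite !linmxE ![row _ _ _ _]mxE !linmxE; ring.
rewrite contr_curv.
have -> : nab e (- c *: (x *m S)) = - c *: nab e (x *m S).
  rewrite /tder map_mxZ_der; last exact: DM.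
  by rewrite raddfN /= cK oppr0 scale0r add0r -scalemxAl -scalerDr.
rewrite nabM grad_nabla.
have -> : x *m eder e S = row e (\sum_(b < m) x 0 b *: eder b S).
  apply/rowP => j; rewrite !mxE summxE; apply: eq_bigr => b _; rewrite scalemxE.
  by have /rowP/(_ j) := codazzi_eder b e; rewrite !mxE => ->.
rewrite !mulmxDl -!scalemxAl -rowE -row_mul trS.
by apply/rowP => j; rewrite !linmxE ![row _ _ _ _]mxE !linmxE; ring.
Qed.

Lemma tr_elap Y : \tr (elap Y) = dlap (\tr Y).
Proof.
rewrite /elap /dlap mxtraceD mxtraceZ; congr (_ + _ * _).
  rewrite raddf_sum; apply: eq_bigr => a _ /=; rewrite raddf_sum.
  by apply: eq_bigr => b _ /=; rewrite -tr_eder2 -mxtraceZ.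
by rewrite raddf_sum; apply: eq_bigr => b _ /=; rewrite -tr_eder -mxtraceZ.
Qed.

(** The trace of Simons' formula; its [kappa] term has trace zero. *)
Theorem dlap_mean_curvature :
  dlap (\tr S) = - (c * phi + \tr (S *m S)) * \tr S.
Proof.
rewrite -tr_elap simons mxtraceD !mxtraceZ mxtraceD raddfN /= mxtraceZ.
rewrite mxtrace_scalar; ring.
Qed.

Lemma dlap_potential f : (forall b, D b f = df b 0) ->
  dlap f = m%:R * phi + c * ((x *m df) 0 0 + theta ^+ 2).
Proof.
move=> Df; rewrite /dlap [(x *m df) 0 0]mxE.
have -> : \sum_(a < m) \sum_(b < m) q a b * der2 a b f =
    theta * \tr S + phi * \tr (1%:M : 'M[A]_m).
  have E a b : der2 a b f = theta * (S *m g) a b + phi * g a b.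
    rewrite /der2; have /colP/(_ b) := hessf a; rewrite mxE Df => ->.
    rewrite !linmxE [(gam a *m df) b 0]mxE.
    under [X in _ - X]eq_bigr do rewrite Df.
    have F (M : 'M[A]_m) : M^T = M -> (M *m delta_mx a 0 : 'cV_m) b 0 = M a b.
      by move=> MT; rewrite -colE mxE -{1}MT mxE.
    by rewrite !F //; ring.
  rewrite -gq -[S in X in _ = X]mulmx1 -gq mulmxA /mxtrace !mulr_sumr -big_split.
  apply: eq_bigr => a _; rewrite !mxE !mulr_sumr -big_split.
  by apply: eq_bigr => b _; rewrite E qsym /=; ring.
under [X in c * X]eq_bigr do rewrite Df.
rewrite mxtrace1 trS; ring.
Qed.

Definition dgrad (w v : A) : A :=
  \sum_(a < m) \sum_(b < m) q a b * (D a w * D b v).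

Lemma dlapM w v : dlap (w * v) = dlap w * v + w * dlap v + dgrad w v *+ 2.
Proof.
have E a b : der2 a b (w * v) = der2 a b w * v + w * der2 a b v
    + (D a w * D b v + D b w * D a v).
  rewrite /der2 !DM raddfD /= !DM.
  have -> : \sum_(k < m) gam a b k * D k (w * v) =
      (\sum_(k < m) gam a b k * D k w) * v + w * \sum_(k < m) gam a b k * D k v.
    rewrite mulr_suml mulr_sumr -big_split; apply: eq_bigr => k _ /=.
    rewrite DM; ring.
  ring.
have F : \sum_(a < m) \sum_(b < m) q a b * (D b w * D a v) = dgrad w v.
  rewrite exchange_big; apply: eq_bigr => a _; apply: eq_bigr => b _.
  by rewrite qsym.
have -> : dlap (w * v) = \sum_(a < m) \sum_(b < m) q a b * der2 a b w * v
    + w * \sum_(a < m) \sum_(b < m) q a b * der2 a b v + dgrad w v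
    + \sum_(a < m) \sum_(b < m) q a b * (D b w * D a v)
    + c * ((\sum_(b < m) x 0 b * D b w) * v + w * \sum_(b < m) x 0 b * D b v).
  rewrite /dlap; congr (_ + _ * _); last first.
    rewrite mulr_suml mulr_sumr -big_split; apply: eq_bigr => b _ /=.
    rewrite DM; ring.
  rewrite mulr_sumr -!big_split; apply: eq_bigr => a _ /=.
  rewrite mulr_sumr -!big_split; apply: eq_bigr => b _ /=.
  rewrite E; ring.
rewrite F /dlap; under eq_bigr do rewrite -mulr_suml.
rewrite -mulr_suml; ring.
Qed.

Lemma elapZ w Y : elap (w *: Y) = dlap w *: Y + w *: elap Y +
  (\sum_(a < m) \sum_(b < m) (q a b * D a w) *: eder b Y) *+ 2.
Proof.
have E a b : eder2 a b (w *: Y) = der2 a b w *: Y + w *: eder2 a b Y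
    + (D a w *: eder b Y + D b w *: eder a Y).
  rewrite /der2 /eder2 !ederZ ederD !ederZ.
  have -> : \sum_(k < m) gam a b k *: eder k (w *: Y) =
      (\sum_(k < m) gam a b k * D k w) *: Y
      + w *: \sum_(k < m) gam a b k *: eder k Y.
    rewrite scaler_suml scaler_sumr -big_split; apply: eq_bigr => k _ /=.
    by rewrite ederZ; mxring.
  mxring.
have F : \sum_(a < m) \sum_(b < m) (q a b * D b w) *: eder a Y =
   \sum_(a < m) \sum_(b < m) (q a b * D a w) *: eder b Y.
  rewrite exchange_big; apply: eq_bigr => a _; apply: eq_bigr => b _.
  by rewrite qsym.
have -> : elap (w *: Y) = (\sum_(a < m) \sum_(b < m) (q a b * der2 a b w)) *: Y
    + w *: \sum_(a < m) \sum_(b < m) q a b *: eder2 a b Y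
    + \sum_(a < m) \sum_(b < m) (q a b * D a w) *: eder b Y
    + \sum_(a < m) \sum_(b < m) (q a b * D b w) *: eder a Y
    + c *: ((\sum_(b < m) x 0 b * D b w) *: Y + w *: \sum_(b < m) x 0 b *: eder b Y).
  rewrite /elap; congr (_ + _ *: _); last first.
    rewrite scaler_suml scaler_sumr -big_split; apply: eq_bigr => b _ /=.
    by rewrite ederZ; mxring.
  rewrite scaler_suml scaler_sumr -!big_split; apply: eq_bigr => a _ /=.
  rewrite scaler_suml scaler_sumr -!big_split; apply: eq_bigr => b _ /=.
  by rewrite E; mxring.
by rewrite F /dlap /elap mulr2n; mxring.
Qed.

(** A Bochner formula: tr(Y Y) is |Y|^2 when [Y] is self-adjoint. *)
Lemma dlap_trsq Y : dlap (\tr (Y *m Y)) = \tr (Y *m elap Y) *+ 2 +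
  (\sum_(a < m) \sum_(b < m) q a b * \tr (eder a Y *m eder b Y)) *+ 2.
Proof.
have E a b : der2 a b (\tr (Y *m Y)) = \tr (Y *m eder2 a b Y) *+ 2 +
    \tr (eder a Y *m eder b Y) *+ 2.
  have sq k : D k (\tr (Y *m Y)) = \tr (Y *m eder k Y) *+ 2.
    by rewrite -tr_eder ederM mxtraceD [\tr (eder k Y *m Y)]mxtrace_mulC mulr2n.
  have F1 : \sum_(k < m) gam a b k * D k (\tr (Y *m Y)) =
      (\sum_(k < m) gam a b k * \tr (Y *m eder k Y)) *+ 2.
    by rewrite -sumrMnl; apply: eq_bigr => k _; rewrite sq mulrnAr.
  have F2 : \tr (Y *m \sum_(k < m) gam a b k *: eder k Y) =
      \sum_(k < m) gam a b k * \tr (Y *m eder k Y).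
    rewrite mulmx_sumr raddf_sum; apply: eq_bigr => k _ /=.
    by rewrite -scalemxAr mxtraceZ.
  rewrite /der2 F1 sq raddfMn /= -tr_eder ederM mxtraceD /eder2 mulmxBr.
  rewrite raddfB /= F2; ring.
rewrite /dlap /elap mulmxDr mxtraceD -scalemxAr mxtraceZ !mulmx_sumr.
under eq_bigr => a _ do under eq_bigr => b _ do rewrite E mulrDr.
have -> : \tr (\sum_(i < m) Y *m \sum_(b < m) q i b *: eder2 i b Y) =
    \sum_(a < m) \sum_(b < m) q a b * \tr (Y *m eder2 a b Y).
  rewrite raddf_sum; apply: eq_bigr => a _ /=; rewrite mulmx_sumr raddf_sum.
  by apply: eq_bigr => b _ /=; rewrite -scalemxAr mxtraceZ.
have -> : \tr (\sum_(i < m) Y *m (x 0 i *: eder i Y)) =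
    \sum_(b < m) x 0 b * \tr (Y *m eder b Y).
  by rewrite raddf_sum; apply: eq_bigr => b _ /=; rewrite -scalemxAr mxtraceZ.
under eq_bigr do rewrite big_split /=; rewrite big_split /=.
under eq_bigr do under eq_bigr do rewrite mulrnAr.
under eq_bigr do rewrite sumrMnl. rewrite sumrMnl.
under [X in _ + X + _]eq_bigr do under eq_bigr do rewrite mulrnAr.
under [X in _ + X + _]eq_bigr do rewrite sumrMnl. rewrite sumrMnl.
have -> : \sum_(b < m) x 0 b * D b (\tr (Y *m Y)) =
    (\sum_(b < m) x 0 b * \tr (Y *m eder b Y)) *+ 2.
  rewrite -sumrMnl; apply: eq_bigr => b _.
  rewrite -tr_eder ederM mxtraceD [\tr (eder b Y *m Y)]mxtrace_mulC.
  by rewrite -mulr2n mulrnAr.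
ring.
Qed.

Variable Hi : A.
Hypothesis HHi : \tr S * Hi = 1.

(* The drift term $2 \langle \nabla \log H, \nabla w\rangle$ makes the right-hand sides of
   [tlap_trsq] and [tlap_quotient] free of gradient terms. *)
Definition tlap (w : A) : A := dlap w + Hi * dgrad (\tr S) w *+ 2.

Let B : 'M[A]_m := Hi *: S.

Lemma tlap_trsq : tlap (\tr (B *m B)) =
  (\sum_(a < m) \sum_(b < m) q a b * \tr (eder a B *m eder b B)) *+ 2
  + kappa * (m%:R * \tr (B *m B) - 1) *+ 2.
Proof.
have SB : S = \tr S *: B by rewrite scalerA HHi scale1r.
have trB : \tr B = 1 by rewrite mxtraceZ mulrC.
pose V := \sum_(a < m) \sum_(b < m) (q a b * D a (\tr S)) *: eder b B.
(* L (H B), expanded by the product rule, is compared with Simons' formula. The zero-order terms of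
   [S] and of its trace agree and cancel; the gradient term [V] remains and is later absorbed by the
   extra drift of [tlap]. *)
have E : elap B = kappa *: (m%:R *: B - 1%:M) - (Hi *: V) *+ 2.
  have := elapZ (\tr S) B; rewrite -SB simons dlap_mean_curvature -/V.
  rewrite -[X in _ = X + _ + _]scalerA -SB -addrA => /addrI E.
  have : \tr S *: elap B = kappa *: (m%:R *: S - (\tr S)%:M) - V *+ 2.
    by rewrite E addrK.
  move=> /(congr1 (fun Z => Hi *: Z)); rewrite scalerA mulrC HHi scale1r => ->.
  rewrite scalerBr scalerMnr; congr (_ - _).
  rewrite scalerA mulrC -scalerA scalerBr scale_scalar_mx mulrC HHi.
  by rewrite scalerA mulrC -scalerA.
have G : \tr (B *m V) = \sum_(a < m) \sum_(b < m)
    (q a b * D a (\tr S)) * \tr (B *m eder b B).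
  rewrite mulmx_sumr raddf_sum; apply: eq_bigr => a _ /=.
  rewrite mulmx_sumr raddf_sum; apply: eq_bigr => b _ /=.
  by rewrite -scalemxAr mxtraceZ.
have F : dgrad (\tr S) (\tr (B *m B)) = \tr (B *m V) *+ 2.
  rewrite G -sumrMnl; apply: eq_bigr => a _; rewrite -sumrMnl.
  apply: eq_bigr => b _; rewrite -(tr_eder b) ederM mxtraceD.
  rewrite [\tr (eder b B *m B)]mxtrace_mulC; ring.
rewrite /tlap dlap_trsq F E mulmxBr mxtraceD raddfN /= -scalemxAr mxtraceZ.
rewrite mulmxBr mxtraceD raddfN /= mulmx1 trB -scalemxAr mxtraceZ.
have tV : \tr (B *m (Hi *: V)) = Hi * \tr (B *m V) by rewrite -scalemxAr mxtraceZ.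
rewrite mulr2n mulmxDr mxtraceD tV; ring.
Qed.

(** L f is expanded as L (H gm); the gradient term is again the extra drift of [tlap]. *)
Lemma tlap_quotient f gm : (forall b, D b f = df b 0) -> f = \tr S * gm ->
  tlap gm = Hi * (m%:R * phi + c * ((x *m df) 0 0 + theta ^+ 2))
    + gm * (c * phi + \tr (S *m S)).
Proof.
move=> Df fE; rewrite -(dlap_potential Df) fE dlapM dlap_mean_curvature /tlap.
rewrite -[dlap gm in LHS]mul1r -HHi.
rewrite -[X in _ = _ + X]mul1r -HHi.
ring.
Qed.

End Simons.


(** * Smooth functions on open sets *)

Section LinearApproximation.
Context {R : realType}.

Lemma line_is_derive n (f : 'rV[R]_n -> R) (p v : 'rV[R]_n) (s : R) :
  derivable f (s *: v + p) v ->
  is_derive s 1 (fun s => f (s *: v + p)) ('D_v f (s *: v + p)).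
Proof.
have E : (fun h : R => h^-1 *: (((fun s => f (s *: v + p)) \o shift s) (h *: 1)
     - f (s *: v + p))) =
    (fun h => h^-1 *: ((f \o shift (s *: v + p)) (h *: v) - f (s *: v + p))).
  by apply/funext => h /=; rewrite [h *: 1]mulr1 scalerDl addrA.
by move=> fd; apply: DeriveDef; rewrite /derivable /derive E.
Qed.

Lemma line_mvt n (f : 'rV[R]_n -> R) (p v : 'rV[R]_n) (t : R) :
  (forall s, `|s| <= `|t| -> derivable f (s *: v + p) v) ->
  exists2 s, `|s| <= `|t| & f (t *: v + p) - f p = t * 'D_v f (s *: v + p).
Proof.
move=> fd; pose ph (s : R) : R := f (s *: v + p).
have phd (s : R) : `|s| <= `|t| -> is_derive s (1 : R) ph ('D_v f (s *: v + p)).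
  by move=> /fd; exact: line_is_derive.
have phc a b : (forall s, s \in `[a, b] -> `|s| <= `|t|) ->
    {within `[a, b], continuous ph}.
  move=> ab; apply: derivable_within_continuous => s /ab /phd [] //.
have ph0 : ph 0 = f p by rewrite /ph scale0r add0r.
have [t0|t0] := leP 0 t.
  have st s : s \in `[0, t] -> `|s| <= `|t|.
    by rewrite in_itv /= => /andP[s0 st]; rewrite !ger0_norm.
  have [|s s0t E] := @MVT_segment R ph (fun s => 'D_v f (s *: v + p)) 0 t t0 _ (phc _ _ st).
    by move=> s /subset_itv_oo_cc /st /phd.
  by exists s; [exact: st|rewrite -ph0 -/(ph t) E subr0 mulrC].
have st s : s \in `[t, 0] -> `|s| <= `|t|.
  by rewrite in_itv /= => /andP[ts s0]; rewrite !ler0_norm ?lerN2 // ltW.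
have [|s s0t E] := @MVT_segment R ph (fun s => 'D_v f (s *: v + p)) t 0 (ltW t0) _ (phc _ _ st).
  by move=> s /subset_itv_oo_cc /st /phd.
exists s; first exact: st.
by rewrite -ph0 -/(ph t) -opprB E sub0r mulrN opprK mulrC.
Qed.

Lemma row_norm_le n (x : 'rV[R]_n) (e : R) : 0 <= e ->
  (forall i, `|x 0 i| <= e) -> `|x| <= e.
Proof.
move=> e0 xe; rewrite [`|x|]mx_normrE; apply: bigmax_le => // -[i j] _ /=.
by rewrite ord1.
Qed.

Lemma coord_norm_le n (x : 'rV[R]_n) i : `|x 0 i| <= `|x|.
Proof.
rewrite [X in _ <= X]mx_normrE.
by apply: (le_bigmax _ (fun ij => `|x ij.1 ij.2|) (0, i)).
Qed.

Lemma cvg_sumR T (F : set_system T) {FF : Filter F} (J : finType)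
    (f : J -> T -> R) (l : J -> R) :
  (forall i, f i x @[x --> F] --> l i) ->
  \sum_i f i x @[x --> F] --> \sum_i l i.
Proof.
move=> fl; apply: (@cvg_big R J +%R 0 xpredT _ T F _ f l) => // x.
exact: (@add_continuous R).
Qed.

Definition dot_row n (c : 'cV[R]_n) (x : 'rV[R]_n) : R := \sum_(a < n) x 0 a * c a 0.

Lemma dot_row_linear n (c : 'cV[R]_n) : linear (dot_row c).
Proof.
move=> k x y; rewrite /dot_row scaler_sumr -big_split; apply: eq_bigr => a _ /=.
by rewrite !mxE mulrDl -mulrA.
Qed.

HB.instance Definition _ n (c : 'cV[R]_n) :=
  GRing.isLinear.Build R 'rV[R]_n R *:%R (dot_row c) (dot_row_linear c).

Lemma dot_row_continuous n (c : 'cV[R]_n) : continuous (dot_row c).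
Proof.
move=> x; apply: (@cvg_sumR _ (nbhs x) (nbhs_filter x)) => a; apply: cvgMr_tmp; exact: coord_continuous.
Qed.

(** The increment is split along a staircase that changes one coordinate at a time. On each step the
    mean value theorem applies, and the continuity of the partial derivatives controls the error. *)
Lemma partial_approx n (U : set 'rV[R]_n) (f : 'rV[R]_n -> R) v :
  nbhs v U -> (forall w a, U w -> derivable f w (delta_mx 0 a)) ->
  (forall a, {for v, continuous (partial a f)}) ->
  forall e, 0 < e -> \forall x \near (0 : 'rV[R]_n),
    `|f (x + v) - f v - dot_row (\col_a partial a f v) x| <= e * `|x|.
Proof.
move=> vU fd fc e e0.
(* [n.+1] rather than [n] covers dimension 0. *)
have en0 : 0 < e / n.+1%:R by rewrite divr_gt0.
have : \forall w \near v, U w /\ forall a, `|partial a f v - partial a f w| < e / n.+1%:R.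
  near=> w; split; first by near: w.
  near: w; apply: filter_forall => a.
  by have /cvgrPdist_lt := fc a; apply.
move=> /nbhs_ballP[d /= d0]; rewrite -ball_normE => Bd.
have xd0 : \forall x \near (0 : 'rV[R]_n), `|x| < d.
  by apply/nbhs_ballP; exists d => //= x; rewrite -ball_normE /= sub0r normrN.
near=> x.
have xd : `|x| < d by near: x.
(* The vertices of the staircase from 0 to [x]. *)
pose y k : 'rV[R]_n := \row_j if (j < k)%N then x 0 j else 0.
have yx k : `|y k| <= `|x|.
  apply: row_norm_le => // i; rewrite mxE; case: ifP => _; last by rewrite normr0.
  exact: coord_norm_le.
have y0 : y 0%N = 0 by apply/rowP => j; rewrite !mxE ltn0.
have yn : y n = x by apply/rowP => j; rewrite !mxE ltn_ord.
have step (k : 'I_n) : `|f (y k.+1 + v) - f (y k + v) - x 0 k * partial k f v|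
    <= `|x| * (e / n.+1%:R).
  have yS : y k.+1 = x 0 k *: delta_mx 0 k + y k.
    apply/rowP => j; rewrite !mxE eqxx /= ltnS leq_eqVlt -val_eqE /=.
    have [jk|jk] := eqVneq (j : nat) (k : nat).
      by rewrite jk ltnn addr0 mulr1; congr (x 0 _); apply: val_inj.
    by rewrite mulr0 add0r.
  have inB s : `|s| <= `|x 0 k| -> `|v - (s *: delta_mx 0 k + (y k + v))| < d.
    move=> sx; rewrite addrA opprD addrCA subrr addr0 normrN.
    apply: le_lt_trans xd; apply: row_norm_le => // j; rewrite !mxE eqxx /=.
    have [jk|jk] := eqVneq j k.
      by rewrite jk ltnn addr0 mulr1 (le_trans sx) // coord_norm_le.
    rewrite mulr0 add0r; case: ifP => _; last by rewrite normr0.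
    exact: coord_norm_le.
  have [s /inB/Bd /= [_ sB] E] : exists2 s, `|s| <= `|x 0 k| &
      f (x 0 k *: delta_mx 0 k + (y k + v)) - f (y k + v) =
      x 0 k * 'D_(delta_mx 0 k) f (s *: delta_mx 0 k + (y k + v)).
    by apply: line_mvt => s /inB/Bd /= [Us _]; exact: fd.
  rewrite yS -[_ + y k + v]addrA E -mulrBr normrM ler_pM // ?coord_norm_le //.
  by rewrite distrC ltW.
have -> : f (x + v) - f v - dot_row (\col_a partial a f v) x =
    \sum_(k < n) (f (y k.+1 + v) - f (y k + v) - x 0 k * partial k f v).
  rewrite sumrB -(big_mkord xpredT (fun k => f (y k.+1 + v) - f (y k + v))).
  rewrite telescope_sumr // yn y0 add0r; congr (_ - _).
  by apply: eq_bigr => k _; rewrite mxE.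
apply: (le_trans (ler_norm_sum _ _ _)).
apply: (@le_trans _ _ (\sum_(k < n) `|x| * (e / n.+1%:R))).
  by apply: ler_sum => k _; exact: step.
rewrite sumr_const card_ord -mulrnAr mulrC ler_wpM2r //.
rewrite -[_ *+ n]mulr_natr mulrAC ler_pdivrMr //.
by rewrite ler_wpM2l ?ler_nat // ltW.
Unshelve. all: by end_near. Qed.

Lemma partial_differentiable n (U : set 'rV[R]_n) (f : 'rV[R]_n -> R) v :
  nbhs v U -> (forall w a, U w -> derivable f w (delta_mx 0 a)) ->
  (forall a, {for v, continuous (partial a f)}) -> differentiable f v.
Proof.
move=> vU fd fc; pose df := dot_row (\col_a partial a f v).
have lv : lim (nbhs v) = v by exact: lim_id.
have E : f = (fun y => f (lim (nbhs v)) + df (y - lim (nbhs v)))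
    +o_ (nbhs v) (fun y => y - lim (nbhs v)).
  rewrite lv; apply/eqaddoP => e e0.
  suff : \forall y \near v, `|f y - f v - df (y - v)| <= e * `|y - v|.
    by apply: filterS => y /=; rewrite -addrA -opprD.
  apply/nbhs0P; apply: filterS (partial_approx vU fd fc e0) => y.
  by rewrite [v + y]addrC addrK.
(* The differential is selected by choice, so it is enough to exhibit one continuous linear map with
   the little-o property. *)
apply/diffP => /=.
apply: (@getPex _ (fun (df : {linear 'rV[R]_n -> R}) => continuous df /\
  forall y, f y = f (lim (nbhs v)) + df (y - lim (nbhs v))
                  +o_(y \near v) (y - lim (nbhs v)))).
exists (dot_row (\col_a partial a f v) : {linear _ -> _}); split=> [|y]; first exact: dot_row_continuous.
exact: (congr1 (fun h => h y) E).
Qed.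

Lemma deriveE_partial n (f : 'rV[R]_n -> R) v x : differentiable f v ->
  'D_x f v = \sum_a x 0 a * partial a f v.
Proof.
move=> fd; rewrite deriveE // {1}[x]row_sum_delta linear_sum.
by apply: eq_bigr => a _; rewrite linearZ /= -deriveE.
Qed.

(** Restriction to the line through [v] in the direction [e] reduces the claim to the composition of
    a differentiable function with a curve. *)
Lemma chain_rule n p (f : 'rV[R]_p -> R) (F : 'rV[R]_n -> 'rV[R]_p) v e :
  differentiable f (F v) -> (forall k, derivable (fun w => F w 0 k) v e) ->
  is_derive v e (f \o F) (\sum_k 'D_e (fun w => F w 0 k) v * partial k f (F v)).
Proof.
move=> fd Fd; have dF : derivable F v e.
  by apply/derivable_mxP => i k; rewrite ord1; exact: Fd.
have lineE (W : normedModType R) (k : 'rV[R]_n -> W) :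
    'D_1 (fun s : R => k (s *: e + v)) 0 = 'D_e k v.
  rewrite /derive; suff -> : (fun h : R =>
      h^-1 *: (((fun s : R => k (s *: e + v)) \o shift 0) (h *: 1)
               - k (0 *: e + v))) =
      (fun h => h^-1 *: ((k \o shift v) (h *: e) - k v)) by [].
  by apply/funext => h /=; rewrite addr0 [h *: 1]mulr1 scale0r add0r.
pose gm (s : R) := F (s *: e + v).
have gm0 : gm 0 = F v by rewrite /gm scale0r add0r.
have dg : derivable gm 0 1 := (derivable1P F v e).1 dF.
have fdg : differentiable f (gm 0) by rewrite gm0.
have gdiff : differentiable gm 0 by apply/derivable1_diffP.
have E : is_derive (0 : R) (1 : R) (f \o gm) ('d f (F v) ('D_e F v)).
  apply: DeriveDef; first exact/derivable1_diffP/(differentiable_comp gdiff fdg).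
  rewrite deriveE; last exact: (differentiable_comp gdiff fdg).
  rewrite diff_comp // gm0 /=; congr ('d f (F v) _).
  by rewrite -(deriveE (1 : R) gdiff) /gm lineE.
apply: DeriveDef; first by apply: (derivable1P (f \o F) v e).2; case: E.
have -> : 'D_e (f \o F) v = 'D_1 (f \o gm) 0.
  by rewrite -(lineE _ (f \o F)).
case: E => _ ->; rewrite -(deriveE _ fd) (deriveE_partial _ fd).
by apply: eq_bigr => k _; rewrite (derive_mx dF) mxE.
Qed.

Lemma derivable_translate n (f : 'rV[R]_n -> R) (x c v : 'rV[R]_n) :
  derivable f (x + c) v ->
  is_derive x v (fun y => f (y + c)) ('D_v f (x + c)).
Proof.
have E : (fun h : R => h^-1 *: (((fun y => f (y + c)) \o shift x) (h *: v)
     - f (x + c))) =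
    (fun h => h^-1 *: ((f \o shift (x + c)) (h *: v) - f (x + c))).
  by apply/funext => h /=; rewrite addrA.
by move=> fd; apply: DeriveDef; rewrite /derivable /derive E.
Qed.

Lemma second_difference n (f : 'rV[R]_n -> R) v (a b : 'I_n) t :
  (forall s s', `|s| <= `|t| -> `|s'| <= `|t| ->
     [/\ derivable f (s *: delta_mx 0 a + (s' *: delta_mx 0 b + v)) (delta_mx 0 a)
       & derivable (partial a f) (s *: delta_mx 0 a + (s' *: delta_mx 0 b + v))
                   (delta_mx 0 b)]) ->
  exists s s', [/\ `|s| <= `|t|, `|s'| <= `|t| &
    f (t *: delta_mx 0 a + (t *: delta_mx 0 b + v)) - f (t *: delta_mx 0 a + v)
      - (f (t *: delta_mx 0 b + v) - f v) =
    t * (t * partial b (partial a f) (s *: delta_mx 0 a + (s' *: delta_mx 0 b + v)))].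
Proof.
set u := delta_mx 0 a; set w := delta_mx 0 b.
move=> fd.
have Z s : s *: u + v = s *: u + ((0:R) *: w + v) by rewrite scale0r add0r.
pose ph x := f (x + t *: w) - f x.
have phd s : `|s| <= `|t| -> is_derive (s *: u + v) u ph
    (partial a f (s *: u + v + t *: w) - partial a f (s *: u + v)).
  move=> st; apply: is_deriveB; last first.
    apply: derivableP; rewrite Z; have [|+ _] := fd s 0 st; last exact.
    by rewrite normr0.
  apply: derivable_translate; rewrite -addrA [v + _]addrC.
  by have [+ _] := fd s t st (lexx _); exact.
have [|s st] := @line_mvt _ ph v u t; first by move=> s /phd[].
have [_ ->] := phd s st => E; exists s.
have [|s' s't E'] := @line_mvt _ (partial a f) (s *: u + v) w t.
  move=> s' s't; rewrite addrCA; have [_ +] := fd s s' st s't; exact.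
exists s'; split=> //; rewrite (addrCA (s *: u)) /partial -/(partial a f) -E'.
by rewrite (addrC (t *: w) (s *: u + v)) -E /ph -(addrA (t *: u)) (addrC v).
Qed.

(** Schwarz's theorem: the second difference is symmetric in the two directions, and two mean value
    steps express it through either mixed derivative at a point near [v]. *)
Lemma partialC n (U : set 'rV[R]_n) (f : 'rV[R]_n -> R) v (a b : 'I_n) :
  nbhs v U ->
  (forall w, U w -> forall e, derivable f w (delta_mx 0 e)) ->
  (forall w, U w -> forall c e, derivable (partial c f) w (delta_mx 0 e)) ->
  (forall c e, {for v, continuous (partial c (partial e f))}) ->
  partial a (partial b f) v = partial b (partial a f) v.
Proof.
move=> vU fd fdd fc.
suff H e : 0 < e -> `|partial a (partial b f) v - partial b (partial a f) v| < e.
  by apply/eqP; rewrite -subr_eq0 -normr_le0; apply/ler_addgt0Pl => e /H /ltW; rewrite addr0.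
move=> e0; have e20 : 0 < e / 2 by rewrite divr_gt0.
have cf c k : \forall w \near v,
    `|partial c (partial k f) v - partial c (partial k f) w| < e / 2.
  by have /cvgrPdist_lt/(_ _ e20) := fc c k.
have : \forall w \near v, U w /\
    (`|partial a (partial b f) v - partial a (partial b f) w| < e / 2 /\
     `|partial b (partial a f) v - partial b (partial a f) w| < e / 2).
  exact: filterI vU (filterI (cf a b) (cf b a)).
move=> /nbhs_ballP[d /= d0].
rewrite -ball_normE => Bd.
(* Two displacements of length at most [t] add up to at most 2 d / 3 < d. *)
pose t := d / 3; have t0 : 0 < t by rewrite divr_gt0.
have inB (i j : 'I_n) s s' : `|s| <= `|t| -> `|s'| <= `|t| ->
    `|v - (s *: delta_mx 0 i + (s' *: delta_mx 0 j + v))| < d.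
  rewrite (gtr0_norm t0) => st s't; rewrite addrA opprD addrCA subrr addr0 normrN.
  apply: (@le_lt_trans _ _ (t + t)); last by rewrite /t; lra.
  apply: row_norm_le => [|k]; first by rewrite addr_ge0 // ltW.
  rewrite !mxE eqxx /= (le_trans (ler_normD _ _)) // lerD // normrM.
    by case: eqP => _; rewrite ?normr1 ?mulr1 // normr0 mulr0 ltW.
  by case: eqP => _; rewrite ?normr1 ?mulr1 // normr0 mulr0 ltW.
have [|s1 [s1' [h1 h1' E1]]] := @second_difference _ f v a b t.
  move=> s s' hs hs'; have [Us _] := Bd _ (inB a b _ _ hs hs').
  by split; [exact: fd|exact: fdd].
have [|s2 [s2' [h2 h2' E2]]] := @second_difference _ f v b a t.
  move=> s s' hs hs'; have [Us _] := Bd _ (inB b a _ _ hs hs').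
  by split; [exact: fd|exact: fdd].
have [_ [_ B1]] := Bd _ (inB a b _ _ h1 h1').
have [_ [B2 _]] := Bd _ (inB b a _ _ h2 h2').
move: E1 E2 B1 B2; set Y := partial b (partial a f) (_ + _).
set X := partial a (partial b f) (_ + _) => E1 E2 B1 B2; clearbody X Y.
have XY : X = Y.
  have tn : t != 0 by rewrite gt_eqF.
  have E : t * (t * X) = t * (t * Y).
    rewrite -E1 -E2 [t *: delta_mx 0 b + (_ + _)]addrCA; ring.
  exact: (mulfI tn (mulfI tn E)).
move: B1 B2; rewrite -XY.
move: (partial a (partial b f) v) (partial b (partial a f) v) => p1 p2 B1 B2.
rewrite -(subrKA X) (le_lt_trans (ler_normD _ _)) // [e]splitr ltrD //.
by rewrite distrC.
Qed.

End LinearApproximation.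


Section Smoothness.
Context {R : realType} {n : nat}.
Implicit Types (U : set 'rV[R]_n) (f g : 'rV[R]_n -> R).

(** [smooth_on] truncated at order [k]; the closure properties are proved by induction on the
    order. *)
Fixpoint Ck k U f : Prop :=
  (forall v, U v -> {for v, continuous f}) /\
  if k is k'.+1 then
    (forall v a, U v -> derivable f v (delta_mx 0 a)) /\
    (forall a, Ck k' U (partial a f))
  else True.

Lemma smooth_onP U f : smooth_on U f <-> forall k, Ck k U f.
Proof.
have ip s a (h : 'rV[R]_n -> R) : iter_partial s (partial a h) = iter_partial (rcons s a) h.
  by rewrite /iter_partial foldr_rcons.
split=> [fs k|fC s].
  elim: k f fs => [|k IH] f fs; first by split=> // v /(fs [::])[].
  split=> [v /(fs [::])[]//|]; split=> [v a /(fs [::])[]//|a].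
  by apply: IH => s v Uv; rewrite ip; exact: fs.
elim/last_ind: s f fC => [|s a IH] f fC v Uv.
  by split; [have [/(_ v Uv)] := fC 0%N|move=> a; have [_ [+ _]] := fC 1%N; exact].
by rewrite -ip; apply: IH => // k; have [_ [_ +]] := fC k.+1; exact.
Qed.

Lemma open_near_eq U f g v : open U -> U v -> (forall w, U w -> f w = g w) ->
  \forall w \near v, f w = g w.
Proof. by move=> Uo Uv fg; apply: filterS fg _; exact: open_nbhs_nbhs. Qed.

Lemma partial_eq U f g v a : open U -> U v -> (forall w, U w -> f w = g w) ->
  partial a f v = partial a g v.
Proof. by move=> Uo Uv fg; apply: near_eq_derive; exact: open_near_eq fg. Qed.

Lemma Ck_eq k U f g : open U -> (forall w, U w -> f w = g w) -> Ck k U f -> Ck k U g.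
Proof.
move=> Uo; have cont (h h' : 'rV[R]_n -> R) v : U v -> (forall w, U w -> h w = h' w) ->
    {for v, continuous h} -> {for v, continuous h'}.
  move=> Uv hh hc; rewrite /prop_for /continuous_at -hh //.
  apply: cvg_trans hc; apply: (@near_eq_cvg _ _ (nbhs v) (nbhs_filter v)).
  exact: open_near_eq Uo Uv hh.
elim: k f g => [|k IH] f g fg [fc fd].
  by split=> // v Uv; exact: cont fg (fc _ Uv).
split=> [v Uv|]; first exact: cont fg (fc _ Uv).
case: fd => fd fC; split=> [v a Uv|a].
  exact: near_eq_derivable (open_near_eq Uo Uv fg) (fd v a Uv).
by apply: IH (fC a) => w Uw; exact: partial_eq fg.
Qed.

Lemma CkS k U f : Ck k.+1 U f -> Ck k U f.
Proof.
elim: k f => [|k IH] f [fc [fd fC]]; first by split.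
by split=> //; split=> // a; exact: IH.
Qed.

Lemma Ck_cst k U c : Ck k U (cst c).
Proof.
have cc (c0 : R) (v : 'rV[R]_n) : {for v, continuous (cst c0)} by exact: cst_continuous.
elim: k c => [|k IH] c; first by split=> // v _; exact: cc.
split; first by move=> v _; exact: cc.
split=> [v a _|a]; first exact: derivable_cst.
by rewrite (_ : partial a _ = cst 0) //; apply/funext => v; exact: derive_cst.
Qed.

Lemma CkD k U f g : open U -> Ck k U f -> Ck k U g -> Ck k U (fun v => f v + g v).
Proof.
move=> Uo; elim: k f g => [|k IH] f g [fc fd] [gc gd].
  by split=> // v Uv; apply: continuousD; [exact: fc|exact: gc].
split=> [v Uv|]; first by apply: continuousD; [exact: fc|exact: gc].
case: fd gd => fd fC [gd gC]; split=> [v a Uv|a].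
  by apply: derivableD; [exact: fd|exact: gd].
apply: Ck_eq (IH _ _ (fC a) (gC a)) => // w Uw.
by rewrite /partial [RHS]deriveD //; [exact: fd|exact: gd].
Qed.

Lemma CkM k U f g : open U -> Ck k U f -> Ck k U g -> Ck k U (fun v => f v * g v).
Proof.
move=> Uo; elim: k f g => [|k IH] f g.
  by move=> [fc fd] [gc gd]; split=> // v Uv; apply: continuousM; [exact: fc|exact: gc].
move=> fk gk; have [fc [fd fC]] := fk; have [gc [gd gC]] := gk.
split=> [v Uv|]; first by apply: continuousM; [exact: fc|exact: gc].
split=> [v a Uv|a]; first by apply: derivableM; [exact: fd|exact: gd].
apply: Ck_eq (CkD Uo (IH _ _ (CkS fk) (gC a)) (IH _ _ (CkS gk) (fC a))) => // w Uw.
by rewrite /partial [RHS]deriveM //; [exact: fd|exact: gd].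
Qed.

Lemma coord_is_derive (v e : 'rV[R]_n) i : is_derive v e (fun v => v 0 i) (e 0 i).
Proof.
apply: DeriveDef; first exact/diff_derivable/differentiable_coord.
have := derive_id v e; rewrite derive_mx; last exact: derivable_id.
by move=> /rowP/(_ i); rewrite mxE.
Qed.

Lemma Ck_coord k U i : Ck k U (fun v => v 0 i).
Proof.
have dc (v e : 'rV[R]_n) := coord_is_derive v e i.
have cc (v : 'rV[R]_n) : {for v, continuous (fun v : 'rV[R]_n => v 0 i)}.
  exact: coord_continuous.
case: k => [|k]; first by split=> // v _; exact: cc.
split; first by move=> v _; exact: cc.
split=> [v a _|a]; first by have [] := dc v (delta_mx 0 a).
have -> : partial a (fun v => v 0 i) = cst ((delta_mx 0 a : 'rV[R]_n) 0 i).
  by apply/funext => v; have [_] := dc v (delta_mx 0 a).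
exact: Ck_cst.
Qed.

Lemma CkV k U f : open U -> (forall v, U v -> f v != 0) -> Ck k U f ->
  Ck k U (fun v => (f v)^-1).
Proof.
move=> Uo f0; elim: k => [|k IH].
  by move=> [fc fd]; split=> // v Uv; apply: continuousV; [exact: f0|exact: fc].
move=> fk; have [fc [fd fC]] := fk.
split=> [v Uv|]; first by apply: continuousV; [exact: f0|exact: fc].
split=> [v a Uv|a]; first by apply: derivableV; [exact: f0|exact: fd].
have fV := IH (CkS fk).
apply: Ck_eq (CkM Uo (CkM Uo (CkM Uo fV fV) (fC a)) (Ck_cst k U (-1))) => // w Uw.
rewrite /partial (deriveV (f0 _ Uw) (fd _ a Uw)).
by rewrite mulrN1 -mulNr expr2 invfM.
Qed.

Lemma Ck1_differentiable U f v : open U -> U v -> Ck 1 U f -> differentiable f v.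
Proof.
move=> Uo Uv [fc [fd fC]].
have vU : nbhs v U by exact: open_nbhs_nbhs.
apply: (partial_differentiable vU) => [w a Uw|a]; first exact: fd.
by have [+ _] := fC a; exact.
Qed.

Lemma Ck_le1 k U f : Ck k.+1 U f -> Ck 1 U f.
Proof. by elim: k => // k IH /CkS. Qed.

Lemma Ck_sum k U (J : Type) (r : seq J) (F : J -> 'rV[R]_n -> R) : open U ->
  (forall i, Ck k U (F i)) -> Ck k U (fun v => \sum_(i <- r) F i v).
Proof.
move=> Uo FC; elim: r => [|i r IH].
  by apply: Ck_eq (Ck_cst k U 0) => // w _; rewrite big_nil.
by apply: Ck_eq (CkD Uo (FC i) IH) => // w _; rewrite big_cons.
Qed.

Lemma comp1_is_derive (h : R -> R) f v e :
  derivable f v e -> derivable h (f v) 1 ->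
  is_derive v e (fun v => h (f v)) (derive1 h (f v) * 'D_e f v).
Proof.
move=> fd hd; pose F (s : R) := f (s *: e + v).
have F0 : F 0 = f v by rewrite /F scale0r add0r.
have [dF dF'] : is_derive (0:R) (1:R) F ('D_e f v).
  have H := @line_is_derive _ _ f v e 0; rewrite scale0r add0r in H; exact: (H fd).
have E : is_derive (0:R) (1:R) (h \o F) (derive1 h (f v) * 'D_e f v).
  apply: is_derive1_comp; last exact: DeriveDef.
  have hd0 : derivable h (F 0) 1 by rewrite F0; exact: hd.
  apply: (DeriveDef hd0); rewrite F0 derive1E; reflexivity.
case: E => E1 E2; apply: DeriveDef; first exact: (derivable1P _ _ _).2.
rewrite -E2 /derive; suff -> : (fun h0 : R => h0^-1 *: (((fun v0 => h (f v0)) \o shift v)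
    (h0 *: e) - h (f v))) = (fun h0 : R => h0^-1 *:
    ((h \o F \o shift 0) (h0 *: 1) - (h \o F) 0)) by [].
by apply/funext => s /=; rewrite F0 /F addr0 [s *: 1]mulr1.
Qed.

(** All derivatives of [h] are treated at once, because differentiating [derive1n j h (f v)] raises
    [j]. *)
Lemma Ck_comp1 k U f (I : set R) (h : R -> R) j : open U -> smooth_fun_on I h ->
  (forall v, U v -> I (f v)) -> Ck k U f -> Ck k U (fun v => derive1n j h (f v)).
Proof.
move=> Uo hs fI; elim: k j => [|k IH] j.
  move=> [fc fd]; split=> // v Uv; apply: cvg_comp; first exact: fc.
  by apply: differentiable_continuous; apply/derivable1_diffP/hs/fI.
move=> fk; have [fc [fd fC]] := fk.
have dc v a (Uv : U v) := comp1_is_derive (fd v a Uv) (hs j _ (fI v Uv)).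
split=> [v Uv|].
  apply: cvg_comp; first exact: fc.
  by apply: differentiable_continuous; apply/derivable1_diffP/hs/fI.
split=> [v a Uv|a]; first by have [] := dc v a Uv.
apply: Ck_eq (CkM Uo (IH j.+1 (CkS fk)) (fC a)) => // w Uw.
by have [_ E] := dc w a Uw; exact: esym E.
Qed.

End Smoothness.

Section SmoothComposition.
Context {R : realType} {n p : nat}.

Lemma partial_comp (U : set 'rV[R]_n) (V : set 'rV[R]_p) (f : 'rV[R]_p -> R)
    (F : 'rV[R]_n -> 'rV[R]_p) v a : open V -> U v -> V (F v) -> Ck 1 V f ->
  (forall k, Ck 1 U (fun w => F w 0 k)) ->
  is_derive v (delta_mx 0 a) (f \o F)
    (\sum_k partial a (fun w => F w 0 k) v * partial k f (F v)).
Proof.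
move=> Vo Uv VFv fC FC; apply: chain_rule; first exact: Ck1_differentiable fC.
by move=> k; have [_ [+ _]] := FC k; exact.
Qed.

Lemma row_continuous (T : topologicalType) (F : T -> 'rV[R]_p) v :
  (forall k, {for v, continuous (fun w => F w 0 k)}) -> {for v, continuous F}.
Proof.
move=> Fc; apply/cvgrPdist_le => e e0.
have : \forall w \near v, forall k, `|F v 0 k - F w 0 k| <= e.
  apply: filter_forall => k; have /cvgrPdist_le/(_ _ e0) := Fc k; exact.
apply: filterS => w H; apply: row_norm_le; first exact: ltW.
by move=> k; rewrite !mxE.
Qed.

Lemma Ck_comp k (U : set 'rV[R]_n) (V : set 'rV[R]_p) (f : 'rV[R]_p -> R)
    (F : 'rV[R]_n -> 'rV[R]_p) : open U -> open V -> (forall v, U v -> V (F v)) ->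
  Ck k V f -> (forall i, Ck k U (fun w => F w 0 i)) -> Ck k U (f \o F).
Proof.
move=> Uo Vo FV.
have cc (h : 'rV[R]_p -> R) v : U v -> {for F v, continuous h} ->
    (forall i, {for v, continuous (fun w => F w 0 i)}) -> {for v, continuous (h \o F)}.
  by move=> Uv hc Fc; apply: continuous_comp => //; exact: row_continuous.
elim: k f => [|k IH] f fk FC.
  have [fc _] := fk; split=> // v Uv; apply: cc => //; first exact/fc/FV.
  by move=> i; have [+ _] := FC i; exact.
have [fc [fd fC]] := fk; split=> [v Uv|].
  apply: cc => //; first exact/fc/FV.
  by move=> i; have [+ _] := FC i; exact.
have D v a (Uv : U v) := partial_comp a Vo Uv (FV _ Uv) (Ck_le1 fk) (fun i => Ck_le1 (FC i)).
split=> [v a Uv|a]; first by have [] := D v a Uv.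
have E i : Ck k U (fun v => partial a (fun w => F w 0 i) v * (partial i f \o F) v).
  apply: CkM => //; first by have [_ [_ +]] := FC i; exact.
  by apply: IH => [|j]; [exact: fC|exact: CkS].
apply: Ck_eq (Ck_sum _ Uo E) => // w Uw.
by have [_ E'] := D w a Uw; exact: esym E'.
Qed.

End SmoothComposition.

Section SmoothClosure.
Context {R : realType} {n : nat}.
Variable U : set 'rV[R]_n.
Hypothesis Uo : open U.
Implicit Types f g : 'rV[R]_n -> R.

Lemma smooth_eq f g : (forall w, U w -> f w = g w) -> smooth_on U f -> smooth_on U g.
Proof. by move=> fg /smooth_onP fC; apply/smooth_onP => k; exact: Ck_eq fg (fC k). Qed.

Lemma smooth_cst c : smooth_on U (cst c).
Proof. by apply/smooth_onP => k; exact: Ck_cst. Qed.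

Lemma smooth_coord i : smooth_on U (fun v => v 0 i).
Proof. by apply/smooth_onP => k; exact: Ck_coord. Qed.

Lemma smoothD f g : smooth_on U f -> smooth_on U g -> smooth_on U (fun v => f v + g v).
Proof.
by move=> /smooth_onP fC /smooth_onP gC; apply/smooth_onP => k; exact: CkD.
Qed.

Lemma smoothM f g : smooth_on U f -> smooth_on U g -> smooth_on U (fun v => f v * g v).
Proof.
by move=> /smooth_onP fC /smooth_onP gC; apply/smooth_onP => k; exact: CkM.
Qed.

Lemma smoothN f : smooth_on U f -> smooth_on U (fun v => - f v).
Proof.
move=> fs; apply: smooth_eq (smoothM (smooth_cst (-1)) fs) => v _.
by rewrite mulN1r.
Qed.

Lemma smoothV f : (forall v, U v -> f v != 0) -> smooth_on U f ->
  smooth_on U (fun v => (f v)^-1).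
Proof. by move=> f0 /smooth_onP fC; apply/smooth_onP => k; exact: CkV. Qed.

Lemma smooth_sum (J : Type) (r : seq J) (F : J -> 'rV[R]_n -> R) :
  (forall i, smooth_on U (F i)) -> smooth_on U (fun v => \sum_(i <- r) F i v).
Proof.
move=> Fs; apply/smooth_onP => k; apply: Ck_sum => // i.
by have /smooth_onP := Fs i; exact.
Qed.

Lemma smooth_prod (J : Type) (r : seq J) (F : J -> 'rV[R]_n -> R) :
  (forall i, smooth_on U (F i)) -> smooth_on U (fun v => \prod_(i <- r) F i v).
Proof.
move=> Fs; elim: r => [|i r IH].
  by apply: smooth_eq (smooth_cst 1) => w _; rewrite big_nil.
by apply: smooth_eq (smoothM (Fs i) IH) => w _; rewrite big_cons.
Qed.

Lemma smooth_partial a f : smooth_on U f -> smooth_on U (partial a f).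
Proof.
move=> /smooth_onP fC; apply/smooth_onP => k.
by have [_ [_ +]] := fC k.+1; exact.
Qed.

Lemma smooth_derivable f v a : U v -> smooth_on U f -> derivable f v (delta_mx 0 a).
Proof. by move=> Uv /(_ [::] v Uv)[_]; exact. Qed.

Lemma smooth_continuous f v : U v -> smooth_on U f -> {for v, continuous f}.
Proof. by move=> Uv /(_ [::] v Uv)[]. Qed.

Lemma smooth_differentiable f v : U v -> smooth_on U f -> differentiable f v.
Proof. by move=> Uv /smooth_onP fC; exact: Ck1_differentiable (fC 1%N). Qed.

Lemma smooth_comp1 f (I : set R) (h : R -> R) : smooth_fun_on I h ->
  (forall v, U v -> I (f v)) -> smooth_on U f -> smooth_on U (fun v => h (f v)).
Proof.
move=> hs fI /smooth_onP fC; apply/smooth_onP => k.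
exact: (@Ck_comp1 _ _ k U f I h 0).
Qed.

Lemma smooth_partialC f v a b : U v -> smooth_on U f ->
  partial a (partial b f) v = partial b (partial a f) v.
Proof.
move=> Uv fs; have vU : nbhs v U by exact: open_nbhs_nbhs.
apply: (partialC _ _ vU) => [w Uw e|w Uw c e|c e].
- exact: smooth_derivable fs.
- exact: smooth_derivable (smooth_partial _ fs).
- exact: smooth_continuous (smooth_partial _ (smooth_partial _ fs)).
Qed.

End SmoothClosure.

Lemma smooth_comp {R : realType} {n p : nat} (U : set 'rV[R]_n) (V : set 'rV[R]_p)
    (f : 'rV[R]_p -> R) (F : 'rV[R]_n -> 'rV[R]_p) : open U -> open V ->
  (forall v, U v -> V (F v)) -> smooth_on V f -> smooth_map_on U F ->
  smooth_on U (f \o F).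
Proof.
move=> Uo Vo FV /smooth_onP fC Fs; apply/smooth_onP => k.
by apply: Ck_comp FV (fC k) _ => // i; have /smooth_onP := Fs i; exact.
Qed.

Lemma smooth_partial_comp {R : realType} {n p : nat} (U : set 'rV[R]_n)
    (V : set 'rV[R]_p) (f : 'rV[R]_p -> R) (F : 'rV[R]_n -> 'rV[R]_p) v a :
  open U -> open V -> U v -> V (F v) -> smooth_on V f -> smooth_map_on U F ->
  partial a (f \o F) v =
  \sum_k partial a (fun w => F w 0 k) v * partial k f (F v).
Proof.
move=> Uo Vo Uv VFv /smooth_onP fC Fs.
have FC i : Ck 1 U (fun w => F w 0 i) by have /smooth_onP := Fs i; exact.
by have [_ E] := partial_comp a Vo Uv VFv (fC 1%N) FC.
Qed.


(** * The ring of smooth functions on a region *)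

(** Nonemptiness makes 1 differ from 0 in the ring of smooth functions below. *)
Record region (R : realType) (n : nat) := Region {
  rset :> set 'rV[R]_n; rset_open : open rset; rset_neq0 : exists v, rset v }.

Arguments rset_open {R n} r.
Arguments rset_neq0 {R n} r.

(* Smooth functions on a region form a ring; extending them by zero outside the
   region makes the representation unique. *)
Record sfun (R : realType) (n : nat) (U : region R n) := Sfun {
  sfval :> 'rV[R]_n -> R;
  sfunP : smooth_on U sfval /\ forall v, ~ rset U v -> sfval v = 0 }.

Section SmoothFunctions.
Context {R : realType} {n : nat} {U : region R n}.
Implicit Types f g : sfun U.

Let Uo : open U. Proof. exact: rset_open. Qed.

HB.instance Definition _ := gen_eqMixin (sfun U).
HB.instance Definition _ := gen_choiceMixin (sfun U).

Lemma sfun_eq f g : (forall v, rset U v -> f v = g v) -> f = g.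
Proof.
move=> fg; have E : sfval f = sfval g.
  apply/funext => v; have [Uv|Uv] := pselect (rset U v); first exact: fg.
  by rewrite (sfunP f).2 // (sfunP g).2.
case: f g E {fg} => [f fP] [g gP] /= E.
by move: fP gP; rewrite E => fP gP; rewrite (Prop_irrelevance fP gP).
Qed.

Lemma mks_subproof (f : 'rV[R]_n -> R) : smooth_on U f ->
  let g := fun v => if `[< rset U v >] then f v else 0 in
  smooth_on U g /\ forall v, ~ rset U v -> g v = 0.
Proof.
move=> fs g; split=> [|v Uv]; last by rewrite /g asboolF.
by apply: (smooth_eq Uo) fs => v Uv; rewrite /g asboolT.
Qed.

Definition mks (f : 'rV[R]_n -> R) (fs : smooth_on U f) : sfun U :=
  Sfun (mks_subproof fs).

Lemma mksE (f : 'rV[R]_n -> R) (fs : smooth_on U f) v : rset U v -> mks fs v = f v.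
Proof. by move=> Uv; rewrite /= asboolT. Qed.

Lemma sfunS f : smooth_on U f. Proof. by have [] := sfunP f. Qed.

Definition sf0 := mks (smooth_cst (0 : R)).
Definition sf1 := mks (smooth_cst (1 : R)).
Definition sfopp f := mks (smoothN Uo (sfunS f)).
Definition sfadd f g := mks (smoothD Uo (sfunS f) (sfunS g)).
Definition sfmul f g := mks (smoothM Uo (sfunS f) (sfunS g)).

Let sf0E' v : rset U v -> sf0 v = 0. Proof. exact: mksE. Qed.
Let sf1E' v : rset U v -> sf1 v = 1. Proof. exact: mksE. Qed.
Let sfoppE f v : rset U v -> sfopp f v = - f v. Proof. exact: mksE. Qed.
Let sfaddE f g v : rset U v -> sfadd f g v = f v + g v. Proof. exact: mksE. Qed.
Let sfmulE f g v : rset U v -> sfmul f g v = f v * g v. Proof. exact: mksE. Qed.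

Let sfaddA : associative sfadd.
Proof. by move=> f g k; apply: sfun_eq => v Uv; rewrite !sfaddE // addrA. Qed.
Let sfaddC : commutative sfadd.
Proof. by move=> f g; apply: sfun_eq => v Uv; rewrite !sfaddE // addrC. Qed.
Let sfadd0 : left_id sf0 sfadd.
Proof. by move=> f; apply: sfun_eq => v Uv; rewrite sfaddE // sf0E' // add0r. Qed.
Let sfaddN : left_inverse sf0 sfopp sfadd.
Proof.
by move=> f; apply: sfun_eq => v Uv; rewrite sfaddE // sfoppE // sf0E' // addNr.
Qed.

HB.instance Definition _ :=
  GRing.isZmodule.Build (sfun U) sfaddA sfaddC sfadd0 sfaddN.

Let sfmulA : associative sfmul.
Proof. by move=> f g k; apply: sfun_eq => v Uv; rewrite !sfmulE // mulrA. Qed.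
Let sfmulC : commutative sfmul.
Proof. by move=> f g; apply: sfun_eq => v Uv; rewrite !sfmulE // mulrC. Qed.
Let sfmul1 : left_id sf1 sfmul.
Proof. by move=> f; apply: sfun_eq => v Uv; rewrite sfmulE // sf1E' // mul1r. Qed.
Let sfmulD : left_distributive sfmul +%R.
Proof.
have addE f g v : rset U v -> (f + g : sfun U) v = f v + g v by exact: sfaddE.
by move=> f g k; apply: sfun_eq => v Uv; rewrite sfmulE // !addE // !sfmulE // mulrDl.
Qed.
Let sf1_neq0 : sf1 != 0.
Proof.
have [v Uv] := rset_neq0 U.
apply/eqP => /(congr1 (fun f => sfval f v)); rewrite sf1E' // sf0E' // => /eqP.
by rewrite oner_eq0.
Qed.

HB.instance Definition _ :=
  GRing.Zmodule_isComNzRing.Build (sfun U) sfmulA sfmulC sfmul1 sfmulD sf1_neq0.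

Lemma sfDE f g v : (f + g) v = f v + g v.
Proof.
have [Uv|Uv] := pselect (rset U v); first by rewrite [LHS]mksE.
by rewrite !(sfunP _).2 // addr0.
Qed.

Lemma sfNE f v : (- f) v = - f v.
Proof.
have [Uv|Uv] := pselect (rset U v); first by rewrite [LHS]mksE.
by rewrite !(sfunP _).2 // oppr0.
Qed.

Lemma sfME f g v : (f * g) v = f v * g v.
Proof.
have [Uv|Uv] := pselect (rset U v); first by rewrite [LHS]mksE.
by rewrite !(sfunP _).2 // mulr0.
Qed.

Lemma sf0E v : (0 : sfun U) v = 0.
Proof.
by have [Uv|Uv] := pselect (rset U v); [rewrite [LHS]mksE|rewrite (sfunP _).2].
Qed.

Lemma sf1E v : rset U v -> (1 : sfun U) v = 1.
Proof. by move=> Uv; rewrite [LHS]mksE. Qed.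

Definition sfcst (c : R) : sfun U := mks (smooth_cst c).

Lemma sfcstE c v : rset U v -> sfcst c v = c.
Proof. by move=> Uv; rewrite mksE. Qed.

Definition der (a : 'I_n) f : sfun U := mks (smooth_partial a (sfunS f)).

Lemma derE a f v : rset U v -> der a f v = partial a f v.
Proof. by move=> Uv; rewrite mksE. Qed.

Lemma der_sub a : zmod_morphism (der a).
Proof.
move=> f g; apply: sfun_eq => v Uv; rewrite sfDE sfNE !derE //.
rewrite /partial -deriveB; first last.
- exact: smooth_derivable (sfunS g).
- exact: smooth_derivable (sfunS f).
by apply: (partial_eq _ Uo Uv) => w Uw; rewrite sfDE sfNE.
Qed.

HB.instance Definition _ a := GRing.isZmodMorphism.Build (sfun U) (sfun U) (der a) (der_sub a).

Lemma der_mul a f g : der a (f * g) = der a f * g + f * der a g.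
Proof.
apply: sfun_eq => v Uv; rewrite sfDE !sfME !derE //.
have -> : partial a (f * g) v = partial a (sfval f * sfval g) v.
  by apply: (partial_eq _ Uo Uv) => w Uw; rewrite sfME.
rewrite /partial deriveM; first last.
- exact: smooth_derivable (sfunS g).
- exact: smooth_derivable (sfunS f).
by rewrite addrC [X in X + _]mulrC.
Qed.

Lemma derC a b f : der a (der b f) = der b (der a f).
Proof.
apply: sfun_eq => v Uv; rewrite (derE a _ Uv) (derE b _ Uv).
transitivity (partial a (partial b f) v).
  by apply: (partial_eq _ Uo Uv) => w Uw; rewrite derE.
rewrite (smooth_partialC Uo a b Uv (sfunS f)).
by apply: (partial_eq _ Uo Uv) => w Uw; rewrite derE.
Qed.

Lemma der_cst a c : der a (sfcst c) = 0.
Proof.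
apply: sfun_eq => v Uv; rewrite derE // sf0E.
transitivity (partial a (cst c) v); last exact: derive_cst.
by apply: (partial_eq _ Uo Uv) => w Uw; rewrite sfcstE.
Qed.

End SmoothFunctions.

Arguments der {R n U}.
Arguments sfcst {R n} U.

Section Evaluation.
Context {R : realType} {n : nat} (U : region R n).

(** The membership proof is bundled with the point because evaluation preserves 1 only inside the
    region. *)
Record rpoint := Rpoint { rpt : 'rV[R]_n; rptP : rset U rpt }.

Definition ev (p : rpoint) (f : sfun U) : R := f (rpt p).

Lemma ev_sub p : zmod_morphism (ev p).
Proof. by move=> f g; rewrite /ev sfDE sfNE. Qed.

Lemma ev_mul p : monoid_morphism (ev p).
Proof. by split=> [|f g]; rewrite /ev ?sfME // sf1E //; exact: rptP. Qed.

HB.instance Definition _ p := GRing.isZmodMorphism.Build (sfun U) R (ev p) (ev_sub p).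
HB.instance Definition _ p := GRing.isMonoidMorphism.Build (sfun U) R (ev p) (ev_mul p).

End Evaluation.

Section Pullback.
Context {R : realType} {n p : nat} (U : region R n) (V : region R p).

Record smap := Smap { smfun :> 'rV[R]_n -> 'rV[R]_p;
  smapP : (forall v, rset U v -> rset V (smfun v)) /\ smooth_map_on U smfun }.

Implicit Type F : smap.

Lemma pb_subproof F (f : sfun V) : smooth_on U (f \o F).
Proof.
have [FV Fs] := smapP F.
exact: smooth_comp (rset_open U) (rset_open V) FV (sfunS f) Fs.
Qed.

Definition pb F (f : sfun V) : sfun U := mks (pb_subproof F f).

Lemma pbE F f v : rset U v -> pb F f v = f (F v).
Proof. by move=> Uv; rewrite mksE. Qed.

Lemma pb_sub F : zmod_morphism (pb F).
Proof. by move=> f g; apply: sfun_eq => v Uv; rewrite !(sfDE, sfNE) !pbE // sfDE sfNE. Qed.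

Lemma pb_mul F : monoid_morphism (pb F).
Proof.
have [FV Fs] := smapP F.
split=> [|f g]; apply: sfun_eq => v Uv; rewrite ?sfME !pbE // ?sfME //.
by rewrite !sf1E //; exact: FV.
Qed.

HB.instance Definition _ F := GRing.isZmodMorphism.Build (sfun V) (sfun U) (pb F) (pb_sub F).
HB.instance Definition _ F := GRing.isMonoidMorphism.Build (sfun V) (sfun U) (pb F) (pb_mul F).

Definition smcoord F k : sfun U := mks ((smapP F).2 k).

Lemma pb_cst F c : pb F (sfcst V c) = sfcst U c.
Proof.
have [FV _] := smapP F.
by apply: sfun_eq => v Uv; rewrite pbE // !sfcstE //; exact: FV.
Qed.

Lemma der_pb F a f : der a (pb F f) = \sum_k der a (smcoord F k) * pb F (der k f).
Proof.
have [FV Fs] := smapP F.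
apply: sfun_eq => v Uv; rewrite derE //.
transitivity (partial a (sfval f \o F) v).
  by apply: (partial_eq _ (rset_open U) Uv) => w Uw; rewrite pbE.
rewrite (smooth_partial_comp a (rset_open U) (rset_open V) Uv (FV _ Uv) (sfunS f) Fs).
rewrite -[RHS]/(ev (Rpoint Uv) _) rmorph_sum; apply: eq_bigr => k _.
rewrite rmorphM /ev /= !asboolT //; last exact: FV.
congr (_ * _); apply: (partial_eq _ (rset_open U) Uv) => w Uw.
by rewrite asboolT.
Qed.

End Pullback.

Section InverseMatrix.
Context {R : realType} {n : nat} (U : set 'rV[R]_n).
Hypothesis Uo : open U.

Lemma smooth_det m (M : 'rV[R]_n -> 'M[R]_m) :
  (forall i j, smooth_on U (fun v => M v i j)) -> smooth_on U (fun v => \det (M v)).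
Proof.
move=> Ms; apply: smooth_sum => // s; apply: (smoothM Uo).
  exact: smooth_cst.
by apply: smooth_prod.
Qed.

(** Cramer's rule: the entries of the inverse are cofactors divided by the determinant. *)
Lemma smooth_invmx m (M : 'rV[R]_n -> 'M[R]_m) :
  (forall i j, smooth_on U (fun v => M v i j)) ->
  (forall v, U v -> M v \in unitmx) ->
  forall i j, smooth_on U (fun v => invmx (M v) i j).
Proof.
move=> Ms Mu i j.
apply: (@smooth_eq _ _ _ Uo (fun v => (\det (M v))^-1 *
    ((-1) ^+ (j + i) * \det (row' j (col' i (M v)))))).
  by move=> v Uv; rewrite /invmx Mu // !mxE.
apply: (smoothM Uo); first apply: (smoothV Uo).
- by move=> v /Mu; rewrite unitmxE unitfE.
- exact: smooth_det.
apply: (smoothM Uo); first exact: smooth_cst.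
apply: smooth_det => k l.
by apply: (smooth_eq Uo) (Ms (lift j k) (lift i l)) => w _; rewrite !mxE.
Qed.

End InverseMatrix.

#[global] Opaque mks der sfcst pb smcoord.


(** * Positive definite matrices and self-adjoint operators *)

Section PositiveDefinite.
Context {R : realType}.

Lemma discriminant_le0 (A B C : R) : 0 <= A ->
  (forall x, 0 <= A * x ^+ 2 + (B * x) *+ 2 + C) -> B ^+ 2 <= A * C.
Proof.
rewrite le_eqVlt => /predU1P[A0|A0] H.
  have [->|B0] := eqVneq B 0; first by rewrite expr0n -A0 mul0r.
  (* At this point the polynomial, affine because [A] is 0, takes the value -1. *)
  have := H (- (C + 1) / (B *+ 2)); rewrite -A0 mul0r add0r.
  rewrite (_ : _ *+ 2 + C = - 1); last by field.
  by rewrite oppr_ge0 ler10.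
have An : A != 0 by rewrite gt_eqF.
have := H (- B / A); rewrite -(ler_pM2l A0) mulr0 -subr_ge0 => K.
by rewrite -subr_ge0 (le_trans K) // le_eqVlt; apply/orP; left; apply/eqP; field.
Qed.

Definition posdef n (g : 'M[R]_n) := forall u, u != 0 -> 0 < inner g u u.

Lemma innerE n (g : 'M[R]_n) u v : inner g u v = (u *m g *m v^T) 0 0.
Proof. by []. Qed.

(** Congruence to the identity by induction on the size: [L] clears the first row and column, [D']
    is the Schur complement, and the pivot [k] is normalized by its square root. *)
Lemma posdef_factor n (g : 'M[R]_n) : g^T = g -> posdef g ->
  exists2 E, E \in unitmx & E *m g *m E^T = 1%:M.
Proof.
elim: n g => [|n IH] g gT gpos.
  by exists 1%:M; [exact: unitmx1|apply/matrixP; case].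
rewrite -[n.+1]/(1 + n)%N in g gT gpos *.
pose a := ulsubmx g; pose b := ursubmx g; pose D := drsubmx g.
have bT : dlsubmx g = b^T by rewrite /b trmx_ursub gT.
have DT : D^T = D by rewrite /D trmx_drsub gT.
have gE : g = block_mx a b b^T D by rewrite -bT submxK.
pose k := a 0 0.
have ak : a = k%:M by exact: mx11_scalar.
have k0 : 0 < k.
  have := gpos (row_mx 1%:M 0); rewrite innerE gE mul_row_block !mul1mx !mul0mx !addr0.
  rewrite tr_row_mx mul_row_col trmx1 mulmx1 trmx0 mulmx0 addr0; apply.
  by rewrite row_mx_eq0 negb_and (oner_neq0 'M[R]_1 : (1%:M : 'M[R]_1) != 0).
have kn : k != 0 by rewrite gt_eqF.
pose L : 'M[R]_(1 + n) := block_mx 1%:M 0 (- (k^-1 *: b^T)) 1%:M.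
pose D' := D - k^-1 *: (b^T *m b).
have LgL : L *m g *m L^T = block_mx k%:M 0 0 D'.
  rewrite gE /L tr_block_mx !mulmx_block !(trmx1, trmx0, mul1mx, mulmx1, mul0mx, mulmx0, addr0, add0r).
  rewrite ak !mulNmx -!scalemxAl mul_mx_scalar scalerA mulVf // scale1r addNr.
  congr block_mx.
    rewrite linearN /= linearZ /= trmxK mulmxN -scalemxAr mul_scalar_mx scalerA mulVf //.
    by rewrite scale1r addNr.
  by rewrite mul0mx add0r addrC.
have [E' E'u E'E] : exists2 E', E' \in unitmx & E' *m D' *m E'^T = 1%:M.
  apply: IH => [|u u0].
    by rewrite /D' linearB /= linearZ /= trmx_mul trmxK DT.
  have uL : row_mx 0 u *m L != 0.
    rewrite /L mul_row_block mul0mx mulmx1 add0r.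
    by rewrite row_mx_eq0 negb_and mul0mx add0r u0 orbT.
  have := gpos _ uL.
  rewrite innerE trmx_mul !mulmxA -[_ *m L *m g]mulmxA -[_ *m (L *m g) *m L^T]mulmxA LgL.
  by rewrite mul_row_block !mul0mx mulmx0 !add0r tr_row_mx mul_row_col mul0mx add0r.
pose K : 'M[R]_(1 + n) := block_mx ((Num.sqrt k)^-1)%:M 0 0 E'.
have E1 : K *m L *m g *m (K *m L)^T = 1%:M.
  rewrite trmx_mul !mulmxA -[_ *m L *m g]mulmxA -[_ *m (L *m g) *m L^T]mulmxA LgL.
  rewrite /K tr_block_mx !mulmx_block !(trmx0, mul0mx, mulmx0, addr0, add0r) E'E.
  rewrite tr_scalar_mx -!scalar_mxM mulrAC -invfM -expr2 sqr_sqrtr ?ltW // mulVf //.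
  by rewrite -scalar_mx_block.
exists (K *m L) => //.
by move: E1; rewrite -mulmxA => /mulmx1_unit[].
Qed.

Section Factored.
Variables (n : nat) (g q E : 'M[R]_n).
Hypotheses (gT : g^T = g) (qg : q *m g = 1%:M).
Hypotheses (Eu : E \in unitmx) (EgE : E *m g *m E^T = 1%:M).

Lemma inverse_factor : q = E^T *m E.
Proof.
have : g *m (E^T *m E) = 1%:M by rewrite mulmxA mulmx1C // mulmxA.
by move=> H; rewrite -[q]mulmx1 -H !mulmxA qg mul1mx.
Qed.

Let invT : (invmx E)^T = E *m g.
Proof.
have H1 : (invmx E *m E)^T = 1%:M by rewrite mulVmx // trmx1.
by rewrite -[RHS]mulmx1 -H1 trmx_mul !mulmxA EgE mul1mx.
Qed.

(** As q = E^T E, the contraction is the sum of the values of the quadratic form [H] on the rows of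
    [E]. *)
Lemma contract_nonpos (H : 'M[R]_n) :
  (forall u : 'rV[R]_n, \sum_a \sum_b u 0 a * u 0 b * H a b <= 0) ->
  \sum_a \sum_b q a b * H a b <= 0.
Proof.
move=> Hneg.
have -> : \sum_a \sum_b q a b * H a b =
    \sum_k \sum_a \sum_b (row k E) 0 a * (row k E) 0 b * H a b.
  rewrite [RHS]exchange_big; apply: eq_bigr => a _.
  rewrite [RHS]exchange_big; apply: eq_bigr => b _ /=.
  by rewrite inverse_factor mxE mulr_suml; apply: eq_bigr => k _; rewrite !mxE.
by apply: sumr_le0 => k _.
Qed.

(** Quantitative ellipticity: with g = F F^T for the inverse [F] of [E], this is the Cauchy-Schwarz
    inequality in each coordinate. An upper bound for the trace of [g] thus bounds the form [q] from
    below. *)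
Lemma quad_lower (u : 'rV[R]_n) :
  \sum_i u 0 i ^+ 2 <= \tr g * \sum_a \sum_b u 0 a * u 0 b * q a b.
Proof.
pose F := invmx E; pose w := u *m E^T.
have FF : g = F *m F^T.
  by rewrite invT mulmxA mulVmx // mul1mx.
have uE : u = w *m F^T.
  by rewrite /w -mulmxA -trmx_mul mulVmx // trmx1 mulmx1.
have -> : \sum_a \sum_b u 0 a * u 0 b * q a b = \sum_k w 0 k ^+ 2.
  transitivity ((w *m w^T) 0 0); last first.
    by rewrite [LHS]mxE; apply: eq_bigr => k _; rewrite trmxE expr2.
  rewrite /w trmx_mul trmxK !mulmxA -[_ *m E^T *m E]mulmxA -inverse_factor mxE.
  rewrite exchange_big; apply: eq_bigr => b _ /=.
  rewrite mxE mulr_suml; apply: eq_bigr => a _; rewrite mxE; ring.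
have -> : \tr g = \sum_i \sum_k F i k ^+ 2.
  rewrite FF /mxtrace; apply: eq_bigr => i _; rewrite [LHS]mxE.
  by apply: eq_bigr => k _; rewrite trmxE expr2.
rewrite mulr_suml; apply: ler_sum => i _.
have -> : u 0 i = \sum_k F i k * w 0 k.
  by rewrite uE [LHS]mxE; apply: eq_bigr => k _; rewrite trmxE mulrC.
apply: discriminant_le0 => [|x]; first by apply: sumr_ge0 => k _; exact: sqr_ge0.
rewrite !mulr_suml -sumrMnl -!big_split sumr_ge0 // => k _ /=.
rewrite (_ : _ + _ = (F i k * x + w 0 k) ^+ 2) ?sqr_ge0 //; ring.
Qed.

(** Conjugation by [E] turns operators that are self-adjoint for [g] into symmetric matrices, and
    the contracted trace into a sum of squares. *)
Lemma selfadjoint_trsq (S : 'I_n -> 'M[R]_n) :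
  (forall a, (S a *m g)^T = S a *m g) ->
  0 <= \sum_a \sum_b q a b * \tr (S a *m S b) /\
  (\sum_a \sum_b q a b * \tr (S a *m S b) = 0 -> forall a, S a = 0).
Proof.
move=> Ssym; pose F := invmx E; pose T a := E *m S a *m F.
have EF : E *m F = 1%:M by rewrite mulmxV.
have FE : F *m E = 1%:M by rewrite mulVmx.
have FT : F^T = E *m g by exact: invT.
have FgE : F = g *m E^T by rewrite -[RHS]mul1mx -FE -!mulmxA [E *m _]mulmxA EgE mulmx1.
have TT a : (T a)^T = T a.
  rewrite /T !trmx_mul FT !mulmxA -(mulmxA E g).
  have -> : g *m (S a)^T = S a *m g by rewrite -{1}gT -trmx_mul Ssym.
  by rewrite FgE !mulmxA.
have trT a b : \tr (S a *m S b) = \tr (T a *m T b).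
  rewrite /T -!mulmxA [F *m (E *m _)]mulmxA FE mul1mx [RHS]mxtrace_mulC -!mulmxA.
  by rewrite FE mulmx1.
have trE a b : \tr (S a *m S b) = \sum_i \sum_j T a i j * T b i j.
  rewrite trT /mxtrace; apply: eq_bigr => i _; rewrite mxE; apply: eq_bigr => j _.
  by congr (_ * _); rewrite -{1}(TT b) trmxE.
have -> : \sum_a \sum_b q a b * \tr (S a *m S b) =
    \sum_i \sum_j \sum_k (\sum_a E k a * T a i j) ^+ 2.
  have qE a b : q a b = \sum_k E k a * E k b.
    by rewrite inverse_factor mxE; apply: eq_bigr => k _; rewrite mxE.
  transitivity (\sum_a \sum_b \sum_i \sum_j \sum_k (E k a * T a i j) * (E k b * T b i j)).
    apply: eq_bigr => a _; apply: eq_bigr => b _; rewrite trE mulr_sumr.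
    apply: eq_bigr => i _; rewrite mulr_sumr; apply: eq_bigr => j _.
    rewrite qE mulr_suml; apply: eq_bigr => k _; ring.
  under eq_bigr => a _ do rewrite exchange_big.
  rewrite exchange_big; apply: eq_bigr => i _ /=.
  under eq_bigr => a _ do rewrite exchange_big.
  rewrite exchange_big; apply: eq_bigr => j _ /=.
  under eq_bigr => a _ do rewrite exchange_big.
  rewrite exchange_big; apply: eq_bigr => k _ /=.
  rewrite expr2 mulr_suml; apply: eq_bigr => a _; by rewrite mulr_sumr.
split=> [|H a].
  do 3![apply: sumr_ge0 => ? _]; exact: sqr_ge0.
suff Ta : T a = 0.
  have -> : S a = F *m T a *m E by rewrite /T !mulmxA FE mul1mx -mulmxA FE mulmx1.
  by rewrite Ta mulmx0 mul0mx.
apply/matrixP => i j; rewrite mxE.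
pose z : 'cV[R]_n := \col_a T a i j.
suff : z = 0 by move=> /colP/(_ a); rewrite !mxE.
rewrite -[z]mul1mx -FE -mulmxA; suff -> : E *m z = 0 by rewrite mulmx0.
apply/colP => k; rewrite !mxE.
have /eqP : \sum_a E k a * T a i j = 0.
  apply/eqP; rewrite -sqrf_eq0.
  move/eqP: H; rewrite psumr_eq0 => [/allP/(_ i)|i' _]; last first.
    by do 2![apply: sumr_ge0 => ? _]; exact: sqr_ge0.
  rewrite mem_index_enum => /(_ isT); rewrite psumr_eq0 => [/allP/(_ j)|j' _]; last first.
    by apply: sumr_ge0 => ? _; exact: sqr_ge0.
  rewrite mem_index_enum => /(_ isT); rewrite psumr_eq0 => [/allP/(_ k)|k' _]; last exact: sqr_ge0.
  by rewrite mem_index_enum => /(_ isT).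
by move=> /eqP H'; rewrite -[RHS]H'; apply: eq_bigr => a' _; rewrite mxE.
Qed.

Lemma selfadjoint_trsq1 (S : 'M[R]_n) : (S *m g)^T = S *m g ->
  0 <= \tr (S *m S) /\ (\tr (S *m S) = 0 -> S = 0).
Proof.
move=> Ssym; pose F := invmx E; pose T := E *m S *m F.
have EF : E *m F = 1%:M by rewrite mulmxV.
have FE : F *m E = 1%:M by rewrite mulVmx.
have FT : F^T = E *m g by exact: invT.
have FgE : F = g *m E^T by rewrite -[RHS]mul1mx -FE -!mulmxA [E *m _]mulmxA EgE mulmx1.
have TT : T^T = T.
  rewrite /T !trmx_mul FT !mulmxA -(mulmxA E g).
  have -> : g *m S^T = S *m g by rewrite -{1}gT -trmx_mul Ssym.
  by rewrite FgE !mulmxA.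
have -> : \tr (S *m S) = \sum_i \sum_j T i j ^+ 2.
  transitivity (\tr (T *m T)).
    rewrite /T -!mulmxA [F *m (E *m _)]mulmxA FE mul1mx [RHS]mxtrace_mulC -!mulmxA.
    by rewrite FE mulmx1.
  rewrite /mxtrace; apply: eq_bigr => i _; rewrite mxE; apply: eq_bigr => j _.
  by rewrite expr2; congr (_ * _); rewrite -{1}TT trmxE.
split=> [|H]; first by do 2![apply: sumr_ge0 => ? _]; exact: sqr_ge0.
suff T0 : T = 0.
  have -> : S = F *m T *m E by rewrite /T !mulmxA FE mul1mx -mulmxA FE mulmx1.
  by rewrite T0 mulmx0 mul0mx.
apply/matrixP => i j; rewrite [RHS]mxE; apply/eqP; rewrite -sqrf_eq0.
move/eqP: H; rewrite psumr_eq0 => [/allP/(_ i)|i' _]; last first.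
  by apply: sumr_ge0 => ? _; exact: sqr_ge0.
rewrite mem_index_enum => /(_ isT); rewrite psumr_eq0 => [/allP/(_ j)|j' _]; last exact: sqr_ge0.
by rewrite mem_index_enum => /(_ isT).
Qed.

End Factored.

End PositiveDefinite.


(** * Maximum principles *)

Section CompositionDerivative.
Context {R : realType} {n : nat} (U : region R n).
Variables (I : set R) (h : R -> R) (f : sfun U).
Hypotheses (hs : smooth_fun_on I h) (fI : forall v, rset U v -> I (f v)).

Definition sfcomp : sfun U := mks (smooth_comp1 (rset_open U) hs fI (sfunS f)).

Lemma sfcompE v : rset U v -> sfcomp v = h (f v).
Proof. exact: mksE. Qed.

Lemma der_sfcomp a v : rset U v -> der a sfcomp v = derive1 h (f v) * der a f v.
Proof.
move=> Uv; rewrite !(derE a _ Uv).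
have [_ <-] := comp1_is_derive (@smooth_derivable _ _ U f v a Uv (sfunS f)) (@hs 0%N _ (@fI v Uv)).
by apply: (partial_eq _ (rset_open U) Uv) => w Uw; rewrite sfcompE.
Qed.

End CompositionDerivative.

Section LocalMaximum.
Context {R : realType} {n : nat} (U : region R n).
Implicit Type w : sfun U.

Lemma der_sum_lincomb (c : 'I_n -> R) (F : 'I_n -> sfun U) b v : rset U v ->
  der b (\sum_a sfcst U (c a) * F a) v = \sum_a c a * der b (F a) v.
Proof.
move=> Uv; have -> : der b (\sum_a sfcst U (c a) * F a) = \sum_a sfcst U (c a) * der b (F a).
  by rewrite raddf_sum; apply: eq_bigr => a _; rewrite [LHS]der_mul der_cst mul0r add0r.
rewrite -[LHS]/(ev (Rpoint Uv) _) rmorph_sum.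
by apply: eq_bigr => a _; rewrite -[LHS]/((_ * _ : sfun U) v) sfME sfcstE.
Qed.

Lemma sfderive w v xi : rset U v -> 'D_xi w v = \sum_a xi 0 a * der a w v.
Proof.
move=> Uv; rewrite deriveE_partial; last exact: (@smooth_differentiable _ _ U (rset_open U) w v Uv (sfunS w)).
by apply: eq_bigr => a _; rewrite (derE a _ Uv).
Qed.

Lemma line_in_region v (xi : 'rV[R]_n) (P : set 'rV[R]_n) : nbhs v P ->
  exists2 t, 0 < t & forall s, `|s| < t -> P (s *: xi + v).
Proof.
move=> /nbhs_ballP[d /= d0]; rewrite -ball_normE => Bd.
have x1 : 0 < `|xi| + 1 by rewrite ltr_pwDr.
exists (d / (`|xi| + 1)); first by rewrite divr_gt0.
move=> s st; apply: Bd => /=; rewrite opprD addrCA subrr addr0 normrN normrZ.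
rewrite ltr_pdivlMr // in st; apply: le_lt_trans st.
by rewrite ler_wpM2l // lerDl.
Qed.

Lemma sfline w v xi s : rset U (s *: xi + v) ->
  is_derive s 1 (fun s : R => w (s *: xi + v)) (\sum_a xi 0 a * der a w (s *: xi + v)).
Proof.
move=> Us; rewrite -(sfderive _ _ Us); apply: line_is_derive.
exact: diff_derivable (@smooth_differentiable _ _ U (rset_open U) w _ Us (sfunS w)).
Qed.

(** If the second derivative in a direction [xi] were positive, then the first one, which vanishes
    at [v], would be positive just after [v], and by the mean value theorem [w] would exceed its
    maximum. *)
Lemma sfun_local_max w v : rset U v -> (\forall x \near v, w x <= w v) ->
  (forall a, der a w v = 0) /\
  (forall xi : 'rV[R]_n, \sum_a \sum_b xi 0 a * xi 0 b * der a (der b w) v <= 0).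
Proof.
move=> Uv wmax.
have near0 : \forall x \near v, rset U x /\ w x <= w v.
  by apply: filterI => //; apply: open_nbhs_nbhs; split => //; exact: rset_open.
have first_order (xi : 'rV[R]_n) : \sum_a xi 0 a * der a w v = 0.
  have [t t0 tP] := @line_in_region v xi _ near0.
  pose ph (s : R) := w (s *: xi + v).
  have tt : - t <= t by rewrite (le_trans (y := 0)) ?oppr_le0 // ltW.
  have inI s : s \in `]- t, t[ -> rset U (s *: xi + v) /\ ph s <= ph 0.
    rewrite in_itv /= -ltr_norml => /tP; by rewrite {2}/ph scale0r add0r.
  have d0 : is_derive (0:R) (1:R) ph 0.
    apply: (@derive1_at_max _ ph _ _ _ tt) => [s /inI[Us _]||s /inI[]//].
      by have [] := sfline w Us.
    by rewrite in_itv /= oppr_lt0 t0.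
  have U0 : rset U (0 *: xi + v) by rewrite scale0r add0r.
  have [_ E0] := d0; have [_ E1] := sfline w U0.
  by rewrite -[RHS]E0 [RHS]E1 scale0r add0r.
split=> [a|xi].
  have := first_order (delta_mx 0 a); rewrite (bigD1 a) //= big1 ?addr0 => [|b ba].
    by rewrite mxE !eqxx mul1r.
  by rewrite mxE (negbTE ba) andbF mul0r.
pose w1 : sfun U := \sum_a sfcst U (xi 0 a) * der a w.
have w1E x : rset U x -> w1 x = \sum_a xi 0 a * der a w x.
  move=> Ux; rewrite -[LHS]/(ev (Rpoint Ux) _) rmorph_sum; apply: eq_bigr => a _.
  by rewrite -[LHS]/((_ * _ : sfun U) x) sfME sfcstE.
have -> : \sum_a \sum_b xi 0 a * xi 0 b * der a (der b w) v =
    \sum_a xi 0 a * der a w1 v.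
  have dw1 a : der a w1 v = \sum_b xi 0 b * der a (der b w) v.
    exact: (der_sum_lincomb (fun b => xi 0 b) (fun b => der b w) a Uv).
  apply: eq_bigr => a _; rewrite dw1 mulr_sumr.
  by apply: eq_bigr => b _; rewrite mulrA.
rewrite leNgt; apply/negP; set c := (\sum_a _) => c0.
have [t t0 tP] := @line_in_region v xi _ near0.
have U0 : rset U (0 *: xi + v) by rewrite scale0r add0r.
have [dc dE] := sfline w1 U0.
have : \forall s \near (0 : R)^', 0 < s^-1 * w1 (s *: xi + v).
  have : (fun s : R => s^-1 * w1 (s *: xi + v)) @ (0:R)^' --> c.
    have w10 : w1 v = 0 by rewrite w1E // first_order.
    have -> : c = 'D_1 (fun s : R => w1 (s *: xi + v)) 0 by rewrite dE scale0r add0r.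
    rewrite (_ : (fun s : R => _) = (fun h : R => h^-1 *: (((fun s : R => w1 (s *: xi + v))
       \o shift 0) (h *: 1) - w1 (0 *: xi + v)))); first exact: dc.
    by apply/funext => s /=; rewrite addr0 [s *: 1]mulr1 scale0r add0r w10 subr0.
  by move=> /cvgr_gt; apply.
rewrite near_withinE => /nbhs_ballP[d /= d0]; rewrite -ball_normE => Bd.
pose s0 := Num.min d t / 2.
have s00 : 0 < s0 by rewrite divr_gt0 // lt_min d0 t0.
have s0m : s0 < Num.min d t by rewrite /s0 ltr_pdivrMr // ltr_pMr ?ltr1n // lt_min d0 t0.
have [s0d s0t] : s0 < d /\ s0 < t by move: s0m; rewrite lt_min => /andP[].
pose ph (s : R) := w (s *: xi + v).
have inU s : 0 <= s <= s0 -> rset U (s *: xi + v).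
  by move=> /andP[s1 s2]; have [] := tP s; rewrite // ger0_norm // (le_lt_trans s2).
have [||s sI E] := @MVT R ph (fun s => w1 (s *: xi + v)) 0 s0 s00.
- move=> s; rewrite in_itv /= => /andP[s1 s2].
  by rewrite w1E; [apply: sfline|]; apply: inU; rewrite !ltW.
- apply: derivable_within_continuous => s; rewrite in_itv /= => sI.
  by have [] := sfline w (inU _ sI).
have s0t' : `|s0| < t by rewrite gtr0_norm.
have [_] := tP s0 s0t'.
have : ph 0 = w v by rewrite /ph scale0r add0r.
rewrite -/(ph s0) => <-; rewrite -subr_le0 E subr0 leNgt => /negP; apply.
move: sI; rewrite in_itv /= => /andP[s1 s2].
rewrite mulr_gt0 //; have := Bd s; rewrite /= sub0r normrN gtr0_norm // (lt_trans s2) //.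
by move=> /(_ isT); rewrite gt_eqF // => /(_ isT); rewrite pmulr_rgt0 // invr_gt0.
Qed.

Lemma elliptic_max w v (g q : 'M[R]_n) : rset U v -> (\forall x \near v, w x <= w v) ->
  g^T = g -> posdef g -> q *m g = 1%:M ->
  (forall a, der a w v = 0) /\ \sum_a \sum_b q a b * der a (der b w) v <= 0.
Proof.
move=> Uv wmax gT gp qg; have [w0 w2] := sfun_local_max Uv wmax; split=> //.
have [E Eu EgE] := posdef_factor gT gp.
rewrite (eq_bigr (fun a => \sum_b q a b * (\matrix_(a, b) der a (der b w) v) a b)).
  apply: (contract_nonpos qg EgE) => u.
  apply: le_trans (w2 u); rewrite le_eqVlt; apply/orP; left; apply/eqP.
  by apply: eq_bigr => a _; apply: eq_bigr => b _; rewrite mxE.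
by move=> a _; apply: eq_bigr => b _; rewrite mxE.
Qed.


Definition sfX (i : 'I_n) : sfun U := mks (smooth_coord i).

Lemma sfXE i v : rset U v -> sfX i v = v 0 i.
Proof. exact: mksE. Qed.

Lemma der_sfX a i : der a (sfX i) = (a == i)%:R.
Proof.
apply: sfun_eq => v Uv; rewrite (derE a _ Uv).
transitivity (partial a (fun v => v 0 i) v).
  by apply: (partial_eq _ (rset_open U) Uv) => w Uw; rewrite sfXE.
have [_ E] := coord_is_derive v (delta_mx 0 a) i.
rewrite [LHS]E mxE eqxx eq_sym -[RHS]/(ev (Rpoint Uv) _).
by rewrite rmorph_nat.
Qed.

(** The norm on row vectors is the sup norm, whereas Hopf's barrier lives on Euclidean balls; hence
    a separate squared distance. *)
Definition sqdist (z : 'rV[R]_n) : sfun U := \sum_i (sfX i - sfcst U (z 0 i)) ^+ 2.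

Lemma sqdistE z v : rset U v -> sqdist z v = \sum_i (v 0 i - z 0 i) ^+ 2.
Proof.
move=> Uv; rewrite -[LHS]/(ev (Rpoint Uv) _) rmorph_sum; apply: eq_bigr => i _.
by rewrite -[LHS]/((_ ^+ 2 : sfun U) v) expr2 sfME sfDE sfNE sfXE // sfcstE // expr2.
Qed.

Lemma derD a (f k : sfun U) : der a (f + k) = der a f + der a k.
Proof. exact: raddfD. Qed.

Lemma derB a (f k : sfun U) : der a (f - k) = der a f - der a k.
Proof. exact: raddfB. Qed.

Lemma der_sqdist z a : der a (sqdist z) = (sfX a - sfcst U (z 0 a)) *+ 2.
Proof.
have E i : der a ((sfX i - sfcst U (z 0 i)) ^+ 2) =
    if i == a then (sfX i - sfcst U (z 0 i)) *+ 2 else 0.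
  rewrite expr2 [LHS]der_mul derB der_cst der_sfX eq_sym.
  by case: eqP => _; [rewrite (_ : true%:R = 1) //; ring|rewrite (_ : false%:R = 0) //; ring].
rewrite raddf_sum (eq_bigr _ (fun i _ => E i)) -big_mkcond.
exact: big_pred1_eq.
Qed.

End LocalMaximum.


(** * Compactness and Hopf's strong maximum principle *)

Section CompactSublevel.
Context {R : realType}.

(** A cluster point in [K] with value above [c] would have a neighbourhood that misses the sublevel
    set. *)
Lemma compact_sublevel (T : topologicalType) (K : set T) (f : T -> R) c :
  compact K -> (forall p, K p -> {for p, continuous f}) ->
  compact (K `&` [set x | f x <= c]).
Proof.
move=> Kc fc F FF FK; have [|p [Kp cp]] := Kc F FF.
  by apply: filterS FK => x [].
exists p; split=> //; split=> //=; rewrite leNgt; apply/negP => cfp.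
have N : \forall x \near p, c < f x by have := cvgr_gt (f p) (fc p Kp); apply.
by have [x [[_ /= H1] H2]] := cp _ _ FK N; move: H1; rewrite leNgt H2.
Qed.

Lemma compact_min (T : topologicalType) (K : set T) (f : T -> R) : K !=set0 ->
  compact K -> (forall p, K p -> {for p, continuous f}) ->
  exists2 p, K p & forall x, K x -> f p <= f x.
Proof.
move=> K0 Kc fc; have [|p] := @compact_EVT_min _ _ f K K0 Kc.
  by apply: continuous_in_subspaceT => p; rewrite inE; exact: fc.
by rewrite inE => Kp pm; exists p => // x Kx; apply: pm; rewrite inE.
Qed.

Definition box n (y : 'rV[R]_n) (r : R) : set 'rV[R]_n :=
  [set v | forall i, `|v 0 i - y 0 i| <= r].

Lemma box_compact n (y : 'rV[R]_n) r : compact (box y r).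
Proof.
have := @rV_compact R n (fun i => `[y 0 i - r, y 0 i + r]%classic) (fun i => @segment_compact R _ _).
rewrite (_ : [set v | _] = box y r) //; apply/seteqP; split=> v /= H i.
  by have := H i; rewrite /= in_itv /= -ler_distl.
by have := H i; rewrite /= in_itv /= -ler_distl.
Qed.

End CompactSublevel.

Section Hopf.
Context {R : realType} {n : nat} (U : region R n).
Variables (w : sfun U) (a g : 'rV[R]_n -> 'M[R]_n) (b : 'rV[R]_n -> 'rV[R]_n).
Variables (Lam C : R).
Hypotheses (C0 : 0 <= C).
Hypothesis gT : forall x, rset U x -> (g x)^T = g x.
Hypothesis gpos : forall x, rset U x -> posdef (g x).
Hypothesis ag : forall x, rset U x -> a x *m g x = 1%:M.
Hypothesis trg : forall x, rset U x -> \tr (g x) <= Lam.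
Hypothesis tra : forall x, rset U x -> \tr (a x) <= Lam.
Hypothesis bb : forall x, rset U x -> forall i, `|b x 0 i| <= Lam.

Definition lop (f : sfun U) x : R :=
  \sum_i \sum_j a x i j * der i (der j f) x + \sum_i b x 0 i * der i f x.

Lemma lopB f k c x : rset U x -> lop (f - sfcst U c * k) x = lop f x - c * lop k x.
Proof.
move=> Ux.
have E i (h1 h2 : sfun U) : der i (h1 - sfcst U c * h2) = der i h1 - sfcst U c * der i h2.
  by rewrite derB [X in _ - X]der_mul der_cst mul0r add0r.
have E1 i : der i (f - sfcst U c * k) x = der i f x - c * der i k x.
  by rewrite E sfDE sfNE sfME sfcstE.
have E2 i j : der i (der j (f - sfcst U c * k)) x =
    der i (der j f) x - c * der i (der j k) x.
  by rewrite !E sfDE sfNE sfME sfcstE.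
have S (A F K : 'I_n -> 'I_n -> R) (B f1 k1 : 'I_n -> R) :
    \sum_i \sum_j A i j * (F i j - c * K i j) + \sum_i B i * (f1 i - c * k1 i) =
    \sum_i \sum_j A i j * F i j + \sum_i B i * f1 i -
    c * (\sum_i \sum_j A i j * K i j + \sum_i B i * k1 i).
  rewrite mulrDr opprD addrACA !mulr_sumr -!sumrB; congr (_ + _).
    apply: eq_bigr => i _; rewrite mulr_sumr -sumrB.
    by apply: eq_bigr => j _; ring.
  by apply: eq_bigr => i _; ring.
apply: etrans _ (S (fun i j => a x i j) (fun i j => der i (der j f) x)
  (fun i j => der i (der j k) x) (fun i => b x 0 i) (fun i => der i f x)
  (fun i => der i k x)).
by congr (_ + _); apply: eq_bigr => i _; [apply: eq_bigr => j _|];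
  congr (_ * _); [exact: E2|exact: E1].
Qed.

Lemma trg_gt0 x : rset U x -> (0 < n)%N -> 0 < \tr (g x).
Proof.
move=> Ux n0.
have -> : \tr (g x) = \sum_i inner (g x) (delta_mx 0 i) (delta_mx 0 i).
  apply: eq_bigr => i _; rewrite innerE -rowE trmx_delta -colE.
  by rewrite !mxE.
rewrite (bigD1 (Ordinal n0)) //=; apply: ltr_pwDl.
  apply: gpos => //; apply/eqP => /matrixP/(_ 0 (Ordinal n0)) /eqP.
  by rewrite !mxE !eqxx oner_eq0.
apply: sumr_ge0 => i _; apply/ltW/gpos => //.
by apply/eqP => /matrixP/(_ 0 i) /eqP; rewrite !mxE !eqxx oner_eq0.
Qed.

Lemma Lam_ge0 x : rset U x -> (0 < n)%N -> 0 < Lam.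
Proof. by move=> Ux n0; apply: lt_le_trans (trg Ux); exact: trg_gt0. Qed.

Lemma derive1_expR : derive1 expR = expR :> (R -> R).
Proof. by apply/funext => x; rewrite derive1E; exact: derive_val. Qed.

Lemma smooth_expR : smooth_fun_on [set: R] expR.
Proof.
move=> k t _; have -> : derive1n k expR = expR :> (R -> R).
  by elim: k => // k IH; rewrite derive1nS IH derive1_expR.
exact: derivable_expR.
Qed.

(** Hopf's barrier. The second derivatives of the exponential contribute a positive term quadratic
    in [al], all other terms are linear in [al]; on an annulus, away from the centre, a large [al]
    makes the quadratic one win. *)
Lemma barrier_exists z r y1 : rset U y1 -> (0 < n)%N -> 0 < r -> r <= 1 ->
  exists2 al : R, 0 < al & exists2 v : sfun U,
    (forall x, rset U x -> v x = expR (- al * sqdist U z x) - expR (- al * r ^+ 2) /\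
       forall i, der i v x = - (2 * al * (x 0 i - z 0 i) * expR (- al * sqdist U z x))) &
    (forall x, rset U x -> r ^+ 2 / 4 <= sqdist U z x <= r ^+ 2 -> C * v x < lop v x).
Proof.
move=> Uy1 n0 r0 r1; have L0 := Lam_ge0 Uy1 n0.
(* [B] bounds twice the trace of [a] plus the drift paired with x - z, as |x - z| <= r <= 1 on the
   annulus. *)
pose B := 2 * (Lam + n%:R * Lam).
have B0 : 0 <= B by rewrite /B mulr_ge0 // addr_ge0 ?mulr_ge0 // ltW.
(* On the annulus the quadratic form of [a] at x - z is at least r^2 / (4 Lam). With this [al] the
   quadratic term, up to the common exponential factor, is at least al (B + C + 1); the summand 1
   ensures al >= 1. *)
pose al := 1 + (B + C + 1) * Lam / r ^+ 2.
have r20 : 0 < r ^+ 2 by rewrite exprn_gt0.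
have al1 : 1 <= al.
  have P1 : 0 <= (B + C + 1) * Lam by rewrite mulr_ge0 ?(ltW L0) // !addr_ge0.
  by rewrite /al lerDl divr_ge0 // ltW.
have al0 : 0 < al by rewrite (lt_le_trans _ al1).
have alB : B + C + 1 <= al * r ^+ 2 / Lam.
  rewrite /al mulrDl mul1r divfK ?gt_eqF // mulrDl mulfK ?gt_eqF // lerDr.
  by rewrite divr_ge0 // ltW.
pose e := sqdist U z.
pose be : sfun U := sfcomp (f := sfcst U (- al) * e) smooth_expR (fun _ _ => I).
have beE x : rset U x -> be x = expR (- al * e x).
  by move=> Ux; rewrite sfcompE // sfME sfcstE.
have dbe i : der i be = sfcst U (- al) * der i e * be.
  apply: sfun_eq => x Ux; rewrite (der_sfcomp _ _ _ Ux) derive1_expR.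
  have fE : (sfcst U (- al) * e) x = - al * e x by rewrite sfME sfcstE.
  by rewrite fE [RHS]sfME (beE _ Ux) der_mul der_cst mul0r add0r mulrC.
pose xi (x : 'rV[R]_n) : 'rV[R]_n := x - z.
have deE i x : rset U x -> der i e x = 2 * xi x 0 i.
  move=> Ux; rewrite der_sqdist mulr2n sfDE sfDE sfNE sfXE // sfcstE // !mxE.
  by rewrite mulr_natl mulr2n.
have ddeE i j x : rset U x -> der i (der j e) x = 2 * (i == j)%:R.
  move=> Ux; rewrite der_sqdist mulr2n derD !derB der_cst der_sfX subr0.
  rewrite sfDE -[X in X + X]/(ev (Rpoint Ux) _) rmorph_nat -mulr2n mulr_natl //.
have ddbe i j x : rset U x -> der i (der j be) x =
    be x * (4 * al ^+ 2 * (xi x 0 i * xi x 0 j) - 2 * al * (i == j)%:R).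
  move=> Ux; rewrite dbe !der_mul der_cst mul0r add0r dbe.
  rewrite !(sfDE, sfME) !sfcstE // !deE // ddeE //; ring.
pose v := be - sfcst U (expR (- al * r ^+ 2)).
have vE x : rset U x -> v x = expR (- al * e x) - expR (- al * r ^+ 2).
  by move=> Ux; rewrite /v sfDE sfNE sfcstE // beE.
have dv i : der i v = der i be by rewrite derB der_cst subr0.
exists al => //; exists v => [x Ux|x Ux /andP[re er]].
  split=> [|i]; first exact: vE.
  rewrite dv dbe !sfME (sfcstE _ Ux) (deE _ _ Ux) (beE _ Ux) !mxE; ring.
have be0 : 0 < be x by rewrite beE // expR_gt0.
have vbe : v x <= be x by rewrite vE // beE // gerBl expR_ge0.
pose Q := \sum_i \sum_j xi x 0 i * xi x 0 j * a x i j.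
have lv : lop v x = be x * (4 * al ^+ 2 * Q - 2 * al * (\tr (a x) + \sum_i b x 0 i * xi x 0 i)).
  rewrite /lop.
  have -> : \sum_i \sum_j a x i j * der i (der j v) x =
      be x * (4 * al ^+ 2 * Q - 2 * al * \tr (a x)).
    rewrite /Q /mxtrace !mulr_sumr -sumrB mulr_sumr; apply: eq_bigr => i _.
    have -> : a x i i = \sum_j (i == j)%:R * a x i j.
      rewrite (bigD1 i) //= eqxx mul1r big1 ?addr0 // => j ji.
      by rewrite eq_sym (negbTE ji) mul0r.
    rewrite !mulr_sumr -sumrB mulr_sumr; apply: eq_bigr => j _.
    rewrite dv ddbe //; ring.
  have -> : \sum_i b x 0 i * der i v x = be x * (- (2 * al * \sum_i b x 0 i * xi x 0 i)).
    rewrite !mulr_sumr -sumrN mulr_sumr; apply: eq_bigr => i _.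
    rewrite dv dbe !sfME sfcstE // deE //; ring.
  ring.
have eE : e x = \sum_i xi x 0 i ^+ 2.
  by rewrite /e sqdistE //; apply: eq_bigr => i _; rewrite !mxE.
have Qlow : r ^+ 2 / 4 / Lam <= Q.
  rewrite ler_pdivrMr // (le_trans re) // eE [Q * _]mulrC.
  have [E Eu EgE] := posdef_factor (gT Ux) (gpos Ux).
  apply: le_trans (quad_lower (ag Ux) Eu EgE (xi x)) _.
  rewrite -/Q ler_wpM2r ?trg //.
  have tg := trg_gt0 Ux n0; rewrite -(pmulr_rge0 _ tg).
  apply: le_trans (quad_lower (ag Ux) Eu EgE (xi x)).
  by apply: sumr_ge0 => i _; exact: sqr_ge0.
have xi1 i : `|xi x 0 i| <= 1.
  rewrite -(@ler_pXn2r _ 2) ?nnegrE // expr1n -normrX ger0_norm ?sqr_ge0 //.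
  apply: (@le_trans _ _ (e x)); last by rewrite (le_trans er) // expr_le1 // ltW.
  rewrite eE (bigD1 i) //= lerDl; apply: sumr_ge0 => j _; exact: sqr_ge0.
have bxi : \sum_i b x 0 i * xi x 0 i <= n%:R * Lam.
  apply: (@le_trans _ _ (\sum_(i < n) Lam)); last by rewrite sumr_const card_ord mulr_natl.
  apply: ler_sum => i _; apply: le_trans (ler_norm _) _; rewrite normrM.
  by rewrite -[Lam]mulr1 ler_pM // bb.
apply: (@le_lt_trans _ _ (C * be x)); first by rewrite ler_wpM2l.
rewrite lv [C * _]mulrC ltr_pM2l //.
have H1 : al * (B + C + 1) <= 4 * al ^+ 2 * Q.
  apply: (@le_trans _ _ (al * (al * r ^+ 2 / Lam))); first by rewrite ler_wpM2l // ltW.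
  have -> : al * (al * r ^+ 2 / Lam) = 4 * al ^+ 2 * (r ^+ 2 / 4 / Lam).
    by field; rewrite gt_eqF.
  by rewrite ler_wpM2l // mulr_ge0 // sqr_ge0.
have H2 : 2 * al * (\tr (a x) + \sum_i b x 0 i * xi x 0 i) <= al * B.
  have -> : al * B = 2 * al * (Lam + n%:R * Lam) by rewrite /B; ring.
  by rewrite ler_wpM2l ?mulr_ge0 ?(ltW al0) // lerD // tra.
have H3 : C + 1 <= al * (C + 1) by rewrite ler_peMl // addr_ge0.
by move: H1 H2 H3; rewrite !mulrDr; lra.
Qed.

End Hopf.


Section HopfMain.
Context {R : realType} {n : nat} (U : region R n).
Variables (w : sfun U) (a g : 'rV[R]_n -> 'M[R]_n) (b : 'rV[R]_n -> 'rV[R]_n).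
Variables (Lam C : R).
Hypotheses (C0 : 0 <= C).
Hypothesis gT : forall x, rset U x -> (g x)^T = g x.
Hypothesis gpos : forall x, rset U x -> posdef (g x).
Hypothesis ag : forall x, rset U x -> a x *m g x = 1%:M.
Hypothesis trg : forall x, rset U x -> \tr (g x) <= Lam.
Hypothesis tra : forall x, rset U x -> \tr (a x) <= Lam.
Hypothesis bb : forall x, rset U x -> forall i, `|b x 0 i| <= Lam.
Hypothesis w0 : forall x, rset U x -> 0 <= w x.
Hypothesis wsup : forall x, rset U x -> 0 < w x -> lop a b w x <= C * w x.

Lemma sf_continuous (f : sfun U) x : rset U x -> {for x, continuous f}.
Proof. by move=> Ux; exact: (@smooth_continuous _ _ U f x Ux (sfunS f)). Qed.

Lemma lop_local_min (f : sfun U) x : rset U x -> (\forall y \near x, f x <= f y) ->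
  (forall i, der i f x = 0) /\ 0 <= lop a b f x.
Proof.
move=> Ux fmin.
have [||||D0 D2] := @elliptic_max _ _ U (- f) x (g x) (a x) Ux.
- by apply: filterS fmin => y; rewrite !sfNE lerN2.
- exact: gT.
- exact: gpos.
- exact: ag.
have dN i (k : sfun U) : der i (- k) = - der i k by exact: raddfN.
have D0' i : der i f x = 0.
  by apply/eqP; rewrite -oppr_eq0 -sfNE -dN D0.
split=> //; rewrite /lop [X in _ + X]big1 ?addr0 => [|i _]; last by rewrite D0' mulr0.
rewrite -oppr_le0 -sumrN; apply: le_trans D2; rewrite le_eqVlt; apply/orP; left.
apply/eqP; apply: eq_bigr => i _; rewrite -sumrN; apply: eq_bigr => j _.
by rewrite !dN sfNE mulrN.
Qed.

Lemma region_near x : rset U x -> \forall y \near x, rset U y.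
Proof. by move=> Ux; apply: open_nbhs_nbhs; split => //; exact: rset_open. Qed.

(** Hopf's boundary point lemma as a contradiction. On the annulus [w] dominates a positive multiple
    of the barrier, so its derivative at [y] towards the centre is positive; but [y] is a minimum of
    [w] inside the region and the gradient vanishes there. The inequality [wsup] is applied inside
    the ball only, where w > 0. *)
Lemma hopf_annulus (z y : 'rV[R]_n) (r : R) : 0 < r -> r <= 1 -> rset U y -> (0 < n)%N ->
  (forall x : 'rV[R]_n, \sum_i (x 0 i - z 0 i) ^+ 2 <= r ^+ 2 -> rset U x) ->
  (forall x : 'rV[R]_n, \sum_i (x 0 i - z 0 i) ^+ 2 < r ^+ 2 -> 0 < w x) ->
  \sum_i (y 0 i - z 0 i) ^+ 2 = r ^+ 2 -> w y = 0 -> False.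
Proof.
move=> r0 r1 Uy n0 BU Bw yr wy.
have [al al0 [v vEd vL]] := barrier_exists C0 gT gpos ag trg tra bb z Uy n0 r0 r1.
have vE x (Ux : rset U x) := (vEd x Ux).1.
pose e := sqdist U z.
have eE x : rset U x -> e x = \sum_i (x 0 i - z 0 i) ^+ 2 by exact: sqdistE.
pose q (x : 'rV[R]_n) : R := \sum_i (x 0 i - z 0 i) ^+ 2.
have r20 : 0 < r ^+ 2 by rewrite exprn_gt0.
have r4 : r ^+ 2 / 4 < r ^+ 2 by rewrite ltr_pdivrMr //; lra.
have ballK s : s <= r ^+ 2 -> compact [set x | q x <= s].
  move=> sr; have -> : [set x | q x <= s] = box z r `&` [set x | q x <= s].
    apply/seteqP; split=> x /=; last by case.
    move=> qs; split=> // i; rewrite -(@ler_pXn2r _ 2) ?nnegrE // ?(ltW r0) //.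
    rewrite -normrX ger0_norm ?sqr_ge0 // (le_trans _ (le_trans qs sr)) //.
    by rewrite /q (bigD1 i) //= lerDl; apply: sumr_ge0 => j _; exact: sqr_ge0.
  apply: compact_sublevel; first exact: box_compact.
  move=> p _; apply: (@cvg_sumR _ _ (nbhs p) (nbhs_filter p)) => i.
  have ci : {for p, continuous (fun x : 'rV[R]_n => x 0 i - z 0 i)}.
    by apply: continuousB; [exact: coord_continuous|exact: cst_continuous].
  exact: (continuousM ci ci).
have annK (f : sfun U) s : compact ([set x | q x <= r ^+ 2] `&` [set x | f x <= s]).
  apply: compact_sublevel; first exact: ballK.
  by move=> p /= qp; apply: sf_continuous; exact: BU.
(* [mu] is the minimum of [w] over the inner sphere, of radius r / 2; on that sphere v <= 1. *)
have [mu mu0 muP] : exists2 mu, 0 < mu & forall x, q x = r ^+ 2 / 4 -> mu <= w x.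
  have [[x0 x0r]|nx] := pselect (exists x0, q x0 = r ^+ 2 / 4); last first.
    by exists 1 => // x xr; case: nx; exists x.
  pose S := [set x | q x <= r ^+ 2 / 4] `&` [set x | (- e) x <= - (r ^+ 2 / 4)].
  have Sin x : S x -> rset U x /\ q x = r ^+ 2 / 4.
    move=> [/= h1]; have Ux : rset U x by apply: BU; rewrite (le_trans h1) // ltW.
    by rewrite sfNE lerN2 eE // => h2; split=> //; apply/eqP; rewrite eq_le h1.
  have Uq x : q x = r ^+ 2 / 4 -> rset U x.
    by move=> xr; apply: BU; rewrite -/(q x) xr ltW.
  have S0 : S x0.
    split=> /=; first by rewrite x0r.
    by rewrite sfNE lerN2 (eE _ (Uq _ x0r)) -/(q x0) x0r.
  have Sc : compact S.
    apply: compact_sublevel; first by apply: ballK; exact: ltW.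
    by move=> p /= qp; apply: sf_continuous; apply: BU; rewrite (le_trans qp) // ltW.
  have [||p Sp pm] := @compact_min _ _ S w _ Sc; first by exists x0.
    by move=> p /Sin[Up _]; exact: sf_continuous.
  have [Up qp] := Sin _ Sp; exists (w p); first by apply: Bw; rewrite -/(q p) qp.
  move=> x xr; apply: pm; split=> /=; first by rewrite xr.
  by rewrite sfNE lerN2 (eE _ (Uq _ xr)) -/(q x) xr.
pose f := w - sfcst U mu * v.
have fE x : rset U x -> f x = w x - mu * v x.
  by move=> Ux; rewrite /f sfDE sfNE sfME sfcstE.
have v1 x : rset U x -> v x <= 1.
  move=> Ux; rewrite vE // (le_trans (y := expR (- al * sqdist U z x))) //.
    by rewrite gerBl expR_ge0.
  rewrite -expR0 ler_expR mulNr oppr_le0 mulr_ge0 ?(ltW al0) // sqdistE //.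
  by apply: sumr_ge0 => i _; exact: sqr_ge0.
have v0 x : rset U x -> q x = r ^+ 2 -> v x = 0.
  by move=> Ux qx; rewrite vE // sqdistE // -/(q x) qx subrr.
pose D := [set x | q x <= r ^+ 2] `&` [set x | (- e) x <= - (r ^+ 2 / 4)].
have Din x : D x <-> r ^+ 2 / 4 <= q x <= r ^+ 2.
  split=> [[/= h1]|/andP[h1 h2]].
    by rewrite sfNE lerN2 (eE _ (BU _ h1)) h1 andbT.
  by split=> //=; rewrite sfNE lerN2 (eE _ (BU _ h2)).
have yq : q y = r ^+ 2 by [].
have Dy : D y by apply/Din; rewrite yq lexx ltW.
have DU x : D x -> rset U x by move=> /Din/andP[_]; exact: BU.
have [||p Dp pm] := @compact_min _ _ D f _ (annK _ _); first by exists y.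
  by move=> p /DU; exact: sf_continuous.
(* At the minimum [p] of w - mu v over the annulus: on the inner sphere [mu] bounds [w] from below,
   on the outer sphere [v] vanishes, and a negative minimum in between would give 0 <= lop f < C f
   <= 0. *)
have fp0 : 0 <= f p.
  rewrite leNgt; apply/negP => fp.
  have Up := DU _ Dp; have /Din/andP[p1 p2] := Dp.
  move: p1; rewrite le_eqVlt => /predU1P[p1|p1].
    move: fp; rewrite fE // ltNge subr_ge0 => /negP; apply.
    apply: le_trans (muP p (esym p1)).
    by rewrite -[X in _ <= X]mulr1 ler_wpM2l ?v1 // ltW.
  move: p2; rewrite le_eqVlt => /predU1P[p2|p2].
    by move: fp; rewrite fE // v0 // mulr0 subr0 ltNge w0.
  have near_min : \forall x \near p, f p <= f x.
    have ec : {for p, continuous (e : 'rV[R]_n -> R)} by exact: sf_continuous.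
    have N1 : \forall x \near p, r ^+ 2 / 4 < e x.
      by have := cvgr_gt (e p) ec; apply; rewrite eE.
    have N2 : \forall x \near p, e x < r ^+ 2.
      by have := cvgr_lt (e p) ec; apply; rewrite eE.
    apply: filterS (filterI (region_near Up) (filterI N1 N2)) => x [Ux [x1 x2]].
    by apply: pm; apply/Din; have -> : q x = e x by [rewrite eE]; rewrite !ltW.
  have [_ l0] := lop_local_min Up near_min.
  have wp : 0 < w p by exact: Bw.
  have := lopB a b w v mu Up; rewrite -/f => lE.
  have lw := wsup Up wp.
  have lv : C * v p < lop a b v p.
    by apply: vL => //; rewrite sqdistE // -/(q p) (ltW p1) ltW.
  move: l0; rewrite lE leNgt => /negP; apply.
  have : mu * (C * v p) < mu * lop a b v p by rewrite ltr_pM2l.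
  have : C * f p <= 0 by rewrite mulr_ge0_le0 // ltW.
  rewrite fE // mulrBr mulrCA; lra.
have [wy0 _] : (forall i, der i w y = 0) /\ 0 <= lop a b w y.
  apply: lop_local_min => //; apply: filterS (region_near Uy) => x Ux.
  by rewrite wy w0.
pose xi := z - y.
have Ud : rset U (0 *: xi + y) by rewrite scale0r add0r.
have [dk kE] := sfline f Ud.
pose c := \sum_i xi 0 i * der i f y.
(* The gradient of [w] vanishes at [y], so only the barrier contributes to the derivative of [f]
   towards the centre. *)
have c0 : c < 0.
  have dfy i : der i f y = mu * (2 * al * (y 0 i - z 0 i) * expR (- al * sqdist U z y)).
    have -> : der i f = der i w - sfcst U mu * der i v.
      by rewrite derB [X in _ - X]der_mul der_cst mul0r add0r.
    by rewrite sfDE sfNE sfME (sfcstE _ Uy) wy0 (vEd y Uy).2 sub0r mulrN opprK.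
  have -> : c = - (mu * (2 * al * expR (- al * sqdist U z y))) * r ^+ 2.
    rewrite -yq mulr_sumr; apply: eq_bigr => i _; rewrite dfy !mxE; ring.
  by rewrite mulNr oppr_lt0 !mulr_gt0 // expR_gt0.
(* For s <= 1/2 the point stays at distance at least r / 2 from [z], hence in the annulus. *)
have nonneg s : 0 <= s -> s <= 1 / 2 -> 0 <= f (s *: xi + y).
  move=> s0 s1; apply: le_trans fp0 _; apply: pm; apply/Din.
  have -> : q (s *: xi + y) = (1 - s) ^+ 2 * r ^+ 2.
    rewrite -yq mulr_sumr; apply: eq_bigr => i _; rewrite !mxE; ring.
  have S1 : 4^-1 <= (1 - s) ^+ 2 by nra.
  have S2 : (1 - s) ^+ 2 <= 1 by nra.
  apply/andP; split; last by rewrite ler_piMl // ltW.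
  by rewrite [X in _ <= X]mulrC ler_wpM2l // ltW.
have : \forall s \near (0:R)^', s^-1 * f (s *: xi + y) < 0.
  have fy : f y = 0 by rewrite fE // wy v0 // mulr0 subr0.
  have : (fun s : R => s^-1 * f (s *: xi + y)) @ (0:R)^' --> c.
    have -> : c = 'D_1 (fun s : R => f (s *: xi + y)) 0 by rewrite kE scale0r add0r.
    rewrite (_ : (fun s : R => _) = (fun h : R => h^-1 *: (((fun s : R => f (s *: xi + y))
       \o shift 0) (h *: 1) - f (0 *: xi + y)))); first exact: dk.
    by apply/funext => s /=; rewrite addr0 [s *: 1]mulr1 scale0r add0r fy subr0.
  by move=> /cvgr_lt; apply.
rewrite near_withinE => /nbhs_ballP[d /= d0]; rewrite -ball_normE => Bd.
pose s := Num.min (d / 2) (1 / 2).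
have s0 : 0 < s by rewrite lt_min !divr_gt0.
have sd : s < d by rewrite /s gt_min ltr_pdivrMr // ltr_pMr // ltr1n.
have s1 : s <= 1 / 2 by rewrite /s ge_min lexx orbT.
have := Bd s; rewrite /= sub0r normrN gtr0_norm // => /(_ sd); rewrite gt_eqF // => /(_ isT).
by rewrite pmulr_rlt0 ?invr_gt0 // ltNge nonneg // ltW.
Qed.

(** If [w] were positive at a point [z] near [y0], then the zero of [w] nearest to [z] would lie on
    the boundary of a ball about [z] on which w > 0, against [hopf_annulus]. *)
Lemma strong_min_local y0 : rset U y0 -> w y0 = 0 -> \forall x \near y0, w x = 0.
Proof.
move=> Uy0 wy0.
(* In dimension 0 the space is a single point. *)
case: (posnP n) => [n0|n0].
  apply: filterE => x; suff -> : x = y0 by [].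
  by apply/rowP => i; have := ltn_ord i; rewrite {2}n0.
have [d d0 dU] : exists2 d : R, 0 < d & forall x : 'rV[R]_n, (forall i, `|x 0 i - y0 0 i| < d) -> rset U x.
  have /nbhs_ballP[d /= d0] := region_near Uy0; rewrite -ball_normE => Bd.
  exists (d / 2) => [|x xd]; first by rewrite divr_gt0.
  apply: Bd => /=; apply: (@le_lt_trans _ _ (d / 2)); last by rewrite ltr_pdivrMr // ltr_pMr // ltr1n.
  apply: row_norm_le; first by rewrite ltW // divr_gt0.
  by move=> i; rewrite !mxE distrC ltW.
(* A ball of radius [rho] about a point close to [y0] stays within 2 [rho] of [y0], hence in the
   region; [hopf_annulus] also wants a radius of at most 1. *)
pose rho := Num.min (d / 3) 1.
have rho0 : 0 < rho by rewrite lt_min divr_gt0 // ltr01.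
have rho1 : rho <= 1 by rewrite ge_min lexx orbT.
have rhod : 2 * rho < d.
  have : rho <= d / 3 by rewrite ge_min lexx.
  by move: d0; lra.
(* As n dl^2 < rho^2, a sup-norm distance below [dl] is a Euclidean distance below [rho]. *)
pose dl := rho / n.+1%:R.
have dl0 : 0 < dl by rewrite divr_gt0.
have dlr : dl <= rho by rewrite ler_pdivrMr // ler_peMr ?ler1n // ltW.
have nd : n%:R * dl ^+ 2 < rho ^+ 2.
  rewrite /dl expr_div_n mulrA ltr_pdivrMr ?exprn_gt0 // mulrC ltr_pM2l ?exprn_gt0 //.
  by rewrite -natrX ltr_nat expnS expn1 (leq_trans (ltnSn n)) // leq_pmulr.
apply/nbhs_ballP; exists dl => //= z; rewrite -ball_normE /= => zd.
have zc i : `|z 0 i - y0 0 i| < dl.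
  apply: le_lt_trans zd; rewrite distrC.
  by have := coord_norm_le (y0 - z) i; rewrite !mxE.
have inU (x : 'rV[R]_n) : (forall i, `|x 0 i - y0 0 i| <= 2 * rho) -> rset U x.
  by move=> H; apply: dU => i; apply: le_lt_trans (H i) rhod.
pose q (x : 'rV[R]_n) : R := \sum_i (x 0 i - z 0 i) ^+ 2.
apply: contrapT => wz.
have Uz : rset U z.
  apply: inU => i; rewrite (le_trans (ltW (zc i))) // (le_trans dlr) //; move: rho0; lra.
have wz0 : 0 < w z by rewrite lt_neqAle w0 // andbT eq_sym; apply/eqP.
have qc p : {for p, continuous q}.
  apply: (@cvg_sumR _ _ (nbhs p) (nbhs_filter p)) => i.
  have ci : {for p, continuous (fun x : 'rV[R]_n => x 0 i - z 0 i)}.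
    by apply: continuousB; [exact: coord_continuous|exact: cst_continuous].
  exact: (continuousM ci ci).
(* The zeros of [w] in the cube; w >= 0 makes them a sublevel set, hence compact. *)
pose Z := box y0 (2 * rho) `&` [set x | w x <= 0].
have ZU x : Z x -> rset U x /\ w x = 0.
  move=> [bx /= wx]; have Ux := inU _ bx; split=> //.
  by apply/eqP; rewrite eq_le wx w0.
have Zy0 : Z y0.
  by split=> [i|/=]; [rewrite subrr normr0 mulr_ge0 // ltW|rewrite wy0].
have Zc : compact Z.
  apply: compact_sublevel; first exact: box_compact.
  by move=> p bp; apply: sf_continuous; exact: inU.
have [||y Zy ym] := @compact_min _ _ Z q _ Zc; first by exists y0.
  by move=> p _; exact: qc.
have [Uy wy] := ZU _ Zy.
have qy0 : q y0 < rho ^+ 2.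
  apply: le_lt_trans nd; apply: (@le_trans _ _ (\sum_(i < n) dl ^+ 2)).
    apply: ler_sum => i _; rewrite -real_normK ?num_real //.
    by rewrite ler_pXn2r ?nnegrE ?(ltW dl0) // distrC ltW.
  by rewrite sumr_const card_ord mulr_natl.
have qyr : q y < rho ^+ 2 by apply: le_lt_trans (ym _ Zy0) qy0.
have qy : 0 < q y.
  rewrite lt_neqAle sumr_ge0 ?andbT; last by move=> i _; exact: sqr_ge0.
  apply/eqP => /esym/eqP; rewrite psumr_eq0; last by move=> i _; exact: sqr_ge0.
  move=> /allP H; have yz : y = z.
    apply/rowP => i; apply/eqP; rewrite -subr_eq0 -sqrf_eq0.
    by have := H i; rewrite mem_index_enum => /(_ isT).
  by move: wz0; rewrite -yz wy ltxx.
have inZ (x : 'rV[R]_n) : q x <= q y -> forall i, `|x 0 i - y0 0 i| <= 2 * rho.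
  move=> qx i; have xz : `|x 0 i - z 0 i| <= rho.
    rewrite -(@ler_pXn2r _ 2) ?nnegrE // ?(ltW rho0) // real_normK ?num_real //.
    apply: le_trans (ltW qyr); apply: le_trans qx.
    by rewrite /q (bigD1 i) //= lerDl; apply: sumr_ge0 => j _; exact: sqr_ge0.
  rewrite -(subrKA (z 0 i)) (le_trans (ler_normD _ _)) //.
  by have := zc i; move: xz dlr; lra.
pose r := Num.sqrt (q y).
have rq : r ^+ 2 = q y by rewrite sqr_sqrtr // ltW.
have r0 : 0 < r by rewrite sqrtr_gt0.
have r1 : r <= 1.
  rewrite -(@ler_pXn2r _ 2) ?nnegrE // ?(ltW r0) // rq expr1n.
  by rewrite (le_trans (ltW qyr)) // expr_le1 // ltW.
apply: (@hopf_annulus z y r r0 r1 Uy n0) => //.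
- by move=> x; rewrite rq => qx; apply: inU; exact: inZ.
- move=> x; rewrite rq => qx; have bx := inZ _ (ltW qx).
  rewrite ltNge; apply/negP => wx.
  by have := ym x (conj bx wx); rewrite leNgt qx.
Qed.

End HopfMain.


(** * Connections and curvature *)

Section PullbackConnection.
Variables (A B : comNzRingType) (m n : nat).
Variables (D : 'I_m -> {additive A -> A}) (E : 'I_n -> {additive B -> B}).
Variables (f : {rmorphism B -> A}) (J : 'M[A]_(m, n)).
Hypothesis DM : forall a x y, D a (x * y) = D a x * y + x * D a y.
Hypothesis JC : forall a b r, D a (J b r) = D b (J a r).
Hypothesis chain : forall a x, D a (f x) = \sum_k J a k * f (E k x).

Definition pullback_conn (C : 'I_n -> 'M[B]_n) (a : 'I_m) : 'M[A]_n :=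
  \sum_(r < n) J a r *: map_mx f (C r).

Lemma map_chain a p q (M : 'M[B]_(p, q)) :
  map_mx (D a) (map_mx f M) = \sum_k J a k *: map_mx f (map_mx (E k) M).
Proof.
apply/matrixP => i j; rewrite !mxE chain summxE.
by apply: eq_bigr => k _; rewrite !mxE.
Qed.

Lemma pullback_tder (C : 'I_n -> 'M[B]_n) a p (Y : 'M[B]_(p, n)) :
  tder D (pullback_conn C) a (map_mx f Y) = \sum_r J a r *: map_mx f (tder E C r Y).
Proof.
rewrite /tder map_chain /pullback_conn mulmx_sumr -big_split.
apply: eq_bigr => r _ /=.
by rewrite -scalemxAr -map_mxM -scalerDr -map_mxD.
Qed.

Lemma pullback_compat (C : 'I_n -> 'M[B]_n) G :
  tcompat E C G -> tcompat D (pullback_conn C) (map_mx f G).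
Proof.
move=> CG a; rewrite map_chain /pullback_conn mulmx_suml raddf_sum /= mulmx_sumr -big_split.
apply: eq_bigr => r _ /=.
by rewrite CG trmxZ -scalemxAl -scalemxAr map_trmx -!map_mxM -scalerDr -map_mxD.
Qed.

(** Curvature is tensorial: the second derivatives of the map, which enter through the derivatives
    of [J], cancel by [JC]. *)
Lemma pullback_curv (C : 'I_n -> 'M[B]_n) a b :
  tcurv D (pullback_conn C) a b =
  \sum_r \sum_s (J a r * J b s) *: map_mx f (tcurv E C r s).
Proof.
have dsum c e : map_mx (D c) (pullback_conn C e) =
    \sum_r D c (J e r) *: map_mx f (C r) +
    \sum_r \sum_s (J e s * J c r) *: map_mx f (map_mx (E r) (C s)).
  rewrite [X in _ + X]exchange_big -big_split /pullback_conn.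
  apply/matrixP => i j; rewrite mxE summxE raddf_sum summxE; apply: eq_bigr => r _.
  have -> : D c ((J e r *: map_mx f (C r)) i j) = D c (J e r * f (C r i j)) by rewrite !mxE.
  rewrite DM chain addmxE scalemxE mxE summxE mulr_sumr; congr (_ + _).
  by apply: eq_bigr => s _; rewrite scalemxE !mxE mulrA.
have prod c e : pullback_conn C c *m pullback_conn C e =
    \sum_r \sum_s (J c r * J e s) *: map_mx f (C r *m C s).
  rewrite /pullback_conn mulmx_suml; apply: eq_bigr => r _; rewrite mulmx_sumr.
  by apply: eq_bigr => s _; rewrite -scalemxAl -scalemxAr scalerA -map_mxM.
rewrite /tcurv !dsum !prod.
under [X in _ = X]eq_bigr do under eq_bigr do rewrite !(map_mxD, map_mxN) !(scalerDr, scalerN).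
have sp (F1 F2 F3 F4 : 'I_n -> 'I_n -> 'M[A]_n) :
  \sum_r \sum_s (F1 r s - F2 r s + F3 r s - F4 r s) =
  \sum_r \sum_s F1 r s - \sum_r \sum_s F2 r s + \sum_r \sum_s F3 r s - \sum_r \sum_s F4 r s.
  rewrite -!(sumrB, big_split); apply: eq_bigr => r _ /=.
  by rewrite -!(sumrB, big_split).
rewrite sp (eq_bigr _ (fun r _ => congr1 (fun z => z *: map_mx f (C r)) (JC a b r))).
have -> : \sum_r \sum_s (J a s * J b r) *: map_mx f (map_mx (E r) (C s)) =
    \sum_r \sum_s (J a r * J b s) *: map_mx f (map_mx (E s) (C r)).
  by rewrite exchange_big.
have -> : \sum_r \sum_s (J b s * J a r) *: map_mx f (map_mx (E r) (C s)) =
    \sum_r \sum_s (J a r * J b s) *: map_mx f (map_mx (E r) (C s)).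
  by apply: eq_bigr => r _; apply: eq_bigr => s _; rewrite mulrC.
have -> : \sum_r \sum_s (J b r * J a s) *: map_mx f (C r *m C s) =
    \sum_r \sum_s (J a r * J b s) *: map_mx f (C s *m C r).
  rewrite exchange_big; apply: eq_bigr => r _; apply: eq_bigr => s _ /=.
  by rewrite mulrC.
mxring.
Qed.

Lemma pullback_constant_curv (C : 'I_n -> 'M[B]_n) G kappa :
  (forall r s, tcurv E C r s = kappa *: (G *m delta_mx s r - G *m delta_mx r s)) ->
  forall a b, tcurv D (pullback_conn C) a b = f kappa *:
    (map_mx f G *m (row b J)^T *m row a J - map_mx f G *m (row a J)^T *m row b J).
Proof.
move=> curv a b; rewrite pullback_curv.
under eq_bigr do under eq_bigr do rewrite curv map_mxZ map_mxB !map_mxM !map_delta_mx.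
have X c e : (row c J)^T *m row e J = \sum_r \sum_s (J e r * J c s) *: delta_mx s r.
  apply/matrixP => i j; rewrite mxE big_ord1 !mxE summxE (bigD1 j) //= summxE.
  rewrite (bigD1 i) //= scalemxE mxE !eqxx mulr1 mulrC.
  rewrite big1 ?addr0 => [|s si]; last first.
    by rewrite scalemxE mxE eq_sym (negbTE si) mulr0.
  rewrite big1 ?addr0 // => r rj; rewrite summxE big1 // => s _.
  by rewrite scalemxE mxE [j == r]eq_sym (negbTE rj) andbF mulr0.
rewrite -!mulmxA !X [X in _ = _ *: (_ - _ *m X)]exchange_big -mulmxBr -sumrB mulmx_sumr scaler_sumr.
apply: eq_bigr => r _; rewrite -sumrB mulmx_sumr scaler_sumr; apply: eq_bigr => s _.
by rewrite [J b s * J a r]mulrC -scalerBr -scalemxAr -mulmxBr !scalerA mulrC.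
Qed.

End PullbackConnection.

(** * Curvature tensors with constant sectional curvature *)

Section ConstantCurvature.
Context {R : realType} {n : nat}.

Definition quad4 (Q : 'I_n -> 'I_n -> 'I_n -> 'I_n -> R) (u w z y : 'rV[R]_n) : R :=
  \sum_i \sum_j \sum_k \sum_l u 0 i * w 0 j * z 0 k * y 0 l * Q i j k l.

Lemma quad4_add Q : [/\ forall u u' w z y, quad4 Q (u + u') w z y = quad4 Q u w z y + quad4 Q u' w z y,
  forall u w w' z y, quad4 Q u (w + w') z y = quad4 Q u w z y + quad4 Q u w' z y,
  forall u w z z' y, quad4 Q u w (z + z') y = quad4 Q u w z y + quad4 Q u w z' y &
  forall u w z y y', quad4 Q u w z (y + y') = quad4 Q u w z y + quad4 Q u w z y'].
Proof.
by split=> *; rewrite -big_split; apply: eq_bigr => i _; rewrite -big_split;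
  apply: eq_bigr => j _; rewrite -big_split; apply: eq_bigr => k _;
  rewrite -big_split; apply: eq_bigr => l _; rewrite /= mxE; ring.
Qed.

Lemma sum_delta (F : 'I_n -> R) i : \sum_j (delta_mx 0 i : 'rV[R]_n) 0 j * F j = F i.
Proof.
rewrite (bigD1 i) //= big1 ?addr0 => [|j ji]; rewrite mxE ?eqxx ?mul1r //.
by rewrite (negbTE ji) mul0r.
Qed.

Lemma quad4_delta Q i j k l :
  quad4 Q (delta_mx 0 i) (delta_mx 0 j) (delta_mx 0 k) (delta_mx 0 l) = Q i j k l.
Proof.
rewrite -[RHS](sum_delta (fun i => Q i j k l)); apply: eq_bigr => i' _.
rewrite -[Q i' j k l](sum_delta (fun j => Q i' j k l)) mulr_sumr; apply: eq_bigr => j' _.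
rewrite -[Q i' j' k l](sum_delta (fun k => Q i' j' k l)) !mulr_sumr; apply: eq_bigr => k' _.
rewrite -[Q i' j' k' l](sum_delta (fun l => Q i' j' k' l)) !mulr_sumr; apply: eq_bigr => l' _.
by rewrite !mulrA.
Qed.

(** Pair symmetry and polarization in both arguments make [Q] alternate in its two middle indices;
    the Bianchi identity then reads 3 Q = 0. *)
Lemma curvature_polarization Q :
  (forall i j k l, Q i j k l = - Q j i k l) -> (forall i j k l, Q i j k l = - Q i j l k) ->
  (forall i j k l, Q i j k l + Q j k i l + Q k i j l = 0) ->
  (forall u w, quad4 Q u w w u = 0) -> forall i j k l, Q i j k l = 0.
Proof.
move=> A1 A2 Bi Q0.
have [a1 a2 a3 a4] := quad4_add Q.
have pair i j k l : Q i j k l = Q k l i j.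
  have := Bi i j k l; have := Bi j k l i; have := Bi k l i j; have := Bi l i j k.
  have := A2 j k i l; have := A1 k i j l; have := A2 i k j l; have := A2 k l j i.
  have := A1 l j k i; have := A2 j l k i; have := A2 l i k j; have := A2 i j l k.
  lra.
have pol u u' w w' : quad4 Q u w w' u' + quad4 Q u w' w u' +
    quad4 Q u' w w' u + quad4 Q u' w' w u = 0.
  have s1 v : quad4 Q u v v u' + quad4 Q u' v v u = 0.
    have := Q0 (u + u') v; rewrite a1 !a4 !Q0; lra.
  by have := s1 (w + w'); rewrite !a2 !a3; have := s1 w; have := s1 w'; lra.
have asym i j k l : Q i j k l = - Q i k j l.
  have := pol (delta_mx 0 i) (delta_mx 0 l) (delta_mx 0 j) (delta_mx 0 k).
  rewrite !quad4_delta (pair l j k i) (A1 k i l j) (A2 i k l j).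
  rewrite (pair l k j i) (A1 j i l k) (A2 i j l k); lra.
move=> i j k l; have := Bi i j k l.
by rewrite (asym j k i l) (A1 j i k l) (A1 k i j l) (asym i k j l); lra.
Qed.

Lemma posdef_unit (G : 'M[R]_n) : G^T = G -> posdef G -> G \in unitmx.
Proof.
move=> GT Gp; have [E _ EGE] := posdef_factor GT Gp.
by have [+ _] := mulmx1_unit EGE; rewrite unitmx_mul => /andP[].
Qed.

Lemma innerC (G : 'M[R]_n) u w : G^T = G -> inner G u w = inner G w u.
Proof. by move=> GT; rewrite !innerE -[LHS]trmxE !trmx_mul trmxK GT mulmxA. Qed.

Lemma row_free2P (u w : 'rV[R]_n) :
  row_free (col_mx u w) <-> (forall s t, s *: u + t *: w = 0 -> s = 0 /\ t = 0).
Proof.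
have mulE (z : 'rV[R]_(1 + 1)) : z *m col_mx u w =
    lsubmx z 0 0 *: u + rsubmx z 0 0 *: w.
  rewrite -{1}[z]hsubmxK mul_row_col [lsubmx z in LHS]mx11_scalar.
  by rewrite [rsubmx z in LHS]mx11_scalar !mul_scalar_mx.
split=> [uw s t st|H].
  have E : row_mx s%:M t%:M *m col_mx u w = 0 *m col_mx u w.
    by rewrite mulE row_mxKl row_mxKr !mxE mul0mx !eqxx !mulr1n.
  have /eqP := row_free_inj uw E.
  rewrite row_mx_eq0 => /andP[/eqP/matrixP/(_ 0 0) E1 /eqP/matrixP/(_ 0 0) E2].
  by move: E1 E2; rewrite !mxE !eqxx !mulr1n.
apply: inj_row_free => z; rewrite mulE => /H[z1 z2].
rewrite -[z]hsubmxK [lsubmx z]mx11_scalar [rsubmx z]mx11_scalar z1 z2.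
by rewrite !raddf0 row_mx0.
Qed.

Lemma innerDZ (G : 'M[R]_n) s t u w y :
  inner G (s *: u + t *: w) y = s * inner G u y + t * inner G w y.
Proof. by rewrite !innerE !mulmxDl -!scalemxAl !mxE. Qed.

(** The determinant times |w|^2 is the squared length of [p], a multiple of the component of [u]
    orthogonal to [w]. *)
Lemma gram_det_gt0 (G : 'M[R]_n) u w : G^T = G -> posdef G -> row_free (col_mx u w) ->
  0 < inner G u u * inner G w w - inner G u w ^+ 2.
Proof.
move=> GT Gp /row_free2P uw.
have wn : w != 0.
  apply/eqP => w0; have w1 : 0 *: u + 1 *: w = 0 by rewrite w0 scaler0 scale0r addr0.
  by have [_ /eqP] := uw _ _ w1; rewrite oner_eq0.
have ww := Gp _ wn; set p := inner G w w *: u + (- inner G u w) *: w.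
have pn : p != 0 by apply/eqP => /uw[/eqP]; rewrite gt_eqF.
have := Gp _ pn; rewrite {1}/p innerDZ ![inner G _ p]innerC // !innerDZ.
rewrite (innerC w u) // => H; rewrite -(pmulr_rgt0 _ ww); apply: lt_le_trans H _.
by rewrite le_eqVlt; apply/orP; left; apply/eqP; ring.
Qed.

(** [curvature_polarization] is applied to the difference with the model tensor. *)
Lemma constant_sectional (G : 'M[R]_n) (Rm : 'I_n -> 'I_n -> 'I_n -> 'I_n -> R) kappa :
  let K i j k l := \sum_a Rm a i j k * G a l in
  G^T = G -> posdef G ->
  (forall i j k l, K i j k l = - K j i k l) -> (forall i j k l, K i j k l = - K i j l k) ->
  (forall i j k l, K i j k l + K j k i l + K k i j l = 0) ->
  (forall u w : 'rV[R]_n, row_free (col_mx u w) ->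
    inner G (\row_l \sum_i \sum_j \sum_k u 0 i * w 0 j * w 0 k * Rm l i j k) u /
    (inner G u u * inner G w w - inner G u w ^+ 2) = kappa) ->
  forall i j k l, K i j k l = kappa * (G j k * G i l - G i k * G j l).
Proof.
move=> K GT Gp A1 A2 Bi sec.
have Gs i j : G i j = G j i by rewrite -{1}GT mxE.
pose Q i j k l := K i j k l - kappa * (G j k * G i l - G i k * G j l).
suff Q0 : forall i j k l, Q i j k l = 0.
  by move=> i j k l; apply/eqP; rewrite -subr_eq0; apply/eqP; exact: Q0.
have innerS u w : inner G u w = \sum_i \sum_j u 0 i * w 0 j * G i j.
  rewrite innerE mxE exchange_big; apply: eq_bigr => j _ /=.
  by rewrite !mxE mulr_suml; apply: eq_bigr => i _; ring.
have quadB r (f k : 'I_n -> 'I_n -> 'I_n -> 'I_n -> R) u w z y :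
    quad4 (fun i j a b => f i j a b - r * k i j a b) u w z y =
    quad4 f u w z y - r * quad4 k u w z y.
  rewrite mulr_sumr -sumrB; apply: eq_bigr => i _; rewrite mulr_sumr -sumrB.
  apply: eq_bigr => j _; rewrite mulr_sumr -sumrB; apply: eq_bigr => a _.
  by rewrite mulr_sumr -sumrB; apply: eq_bigr => b _; ring.
have quadK u w : quad4 K u w w u =
    inner G (\row_l \sum_i \sum_j \sum_k u 0 i * w 0 j * w 0 k * Rm l i j k) u.
  pose cc i j k := u 0 i * w 0 j * w 0 k.
  transitivity (\sum_a \sum_i \sum_j \sum_k cc i j k * Rm a i j k * \sum_l G a l * u 0 l).
    rewrite [RHS]exchange_big; apply: eq_bigr => i _ /=.
    rewrite [RHS]exchange_big; apply: eq_bigr => j _ /=.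
    rewrite [RHS]exchange_big; apply: eq_bigr => k _ /=.
    transitivity (\sum_l \sum_a cc i j k * Rm a i j k * (G a l * u 0 l)).
      apply: eq_bigr => l _; rewrite /K mulr_sumr; apply: eq_bigr => a _.
      by rewrite /cc; ring.
    rewrite exchange_big; apply: eq_bigr => a _ /=; by rewrite mulr_sumr.
  rewrite innerS; apply: eq_bigr => a _.
  have -> : \sum_j (\row_l \sum_i \sum_j0 \sum_k u 0 i * w 0 j0 * w 0 k * Rm l i j0 k) 0 a
      * u 0 j * G a j =
      (\sum_i \sum_j \sum_k cc i j k * Rm a i j k) * \sum_l G a l * u 0 l.
    rewrite mulr_sumr; apply: eq_bigr => l _; rewrite mxE; ring.
  rewrite mulr_suml; apply: eq_bigr => i _; rewrite mulr_suml; apply: eq_bigr => j _.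
  by rewrite mulr_suml.
have quadG u w : quad4 (fun i j k l => G j k * G i l - G i k * G j l) u w w u =
    inner G u u * inner G w w - inner G u w ^+ 2.
  have E1 : quad4 (fun i j k l => G j k * G i l) u w w u = inner G u u * inner G w w.
    rewrite !innerS mulr_suml; apply: eq_bigr => i _; rewrite mulr_sumr.
    apply: eq_bigr => j _; rewrite mulr_sumr; apply: eq_bigr => k _; rewrite mulr_suml.
    by apply: eq_bigr => l _; ring.
  have E2 : quad4 (fun i j k l => G i k * G j l) u w w u = inner G u w ^+ 2.
    rewrite expr2 {2}innerC // !innerS mulr_suml; apply: eq_bigr => i _; rewrite mulr_sumr.
    apply: eq_bigr => j _; rewrite mulr_suml; apply: eq_bigr => k _; rewrite mulr_sumr.
    by apply: eq_bigr => l _; ring.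
  rewrite -E1 -E2 -[X in _ = _ - X]mul1r -quadB.
  congr quad4; do 4!apply/funext => ?; by rewrite mul1r.
have QA1 i j k l : Q i j k l = - Q j i k l by rewrite /Q A1; ring.
apply: curvature_polarization => [//|i j k l|i j k l|u w].
- by rewrite /Q A2; ring.
- rewrite /Q; have := Bi i j k l; rewrite (Gs i k) (Gs i j) (Gs j k) => E.
  rewrite -[RHS]E; ring.
rewrite /Q quadB quadG.
have [uw|/negP uw] := boolP (row_free (col_mx u w)).
  have dn := gram_det_gt0 GT Gp uw.
  by rewrite quadK -(sec u w uw) divfK ?subrr // gt_eqF.
(* The curvature hypothesis is silent on dependent pairs; there the form vanishes because [Q]
   alternates in its first two arguments. *)
have [s [t [st nz]]] : exists s t, s *: u + t *: w = 0 /\ ~ (s = 0 /\ t = 0).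
  apply: contrapT => H; apply: uw; apply/row_free2P => s t st.
  by apply: contrapT => nz; apply: H; exists s, t.
have quadA z y x : quad4 Q z z y x = 0.
  have E : quad4 Q z z y x = - quad4 Q z z y x.
    rewrite {1}/quad4 exchange_big -sumrN; apply: eq_bigr => i _; rewrite -sumrN.
    apply: eq_bigr => j _; rewrite -sumrN; apply: eq_bigr => k _; rewrite -sumrN.
    by apply: eq_bigr => l _ /=; rewrite QA1; ring.
  by lra.
have Z1 r z y x v : quad4 Q (r *: z) y x v = r * quad4 Q z y x v.
  rewrite mulr_sumr; apply: eq_bigr => i _; rewrite mulr_sumr; apply: eq_bigr => j _.
  rewrite mulr_sumr; apply: eq_bigr => k _; rewrite mulr_sumr; apply: eq_bigr => l _.
  by rewrite mxE; ring.
have Z2 z y x v : quad4 Q z (0 *: y) x v = 0.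
  by do 4![apply: big1 => ? _]; rewrite scale0r mxE mulr0 !mul0r.
suff : quad4 Q u w w u = 0 by rewrite /Q quadB quadG.
have [s0|s0] := eqVneq s 0.
  have t0 : t != 0 by apply/eqP => t0; apply: nz.
  have -> : w = 0 *: w; last by rewrite Z2.
  apply/eqP; rewrite scale0r.
  by move/eqP: st; rewrite s0 scale0r add0r scaler_eq0 (negbTE t0).
have -> : quad4 Q u w w u = quad4 Q ((- (t / s)) *: w) w w u.
  congr (quad4 Q _ w w u); apply: (scalerI s0).
  rewrite scalerA mulrN mulrCA mulfV // mulr1 scaleNr.
  by apply/eqP; rewrite -addr_eq0 st.
by rewrite Z1 quadA mulr0.
Qed.

End ConstantCurvature.


Section MatrixFunctions.
Context {R : realType} {n : nat} (U : region R n).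

Lemma evD (p : rpoint U) f k : ev p (f + k) = ev p f + ev p k.
Proof. exact: sfDE. Qed.

Lemma evN (p : rpoint U) f : ev p (- f) = - ev p f.
Proof. exact: sfNE. Qed.

Lemma evB (p : rpoint U) f k : ev p (f - k) = ev p f - ev p k.
Proof. by rewrite evD evN. Qed.

Lemma evM (p : rpoint U) f k : ev p (f * k) = ev p f * ev p k.
Proof. exact: sfME. Qed.

Lemma ev0 (p : rpoint U) : ev p 0 = 0.
Proof. exact: sf0E. Qed.

Lemma ev1 (p : rpoint U) : ev p 1 = 1.
Proof. exact: sf1E (rptP p). Qed.

Lemma ev_sum (p : rpoint U) (J : Type) (r : seq J) (F : J -> sfun U) :
  ev p (\sum_(i <- r) F i) = \sum_(i <- r) ev p (F i).
Proof. exact: rmorph_sum. Qed.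

Lemma ev_mulmx (p : rpoint U) a b e (X : 'M[sfun U]_(a, b)) (Y : 'M[sfun U]_(b, e)) i j :
  ev p ((X *m Y) i j) = \sum_k ev p (X i k) * ev p (Y k j).
Proof. by rewrite mxE ev_sum; apply: eq_bigr => k _; rewrite evM. Qed.

Lemma sfun_ev_eq (f k : sfun U) : (forall p : rpoint U, ev p f = ev p k) -> f = k.
Proof. by move=> H; apply: sfun_eq => v Uv; exact: (H (Rpoint Uv)). Qed.

Lemma sfmx_ev_eq a b (X Y : 'M[sfun U]_(a, b)) :
  (forall p : rpoint U, map_mx (ev p) X = map_mx (ev p) Y) -> X = Y.
Proof.
move=> H; apply/matrixP => i j; apply: sfun_ev_eq => p.
by have /matrixP/(_ i j) := H p; rewrite !mxE.
Qed.

Definition mksM a b (M : 'rV[R]_n -> 'M[R]_(a, b))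
    (Ms : forall i j, smooth_on U (fun v => M v i j)) : 'M[sfun U]_(a, b) :=
  \matrix_(i, j) mks (Ms i j).

Lemma ev_mksM a b (M : 'rV[R]_n -> 'M[R]_(a, b)) Ms (p : rpoint U) :
  map_mx (ev p) (@mksM a b M Ms) = M (rpt p).
Proof. by apply/matrixP => i j; rewrite !mxE; exact: mksE (rptP p). Qed.

Lemma ev_der (p : rpoint U) a (f : sfun U) (k : 'rV[R]_n -> R) :
  (forall q : rpoint U, ev q f = k (rpt q)) -> ev p (der a f) = partial a k (rpt p).
Proof.
move=> H; rewrite /ev (derE a f (rptP p)); apply: (partial_eq _ (rset_open U) (rptP p)).
by move=> w Uw; exact: (H (Rpoint Uw)).
Qed.

Lemma ev_cst (p : rpoint U) c : ev p (sfcst U c) = c.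
Proof. exact: sfcstE (rptP p). Qed.

End MatrixFunctions.

Lemma tcurvE (A : comNzRingType) m n (D : 'I_m -> {additive A -> A})
    (C : 'I_m -> 'M[A]_n) i j k l :
  tcurv D C i j k l = D i (C j k l) - D j (C i k l)
    + \sum_a (C j k a * C i a l - C i k a * C j a l).
Proof.
rewrite /tcurv !linmxE -[RHS]addrA sumrB; rewrite mxE [map_mx _ _ _ _]mxE -!addrA.
by congr (_ + (_ + _)); rewrite !mxE.
Qed.

(** The morphism [e] stands for evaluation at a point, where the hypothesis on sectional curvatures
    is available. *)
Lemma curvature_eval (R : realType) n kappa (A : comNzRingType) (e : {rmorphism A -> R})
    (G : 'M[A]_n) (T : 'I_n -> 'I_n -> 'M[A]_n) (ka : A) :
  G^T = G -> posdef (map_mx e G) ->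
  (forall i j, T i j = - T j i) -> (forall i j, T i j *m G + G *m (T i j)^T = 0) ->
  (forall i j k l, T i j k l + T j k i l + T k i j l = 0) -> e ka = kappa ->
  (forall u w : 'rV[R]_n, row_free (col_mx u w) ->
    inner (map_mx e G) (\row_l \sum_i \sum_j \sum_k u 0 i * w 0 j * w 0 k * e (T i j k l)) u /
    (inner (map_mx e G) u u * inner (map_mx e G) w w - inner (map_mx e G) u w ^+ 2) = kappa) ->
  forall i j, map_mx e (T i j *m G) =
    map_mx e (ka *: (G *m delta_mx j i - G *m delta_mx i j) *m G).
Proof.
move=> GT Gp TN TS TB eka sec r s; apply/matrixP => k l.
have eGT : (map_mx e G)^T = map_mx e G by rewrite map_trmx GT.
have KE i j a b : \sum_c e (T i j a c) * (map_mx e G) c b = e ((T i j *m G) a b).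
  by rewrite mxE rmorph_sum; apply: eq_bigr => c _; rewrite rmorphM mxE.
have K : e ((T r s *m G) k l) = kappa * (e (G s k) * e (G r l) - e (G r k) * e (G s l)).
  have := @constant_sectional R n (map_mx e G) (fun l i j k => e (T i j k l)) kappa eGT Gp.
  move=> H; rewrite -KE H; first by rewrite !mxE.
  - by move=> i j a b; rewrite !KE TN mulNmx oppmxE rmorphN.
  - move=> i j a b; rewrite !KE.
    have /(congr1 (fun M : 'M[A]_n => e (M a b))) := TS i j.
    rewrite addmxE zeromxE rmorphD rmorph0 => /eqP; rewrite addr_eq0 => /eqP ->.
    congr (- e _); have -> : G *m (T i j)^T = (T i j *m G)^T by rewrite trmx_mul GT.
    exact: trmxE.
  - move=> i j a b; rewrite !KE -!rmorphD !mxE -!big_split.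
    by rewrite big1 ?rmorph0 // => c _ /=; rewrite -!mulrDl TB mul0r.
  - exact: sec.
have Gsym a b : G a b = G b a by rewrite -{1}GT mxE.
rewrite mxE K mxE -scalemxAl scalemxE rmorphM eka mulmxBl addmxE oppmxE.
rewrite !(mul_delta_mulE G G) rmorphB !rmorphM.
by rewrite (Gsym k s) (Gsym k r).
Qed.

Section MetricRing.
Context {R : realType} {n : nat} (U : region R n).
Variable Gf : 'rV[R]_n -> 'M[R]_n.
Hypothesis Gs : forall i j, smooth_on U (fun v => Gf v i j).
Hypothesis GT : forall v, rset U v -> (Gf v)^T = Gf v.
Hypothesis Gp : forall v, rset U v -> posdef (Gf v).

Let Gu v (Uv : rset U v) : Gf v \in unitmx := posdef_unit (GT Uv) (Gp Uv).

Definition Gm : 'M[sfun U]_n := mksM Gs.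
Definition Qm : 'M[sfun U]_n := mksM (smooth_invmx (rset_open U) Gs Gu).
Definition hlf : sfun U := sfcst U 2^-1.
Definition Cm (i : 'I_n) : 'M[sfun U]_n := tgam der Gm Qm hlf i.

Lemma GmT : Gm^T = Gm.
Proof. by apply: sfmx_ev_eq => p; rewrite -map_trmx ev_mksM GT //; exact: rptP. Qed.

Lemma QmGm : Qm *m Gm = 1%:M.
Proof.
apply: sfmx_ev_eq => p; rewrite map_mxM !ev_mksM map_mx1 mulVmx //.
exact: Gu (rptP p).
Qed.

Lemma hlf2 : hlf + hlf = 1.
Proof.
apply: sfun_ev_eq => p; rewrite evD ev1 !ev_cst.
by rewrite [RHS](@splitr R) div1r.
Qed.

Lemma ev_Gm (p : rpoint U) i j : ev p (Gm i j) = Gf (rpt p) i j.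
Proof. by have /matrixP/(_ i j) := ev_mksM Gs p; rewrite mxE. Qed.

Lemma ev_Qm (p : rpoint U) i j : ev p (Qm i j) = invmx (Gf (rpt p)) i j.
Proof.
by have /matrixP/(_ i j) := ev_mksM (smooth_invmx (rset_open U) Gs Gu) p; rewrite mxE.
Qed.

Lemma ev_Cm (p : rpoint U) i j k : ev p (Cm i j k) = christoffel Gf k i j (rpt p).
Proof.
rewrite mxE evM ev_cst ev_sum; congr (_ * _); apply: eq_bigr => l _.
rewrite evM ev_Qm evB evD; congr (_ * (_ + _ - _));
  by apply: ev_der => q; exact: ev_Gm.
Qed.

Lemma CmC a b : row a (Cm b) = row b (Cm a).
Proof. by apply: tgamC; exact: GmT. Qed.

Lemma Cm_compat : tcompat der Cm Gm.
Proof. exact: (tgam_compat _ GmT QmGm hlf2). Qed.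

Lemma ev_tcurv (p : rpoint U) i j k l :
  ev p (tcurv der Cm i j k l) = riemann Gf l i j k (rpt p).
Proof.
have dC a b e f : ev p (der a (Cm b e f)) = partial a (christoffel Gf f b e) (rpt p).
  by apply: ev_der => q; exact: ev_Cm.
rewrite tcurvE evD evB ev_sum /riemann; congr (_ + _).
  by congr (_ - _); exact: dC.
apply: eq_bigr => a _; rewrite evB 2!evM; congr (_ - _); rewrite mulrC;
  by congr (_ * _); exact: ev_Cm.
Qed.

(** With the index lowered the identity is checked point by point; multiplication by the inverse
    metric raises the index again. *)
Lemma constant_curv_ring kappa :
  (forall v, rset U v -> forall u w : 'rV[R]_n, row_free (col_mx u w) ->
     sectional Gf v u w = kappa) ->
  forall r s, tcurv der Cm r s =
    sfcst U kappa *: (Gm *m delta_mx s r - Gm *m delta_mx r s).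
Proof.
move=> sec r s.
have ind : tcurv der Cm r s *m Gm =
    sfcst U kappa *: (Gm *m delta_mx s r - Gm *m delta_mx r s) *m Gm.
  apply: sfmx_ev_eq => p; have Uv := rptP p.
  have GE := ev_mksM Gs p.
  have SK i j := tcurv_skew (@der_mul _ _ U) (@derC _ _ U) i j Cm_compat.
  apply: (@curvature_eval _ n kappa _ (ev p) _ _ _ GmT _ (tcurvN der Cm) SK) => //.
  - by rewrite [map_mx _ _]GE; exact: Gp.
  - by move=> i j k l; apply: tcurv_bianchi; exact: CmC.
  - exact: ev_cst.
  - move=> u w uw; rewrite [map_mx _ _]GE -[RHS](sec _ Uv u w uw).
    congr (inner _ _ _ / _); apply/rowP => l; rewrite !mxE.
    apply: eq_bigr => i _; apply: eq_bigr => j _; apply: eq_bigr => k _.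
    by congr (_ * _); exact: ev_tcurv.
rewrite -[LHS]mulmx1 -[RHS]mulmx1 -(gq1 QmGm).
by rewrite !mulmxA ind.
Qed.

End MetricRing.

#[global] Opaque Gm Qm hlf Cm.



Lemma rowmxE (A : Type) m n (X : 'M[A]_(m, n)) i j : row i X 0 j = X i j.
Proof. exact: mxE. Qed.

(** * Warped products *)

Section WarpedAlgebra.
Variables (A : comNzRingType) (n : nat) (D : 'I_(1 + n) -> {additive A -> A}).
Hypothesis DM : forall a x y, D a (x * y) = D a x * y + x * D a y.
Hypothesis DC : forall a b x, D a (D b x) = D b (D a x).
Variables (G Q : 'M[A]_(1 + n)) (half h h1 h2 kappa : A) (P0 : 'M[A]_n).
Hypotheses (GT : G^T = G) (QG : Q *m G = 1%:M) (half2 : half + half = 1).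
Hypothesis GE : G = block_mx 1%:M 0 0 (h ^+ 2 *: P0).
Hypothesis Dh : forall i, D i h = (i == ord0)%:R * h1.
Hypothesis D0P : forall a b, D ord0 (P0 a b) = 0.

Local Notation C := (tgam D G Q half).
Local Notation o := (ord0 : 'I_(1 + n)).

Let ordE : o = lshift n ord0. Proof. exact: val_inj. Qed.

Let G0 l : G o l = (l == o)%:R.
Proof.
rewrite GE ordE; case: (splitP l) => k lk.
  have -> : l = lshift n k by apply: val_inj.
  by rewrite block_mxEul mxE (inj_eq (@lshift_inj _ _)) eq_sym.
have -> : l = rshift 1 k by apply: val_inj.
by rewrite block_mxEur mxE eq_rlshift.
Qed.

Let D1 i (b : bool) : D i b%:R = 0.
Proof.
case: b; last exact: raddf0.
have := DM i 1 1; rewrite !mulr1 mul1r => /eqP.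
by rewrite eq_sym -subr_eq0 addrK => /eqP.
Qed.

Let D0h : D o h = h1. Proof. by rewrite Dh eqxx mul1r. Qed.

(** On the block of P the metric is h^2 [P0], so half its t-derivative is (h' / h) G; the factor [h]
    on the left avoids the division. *)
Let DG r l : h * (half * D o (G r l)) = (r != o)%:R * (h1 * G r l).
Proof.
case: (eqVneq r o) => [->|ro].
  by rewrite G0 D1 !mulr0 mul0r.
rewrite mul1r; case: (eqVneq l o) => [->|lo].
  by rewrite -{1 2}GT !mxE G0 (negbTE ro) (D1 _ false) !mulr0.
have [r' ->] : exists r', r = rshift 1 r'.
  case: (splitP r) ro => k rk ro; last by exists k; apply: val_inj.
  by move: ro; rewrite -val_eqE /= rk ord1.
have [l' ->] : exists l', l = rshift 1 l'.
  case: (splitP l) lo => k lk lo; last by exists k; apply: val_inj.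
  by move: lo; rewrite -val_eqE /= lk ord1.
rewrite GE block_mxEdr scalemxE DM expr2 DM D0P D0h mulr0 addr0.
set k := P0 _ _; transitivity ((half + half) * (h * h * h1 * k)).
  by ring.
by rewrite half2; ring.
Qed.

(** The closed conformal property of $h\partial_t$, verified after lowering the index, where
    [tgam_lower] applies. *)
Lemma warped_conformal r : tder D C r (h *: delta_mx 0 o : 'rV_(1 + n)) = h1 *: delta_mx 0 r.
Proof.
suff E : tder D C r (h *: delta_mx 0 o : 'rV_(1 + n)) *m G = h1 *: delta_mx 0 r *m G.
  by rewrite -[LHS]mulmx1 -[RHS]mulmx1 -(gq1 QG) !mulmxA E.
have -> : tder D C r (h *: delta_mx 0 o : 'rV_(1 + n)) = D r h *: delta_mx 0 o + h *: row o (C r).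
  rewrite /tder -scalemxAl -rowE; congr (_ + _).
  apply/rowP => k; rewrite !mxE eqxx /=.
  by rewrite DM D1 mulr0 addr0.
rewrite mulmxDl -!scalemxAl -!rowE -row_mul.
apply/rowP => l; rewrite addmxE !scalemxE !rowmxE (tgam_lower _ _ GT QG).
rewrite !G0 !D1 add0r (_ : G r o = (r == o)%:R); last by rewrite -{1}GT mxE G0.
rewrite D1 subr0 DG Dh; case: (eqVneq r o) => [->|_]; last by rewrite !mul0r add0r mul1r.
by rewrite mul1r !mul0r addr0 G0.
Qed.

Hypothesis Dh1 : forall i, D i h1 = (i == o)%:R * h2.
Hypothesis curv : forall r s, tcurv D C r s =
  kappa *: (G *m delta_mx s r - G *m delta_mx r s).

(** The commutator of the covariant derivatives of $h\partial_t$ in the directions t and [s] is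
    computed once from [warped_conformal] and once from the curvature. *)
Lemma warped_curvature (s : 'I_(1 + n)) : s != o -> h2 = - (kappa * h).
Proof.
move=> so.
have := tderC DM DC C o s (h *: delta_mx 0 o : 'rV_(1 + n)).
rewrite !warped_conformal.
have tE r l : tder D C r (h1 *: delta_mx 0 l : 'rV_(1 + n)) =
    D r h1 *: delta_mx 0 l + h1 *: row l (C r).
  rewrite /tder -scalemxAl -rowE; congr (_ + _).
  apply/rowP => k; rewrite !mxE eqxx /=.
  by rewrite DM D1 mulr0 addr0.
rewrite !tE (tgamC D Q half GT) !Dh1 eqxx (negbTE so) mul1r mul0r scale0r add0r addrK.
rewrite curv -scalemxAl -scalemxAr mulmxBr !mulmxA -rowE.
have r0 : row o G = delta_mx 0 o.
  by apply/rowP => l; rewrite !mxE G0 eqxx.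
rewrite r0 !mul_delta_mx_cond (eq_sym o s) (negbTE so) eqxx.
move/rowP => /(_ s); rewrite !(scalemxE, addmxE, oppmxE) !mxE !eqxx ?mulr0n ?mulr1n.
by rewrite !mulr1 => ->; ring.
Qed.

End WarpedAlgebra.

Lemma smooth_derive1 {R : realType} (I : set R) (h : R -> R) :
  smooth_fun_on I h -> smooth_fun_on I (derive1 h).
Proof. by move=> hs k t It; rewrite -derive1Sn; exact: hs. Qed.

Section WarpedAmbient.
Context {R : realType} {n : nat} (I : set R) (h : R -> R) (P : charted R n).
Variable g0 : gram_field P.
Hypotheses (I_open : open I) (hs : smooth_fun_on I h) (h_pos : forall t, I t -> 0 < h t).
Hypotheses (P_manifold : smooth_manifold P) (g0_riem : riemannian g0).
Variable d : idx P.

Local Notation Q := (interval_prod I P).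
Local Notation gQ := (warped_metric I h g0).
Local Notation o := (ord0 : 'I_(1 + n)).
Let V : set 'rV[R]_(1 + n) := @coord R _ Q d @` @cdom R _ Q d.
Let W : set 'rV[R]_n := coord d @` cdom d.

Let ordE : o = lshift n ord0. Proof. exact: val_inj. Qed.

Lemma interval_prod_image : V = [set v : 'rV[R]_(1 + n) | I (v 0 o) /\ W (rsubmx v)].
Proof.
apply/seteqP; split=> v /=.
  move=> [[t p] [It dp] <-] /=; rewrite row_mxKr ordE row_mxEl mxE; split=> //.
  by exists p.
move=> [Iv [p dp E]]; exists (v 0 o, p) => //=.
rewrite -[RHS]hsubmxK E [lsubmx v]mx11_scalar mxE; congr (row_mx (v 0 _)%:M _).
exact: val_inj.
Qed.

Lemma rsubmx_continuous (v : 'rV[R]_(1 + n)) :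
  {for v, continuous (rsubmx : 'rV[R]_(1 + n) -> 'rV[R]_n)}.
Proof.
apply: row_continuous => k.
have -> : (fun w : 'rV[R]_(1 + n) => rsubmx w 0 k) = fun w => w 0 (rshift 1 k).
  by apply/funext => w; rewrite mxE.
exact: coord_continuous.
Qed.

Lemma Wopen : open W.
Proof. by have [_ _ _ /(_ d)[]] := P_manifold. Qed.

Lemma interval_prod_open : open V.
Proof.
rewrite interval_prod_image; apply: openI.
  by apply: (@open_comp _ _ (fun v : 'rV[R]_(1 + n) => v 0 o)) => // v _; exact: coord_continuous.
apply: (@open_comp _ _ (rsubmx : 'rV[R]_(1 + n) -> 'rV[R]_n)); last exact: Wopen.
by move=> v _; exact: rsubmx_continuous.
Qed.

Lemma smooth_rsubmx f : smooth_on W f -> smooth_on V (fun v => f (rsubmx v)).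
Proof.
move=> fs; have := @smooth_comp R _ _ V W f rsubmx interval_prod_open Wopen _ fs; apply.
  by rewrite interval_prod_image => v [].
move=> k; apply: (@smooth_eq R _ V interval_prod_open (fun v => v 0 (rshift 1 k))).
  by move=> v _; rewrite mxE.
exact: smooth_coord.
Qed.

Lemma warped_sym v : V v -> (gram gQ d v)^T = gram gQ d v.
Proof.
rewrite interval_prod_image => -[_ [p dp pv]].
have [gT _ _ _] := g0_riem.
have [_ _ _ /(_ d)[_ _ _ _ Pp] _] := P_manifold.
rewrite /gram /warped_metric /= tr_block_mx !trmx0 trmx1 linearZ /= gT //.
by rewrite -pv Pp.
Qed.

Lemma warped_posdef v : V v -> posdef (gram gQ d v).
Proof.
rewrite interval_prod_image => -[Iv [p dp pv]].
have [_ gp _ _] := g0_riem.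
have [_ _ _ /(_ d)[_ _ _ _ Pp] _] := P_manifold.
have vE : lsubmx v 0 0 = v 0 o by rewrite mxE; congr (v 0 _); exact: val_inj.
move=> u u0; rewrite /inner /gram /warped_metric /= vE -pv Pp //.
rewrite -{1 2}[u]hsubmxK mul_row_block tr_row_mx !mulmx0 addr0 add0r mulmx1 mul_row_col.
rewrite -scalemxAr -scalemxAl addmxE scalemxE.
have -> : (lsubmx u *m (lsubmx u)^T) 0 0 = u 0 o ^+ 2.
  rewrite mxE big_ord1 !mxE expr2; congr (u 0 _ * u 0 _); exact: val_inj.
have [r0|r0] := eqVneq (rsubmx u) 0.
  rewrite r0 !mul0mx [(0 : 'M[R]_1) 0 0]mxE mulr0 addr0 exprn_even_gt0 //=.
  apply: contraNneq u0 => uo; rewrite -[u]hsubmxK r0 [lsubmx u]mx11_scalar mxE.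
  have -> : lshift n (0 : 'I_1) = o by apply: val_inj.
  by rewrite uo raddf0 row_mx0.
apply: ltr_wpDl; first exact: sqr_ge0.
by apply: mulr_gt0; [rewrite exprn_gt0 // h_pos|exact: gp].
Qed.

Lemma smooth_head f : smooth_fun_on I f -> smooth_on V (fun v => f (v 0 o)).
Proof.
move=> fs; apply: (@smooth_comp1 R _ V interval_prod_open (fun v => v 0 o) I f fs).
  by rewrite interval_prod_image => v [].
exact: smooth_coord.
Qed.

Lemma smooth_g0 i j : smooth_on V (fun v => g0 d (param d (rsubmx v)) i j).
Proof. by have [_ _ gs _] := g0_riem; exact: (smooth_rsubmx (gs d i j)). Qed.

Lemma warped_smooth i j : smooth_on V (fun v => gram gQ d v i j).
Proof.
have vE (v : 'rV[R]_(1 + n)) : lsubmx v 0 0 = v 0 o.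
  by rewrite mxE; congr (v 0 _); exact: val_inj.
have cs (c : R) : smooth_on V (fun=> c) by exact: smooth_cst.
have [i'|i'] := splitP i; have [j'|j'] := splitP j => Ej Ei.
- apply: (@smooth_eq R _ V interval_prod_open _ _ _ (cs (i' == j')%:R)) => v _.
  have -> : i = lshift n i' by apply: val_inj.
  have -> : j = lshift n j' by apply: val_inj.
  by rewrite /gram /warped_metric block_mxEul mxE.
- apply: (@smooth_eq R _ V interval_prod_open _ _ _ (cs 0)) => v _.
  have -> : i = lshift n i' by apply: val_inj.
  have -> : j = rshift 1 j' by apply: val_inj.
  by rewrite /gram /warped_metric block_mxEur mxE.
- apply: (@smooth_eq R _ V interval_prod_open _ _ _ (cs 0)) => v _.
  have -> : i = rshift 1 i' by apply: val_inj.
  have -> : j = lshift n j' by apply: val_inj.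
  by rewrite /gram /warped_metric block_mxEdl mxE.
have hsm := smooth_head hs.
apply: (@smooth_eq R _ V interval_prod_open _ _ _ (@smoothM R _ V interval_prod_open _ _
  (@smoothM R _ V interval_prod_open _ _ hsm hsm) (smooth_g0 i' j'))) => v _.
have -> : i = rshift 1 i' by apply: val_inj.
have -> : j = rshift 1 j' by apply: val_inj.
by rewrite /gram /warped_metric block_mxEdr mxE /= vE expr2.
Qed.

Hypothesis V0 : exists v, V v.
Definition ambient_region : region R (1 + n) := Region interval_prod_open V0.
Local Notation VV := ambient_region.

Definition head_fun f (fs : smooth_fun_on I f) : sfun VV :=
  @mks R _ VV _ (smooth_head fs).

Lemma der_head_fun f (fs : smooth_fun_on I f) i :
  der i (head_fun fs) = (i == o)%:R * head_fun (smooth_derive1 fs).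
Proof.
have oI v : rset VV v -> I (sfX VV o v).
  by move=> Vv; rewrite sfXE //; move: Vv; rewrite /= interval_prod_image => -[].
have E : head_fun fs = sfcomp fs oI.
  apply: sfun_eq => v Vv; rewrite sfcompE //.
  by rewrite [LHS](mksE _ Vv) [sfX VV o v]sfXE.
apply: sfun_eq => v Vv; rewrite E (der_sfcomp fs oI _ Vv) der_sfX mulrC sfME.
by congr (_ * _); rewrite [RHS](mksE _ Vv) sfXE.
Qed.

Let Gs := warped_smooth : forall i j, smooth_on VV (fun v => gram gQ d v i j).
Definition amb_G := Gm Gs.
Definition amb_C := @Cm R _ VV _ Gs warped_sym warped_posdef.

Let P0 : 'M[sfun VV]_n := @mksM R _ VV _ _ _ smooth_g0.
Let hh := head_fun hs.

Lemma amb_GE : amb_G = block_mx 1%:M 0 0 (hh ^+ 2 *: P0).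
Proof.
apply: sfmx_ev_eq => p; rewrite [LHS]ev_mksM map_block_mx map_mx1 !map_mx0 map_mxZ ev_mksM.
rewrite /gram /warped_metric /=; congr (block_mx _ _ _ (_ *: _)).
rewrite rmorphXn; congr (_ ^+ 2); rewrite [RHS](mksE _ (rptP p)).
by rewrite mxE; congr (h (rpt p 0 _)); exact: val_inj.
Qed.

Lemma der_P0 a b : der o (P0 a b) = 0.
Proof.
apply: sfun_ev_eq => p.
rewrite (@ev_der _ _ _ _ _ _ (fun v => g0 d (param d (rsubmx v)) a b)); last first.
  by move=> q; rewrite mxE; exact: mksE (rptP q).
rewrite ev0 /partial /derive.
have -> : (fun s : R => s^-1 *: (((fun v => g0 d (param d (rsubmx v)) a b)
    \o shift (rpt p)) (s *: (delta_mx 0 o : 'rV[R]_(1 + n))) -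
    g0 d (param d (rsubmx (rpt p))) a b)) = cst 0.
  apply/funext => s /=; suff -> : rsubmx (s *: (delta_mx 0 o : 'rV[R]_(1 + n)) + rpt p) =
    rsubmx (rpt p) by rewrite subrr scaler0.
  apply/rowP => k; by rewrite !mxE /= mulr0 add0r.
exact: lim_cst.
Qed.

Let GT' := @GmT R _ VV _ Gs warped_sym.
Let QG' := @QmGm R _ VV _ Gs warped_sym warped_posdef.

Lemma amb_conformal r : tder der amb_C r (hh *: delta_mx 0 o : 'rV_(1 + n)) =
  head_fun (smooth_derive1 hs) *: delta_mx 0 r.
Proof.
apply: (warped_conformal (@der_mul _ _ VV) GT' QG' (hlf2 VV) amb_GE).
  by move=> i; exact: der_head_fun.
exact: der_P0.
Qed.

Variable kappa : R.
Hypothesis curv : constant_curvature gQ kappa.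

Lemma amb_curv r s : tcurv der amb_C r s =
  sfcst VV kappa *: (amb_G *m delta_mx s r - amb_G *m delta_mx r s).
Proof.
apply: constant_curv_ring => v [x dx <-] u w uw.
exact: (curv dx uw).
Qed.

Lemma amb_h2 : (0 < n)%N -> forall t, I t -> derive1 (derive1 h) t = - (kappa * h t).
Proof.
move=> n0 t It.
have sP : rshift 1 (Ordinal n0) != o :> 'I_(1 + n) by rewrite -val_eqE.
have := warped_curvature (@der_mul _ _ VV) (@derC _ _ VV) GT' QG' (hlf2 VV) amb_GE
  (der_head_fun hs) der_P0 (der_head_fun (smooth_derive1 hs)) amb_curv sP.
have [v] := V0; rewrite interval_prod_image => -[_ Wv].
(* A point of the product chart with the prescribed height [t]: the identity in the ring holds at
   every point of the chart. *)
pose w : 'rV[R]_(1 + n) := row_mx t%:M (rsubmx v).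
have wo : w 0 o = t by rewrite ordE row_mxEl mxE.
have Vw : rset VV w by rewrite /= interval_prod_image /= wo row_mxKr.
move/(congr1 (fun f : sfun VV => ev (Rpoint Vw) f)); rewrite evN evM ev_cst.
by rewrite /ev [LHS](mksE _ Vw) [X in _ = - (_ * X) -> _](mksE _ Vw) /= wo.
Qed.

End WarpedAmbient.



(** * Coordinate form of L and L', and the soliton equations over a ring *)

Section OperatorCoefficients.
Variables (A : comNzRingType) (m : nat) (D : 'I_m -> {additive A -> A}).
Variables (q : 'M[A]_m) (gam : 'I_m -> 'M[A]_m) (c : A) (df : 'cV[A]_m).

(** The first-order coefficients of L in coordinates, the form in which the maximum principle takes
    an operator; [tdrift] below serves L'. *)
Definition drift : 'rV[A]_m := \row_k
  (c * (df^T *m q) 0 k - \sum_(a < m) \sum_(b < m) q a b * gam a b k).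

Lemma dlap_drift w : dlap D q gam c df w =
  \sum_a \sum_b q a b * D a (D b w) + \sum_k drift 0 k * D k w.
Proof.
rewrite /dlap /der2.
under eq_bigr => a _ do under eq_bigr => b _ do rewrite mulrBr.
under eq_bigr => a _ do rewrite sumrB.
rewrite sumrB -addrA; congr (_ + _).
under [RHS]eq_bigr => k _ do rewrite mxE mulrBl mulr_suml.
rewrite sumrB addrC; congr (_ - _).
  by rewrite mulr_sumr; apply: eq_bigr => k _; rewrite mulrA.
rewrite [RHS]exchange_big /=; apply: eq_bigr => a _.
under [RHS]eq_bigr => k _ do rewrite mulr_suml.
rewrite [RHS]exchange_big /=; apply: eq_bigr => b _.
by rewrite mulr_sumr; apply: eq_bigr => k _; rewrite mulrA.
Qed.

Definition tdrift (S : 'M[A]_m) (Hi : A) : 'rV[A]_m := \row_k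
  (drift 0 k + Hi * (\sum_a q a k * D a (\tr S)) *+ 2).

Lemma tlap_drift S Hi w : tlap D q gam S c df Hi w =
  \sum_a \sum_b q a b * D a (D b w) + \sum_k tdrift S Hi 0 k * D k w.
Proof.
rewrite /tlap dlap_drift -addrA; congr (_ + _).
under [RHS]eq_bigr => k _ do rewrite mxE mulrDl.
rewrite big_split /=; congr (_ + _).
rewrite /dgrad exchange_big mulr_sumr -sumrMnl; apply: eq_bigr => k _.
rewrite mulrnAl -mulrA mulr_suml; congr (_ * _ *+ 2).
by apply: eq_bigr => a _; rewrite mulrA.
Qed.

End OperatorCoefficients.

Section SolitonRing.
Variables (A : comNzRingType) (m : nat) (D : 'I_m -> {additive A -> A}).
Hypothesis DM : forall a x y, D a (x * y) = D a x * y + x * D a y.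
Hypothesis DC : forall a b x, D a (D b x) = D b (D a x).
Variables (G : 'M[A]_(1 + m)) (C : 'I_(1 + m) -> 'M[A]_(1 + m)).
Variables (J : 'M[A]_(m, 1 + m)) (N : 'rV[A]_(1 + m)).
Variables (g q : 'M[A]_m) (half : A).
Let CF (a : 'I_m) : 'M[A]_(1 + m) := \sum_(r < 1 + m) J a r *: C r.
Hypotheses (GT : G^T = G) (CC : forall r s, row r (C s) = row s (C r)).
Hypothesis JC : forall a b r, D a (J b r) = D b (J a r).
Hypothesis CG : tcompat D CF G.
Hypotheses (gE : g = J *m G *m J^T) (qg : q *m g = 1%:M) (half2 : half + half = 1).
Hypotheses (NN : N *m G *m N^T = 1%:M) (JN : J *m G *m N^T = 0).
Variables (X : 'rV[A]_(1 + m)) (phi : A).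
Hypothesis conf : forall a, tder D CF a X = phi *: row a J.

Local Notation gam := (tgam D g q half).
Local Notation Af := (shape_form D G C J N).
Local Notation S := (Af *m q).
Local Notation df := (J *m G *m X^T).
Local Notation theta := ((N *m G *m X^T) 0 0).

Let qg' : q *m (J *m G *m J^T) = 1%:M. Proof. by rewrite -gE. Qed.
Let gT : g^T = g. Proof. by rewrite gE !trmx_mul trmxK GT mulmxA. Qed.

Lemma sr_AT : Af^T = Af. Proof. exact: shape_formT. Qed.

Lemma sr_SgE : S *m g = Af. Proof. by rewrite -mulmxA qg mulmx1. Qed.

Lemma sr_sym : (S *m g)^T = S *m g.
Proof. by rewrite sr_SgE sr_AT. Qed.

Lemma sr_weingarten a : tder D CF a N = - (row a S *m J).
Proof. exact: (weingarten_formula DM GT CG qg' half2 NN JN). Qed.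

Lemma sr_dtheta a : D a theta = - (S *m df) a 0.
Proof.
rewrite (diff_support DM GT CG qg' half2 NN JN conf).
by rewrite -row_mul mxE.
Qed.

Lemma sr_hessf a : map_mx (D a) df =
  gam a *m df + theta *: (S *m g *m delta_mx a 0) + phi *: (g *m delta_mx a 0).
Proof.
have := hess_potential DM GT CC JC CG qg' half2 NN JN conf a.
by rewrite -gE => ->; rewrite sr_SgE (shape_colE G N CC JC) trmx_delta.
Qed.

Variable f : A.
Hypothesis Df : forall b, D b f = df b 0.

Lemma sr_hess a b : D a (D b f) =
  \sum_k gam a b k * D k f + theta * Af a b + phi * g a b.
Proof.
have /colP/(_ b) := sr_hessf a; rewrite mxE -Df => ->.
have F (M : 'M[A]_m) : M^T = M -> (M *m delta_mx a 0 : 'cV_m) b 0 = M a b.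
  by move=> MT; rewrite -colE mxE -{1}MT mxE.
rewrite !addmxE !scalemxE sr_SgE !F ?sr_AT //; congr (_ + _ + _).
by rewrite mxE; apply: eq_bigr => k _; rewrite Df.
Qed.

Variables (kappa c hh : A).
Hypothesis curvF : forall a b, tcurv D CF a b =
  kappa *: (G *m (row b J)^T *m row a J - G *m (row a J)^T *m row b J).
Hypotheses (cK : forall a, D a c = 0) (trS : \tr S = c * theta).
Hypothesis XX : (X *m G *m X^T) 0 0 = hh ^+ 2.

Let codazzi a b : map_mx (D b) (row a S) + row a S *m gam b =
  map_mx (D a) (row b S) + row b S *m gam a.
Proof.
have := codazzi_rows DM DC GT CC JC CG qg' half2 NN JN curvF a b.
by rewrite -gE.
Qed.

Let gauss a b : tcurv D gam a b =
  S *m g *m delta_mx b a *m S - S *m g *m delta_mx a b *m S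
  + kappa *: (g *m delta_mx b a - g *m delta_mx a b).
Proof.
have := gauss_equation DM DC GT CC JC CG qg' half2 NN JN curvF a b.
rewrite -gE => ->; congr (_ + _).
rewrite sr_SgE !(shape_colE G N CC JC) !trmx_delta !rowE.
by rewrite -!mulmxA !(mulmxA (delta_mx _ 0) (delta_mx 0 _)) !mul_delta_mx.
Qed.

Let gamC a b : row a (gam b) = row b (gam a).
Proof. exact: tgamC. Qed.

Let gamg : tcompat D gam g.
Proof. exact: tgam_compat. Qed.

Let pyth : (df^T *m q *m df) 0 0 + theta ^+ 2 = hh ^+ 2.
Proof. by rewrite -XX; exact: (conformal_pythagoras GT qg' NN JN). Qed.

Lemma sr_mean : dlap D q gam c df (\tr S) = - (c * phi + \tr (S *m S)) * \tr S.
Proof.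
exact: (dlap_mean_curvature DM DC gT qg gamC gamg sr_sym codazzi gauss sr_hessf
  sr_dtheta cK trS).
Qed.

Variable Hi : A.
Hypothesis HHi : \tr S * Hi = 1.
Local Notation B := (Hi *: S).

Lemma sr_eder_sym a : (eder D gam a B *m g)^T = eder D gam a B *m g.
Proof.
have E := eder_sym DM gamg sr_sym a.
by rewrite ederZ // mulmxDl -!scalemxAl linearD /= !linearZ /= E sr_sym.
Qed.

Lemma sr_trsq : tlap D q gam S c df Hi (\tr (B *m B)) =
  (\sum_(a < m) \sum_(b < m) q a b * \tr (eder D gam a B *m eder D gam b B)) *+ 2
  + kappa * (m%:R * \tr (B *m B) - 1) *+ 2.
Proof.
exact: (tlap_trsq DM DC gT qg gamC gamg sr_sym codazzi gauss sr_hessf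
  sr_dtheta cK trS HHi).
Qed.

Lemma sr_quotient gm : f = \tr S * gm -> tlap D q gam S c df Hi gm =
  Hi * (m%:R * phi + c * hh ^+ 2) + gm * (c * phi + \tr (S *m S)).
Proof.
rewrite -pyth; apply: (tlap_quotient DM DC gT qg gamC gamg sr_sym codazzi gauss sr_hessf
  sr_dtheta cK trS HHi) => //; exact: Df.
Qed.

End SolitonRing.



(** * The antiderivative of the warping function *)

Section Antiderivative.
Context {R : realType} (I : set R) (h : R -> R) (t0 : R).
Hypotheses (I_open : open I) (I_itv : is_interval I) (It0 : I t0).
Hypothesis hs : smooth_fun_on I h.

Let hc t : I t -> {for t, continuous h}.
Proof.
move=> It; have /derivable1_diffP := @hs 0%N t It.
exact: differentiable_continuous.
Qed.

Let I_below t : I t -> exists2 a, I a & a < t.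
Proof.
move=> It; have /nbhs_ballP[e /= e0 eI] := open_nbhs_nbhs (conj I_open It).
exists (t - e / 2); last by rewrite ltrBlDr ltrDl divr_gt0.
apply: eI; rewrite /ball /= opprB addrC subrK ger0_norm ?divr_ge0 ?ltW //.
by rewrite ltr_pdivrMr // ltr_pMr // ltr1n.
Qed.

Let I_above t : I t -> exists2 a, I a & t < a.
Proof.
move=> It; have /nbhs_ballP[e /= e0 eI] := open_nbhs_nbhs (conj I_open It).
exists (t + e / 2); last by rewrite ltrDl divr_gt0.
apply: eI; rewrite /ball /= opprD addrA subrr sub0r normrN ger0_norm ?divr_ge0 ?ltW //.
by rewrite ltr_pdivrMr // ltr_pMr // ltr1n.
Qed.

Lemma antiderivative t : I t ->
  derivable (fun t => oriented_integral t0 t h) t 1 /\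
  derive1 (fun t => oriented_integral t0 t h) t = h t.
Proof.
move=> It.
(* With a lower endpoint [a] to the left of both [t] and [t0], the oriented integral is F x - F t0
   for x near [t], in either order of x and [t0]. *)
have [a Ia] : exists2 a, I a & (a < t) && (a < t0).
  have Im : I (Num.min t t0) by rewrite /Num.min; case: ifP.
  by have [a Ia] := I_below Im; rewrite lt_min => H; exists a.
move=> /andP[at1 at0].
have [u Iu] : exists2 u, I u & (t < u) && (t0 < u).
  have Im : I (Num.max t t0) by rewrite /Num.max; case: ifP.
  by have [u Iu] := I_above Im; rewrite gt_max => H; exists u.
move=> /andP[tu t0u].
have auI x : a <= x <= u -> I x by exact: (I_itv Ia Iu).
have intg : lebesgue_measure.-integrable `[a, u] (EFin \o h).
  apply: continuous_compact_integrable; first exact: segment_compact.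
  apply: continuous_in_subspaceT => x; rewrite inE /= in_itv /= => /auI.
  exact: hc.
pose F x := \int[lebesgue_measure]_(s in [set` `[a, x]]) h s.
have [dF F'] : derivable F t 1 /\ derive1 F t = h t.
  by apply: (continuous_FTC1_closed tu intg at1); exact: hc.
have sub x y : a <= x -> x <= y -> y <= u ->
    F y - F x = \int[lebesgue_measure]_(s in `[x, y]) h s.
  move=> ax xy yu; rewrite /F Rintegral_itvB ?bnd_simp //.
    apply: Rintegral_itv_obnd_cbnd; apply: integrableS intg => //= z.
    by rewrite /= !in_itv /= => /andP[xz zy]; rewrite (le_trans ax (ltW xz)) (le_trans zy yu).
  apply: integrableS intg => //= z.
  by rewrite /= !in_itv /= => /andP[-> zy]; rewrite (le_trans zy yu).
have E : \forall x \near t, F x - F t0 = oriented_integral t0 x h.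
  have: \forall x \near t, x \in `]a, u[.
    by apply: near_in_itvoo; rewrite in_itv /= at1 tu.
  apply: filterS => x; rewrite in_itv /= => /andP[ax xu].
  rewrite /oriented_integral; case: ifPn => [t0x|].
    by apply: sub => //; exact: ltW.
  rewrite -ltNge => xt0; rewrite -sub ?opprB //; exact: ltW.
have dF1 : is_derive t 1 F (h t) := DeriveDef dF (etrans (esym (derive1E F t)) F').
have dFB : is_derive t 1 (fun x => F x - F t0) (h t).
  have := is_deriveB dF1 (is_derive_cst (F t0) t 1); rewrite subr0; exact.
have [d1 d2] := near_eq_is_derive E dFB.
by split; [exact: d1|rewrite derive1E].
Qed.

End Antiderivative.



(** * Solitons in charts *)

Record soliton (R : realType) (m : nat) := Soliton {
  sI : set R; sh : R -> R; st0 : R;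
  sP : charted R m; sg0 : gram_field sP; skappa : R;
  sM : charted R m; sg : gram_field sM; spsi : sM -> interval_prod sI sP;
  sN : @field_along R m (1 + m) sM (interval_prod sI sP); sc : R;
  sI_open : open sI; sI_itv : is_interval sI; sIt0 : sI st0;
  sh_smooth : smooth_fun_on sI sh; sh_pos : forall t, sI t -> 0 < sh t;
  sP_manifold : smooth_manifold sP; sg0_riem : riemannian sg0;
  scurv : constant_curvature (warped_metric sI sh sg0) skappa;
  sM_manifold : smooth_manifold sM; sg_riem : riemannian sg;
  spsi_isom : isometric_immersion sg (warped_metric sI sh sg0) spsi;
  sN_normal : unit_normal (warped_metric sI sh sg0) spsi sN;
  s_soliton : mcf_soliton sg (warped_metric sI sh sg0) spsi (h_dt sI sh sP) sc }.

Section Package.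
Context {R : realType} {m : nat} (s : soliton R m).
Local Notation I := (sI s).
Local Notation h := (sh s).
Local Notation t0 := (st0 s).
Local Notation P := (sP s).
Local Notation M := (sM s).
Local Notation g := (@sg _ _ s).
Local Notation psi := (@spsi _ _ s).
Local Notation N := (@sN _ _ s).
Local Notation c := (sc s).
Local Notation kappa := (skappa s).
Local Notation Q := (interval_prod I P).
Local Notation gQ := (warped_metric I h (@sg0 _ _ s)).
Local Notation qdom d := (@cdom R _ Q d).
Local Notation qcoord d := (@coord R _ Q d).
Local Notation qparam d := (@param R _ Q d).
Local Notation o := (ord0 : 'I_(1 + m)).

Definition height_potential (t : R) := oriented_integral t0 t h.
Definition eta (x : M) : R := height_potential (psi x).1.
Definition phi (x : M) : R := derive1 h (psi x).1.

Lemma height_potentialE t : I t -> derivable height_potential t 1 /\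
  derive1 height_potential t = h t.
Proof. exact: (antiderivative (@sI_open _ _ s) (@sI_itv _ _ s) (@sIt0 _ _ s) (@sh_smooth _ _ s)). Qed.

Lemma smooth_height_potential : smooth_fun_on I height_potential.
Proof.
move=> [|k] t It; first by have [] := height_potentialE It.
have E j : forall u, I u -> derive1n j.+1 height_potential u = derive1n j h u.
  elim: j => [|j IH] u Iu; first by have [_] := height_potentialE Iu.
  rewrite -[LHS]/(derive1 (derive1n j.+1 height_potential) u).
  rewrite -[RHS]/(derive1 (derive1n j h) u) !derive1E; apply: near_eq_derive.
  by apply: filterS IH _; exact: open_nbhs_nbhs (conj (@sI_open _ _ s) Iu).
apply: (@near_eq_derivable _ _ _ (derive1n k h)); last exact: sh_smooth.
apply: filterS (open_nbhs_nbhs (conj (@sI_open _ _ s) It)) => u Iu.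
by rewrite E.
Qed.

Variables (i : idx M) (d : idx P).

(* The part of chart [i] that is mapped into chart [d] of the ambient space. *)
Definition hdom : set 'rV[R]_m := coord i @` (cdom i `&` psi @^-1` qdom d).

Let Mchart : is_chart i. Proof. by have [_ _ _ /(_ i)] := @sM_manifold _ _ s. Qed.
Let Pchart : is_chart d. Proof. by have [_ _ _ /(_ d)] := @sP_manifold _ _ s. Qed.

Lemma hdomP v : hdom v ->
  [/\ cdom i (param i v), qdom d (psi (param i v)) & coord i (param i v) = v].
Proof.
have [_ _ _ _ Pi] := Mchart.
by move=> [x [ix dx] <-]; rewrite Pi.
Qed.

Lemma qdom_open : open (qdom d).
Proof.
have [Po _ _ _ _] := Pchart.
rewrite openE => -[t p] [/= It dp].
have nI : nbhs t I := open_nbhs_nbhs (conj (@sI_open _ _ s) It).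
have nd : nbhs p (cdom d) := open_nbhs_nbhs (conj Po dp).
exists (I, cdom d) => //.
Qed.

Lemma qparamK y : qdom d y -> qparam d (qcoord d y) = y.
Proof.
have [_ _ _ _ Pi] := Pchart.
case: y => t p [It dp] /=; rewrite row_mxKl row_mxKr Pi //.
by rewrite mxE eqxx.
Qed.

Lemma hdom_open : open hdom.
Proof.
have [Mo io ic pc Pi] := Mchart; have [_ [psic _] _] := @spsi_isom _ _ s.
have -> : hdom = [set v | (coord i @` cdom i) v /\ (psi @^-1` qdom d) (param i v)].
  apply/seteqP; split=> v.
    move=> hv; have [ix dx vE] := hdomP hv; split=> //.
    by exists (param i v).
  by move=> [[x ix <-]] /=; rewrite Pi // => dx; exists x.
rewrite openE => v [iv dv].
have Vi := open_nbhs_nbhs (conj io iv).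
have Vd : nbhs v [set w | (psi @^-1` qdom d) (param i w)].
  have pv := pc v (mem_set iv).
  have op : open (psi @^-1` qdom d) by apply: open_comp qdom_open => y _; exact: psic.
  exact: (pv _ (open_nbhs_nbhs (conj op dv))).
by apply: filterS2 Vi Vd.
Qed.

Lemma hdom_nonempty x : cdom i x -> qdom d (psi x) -> hdom (coord i x).
Proof. by move=> ix dx; exists x. Qed.

(** The form [weingarten] uses the target chart at psi x, which may jump with x. With [d] fixed the
    entries are smooth on [hdom] and can be differentiated. *)
Definition sform (x : M) : 'M[R]_m :=
  \matrix_(a, b) inner (gQ d (psi x)) (second_form gQ psi i d x a b) (N d x).

Variable U : region R m.
Hypothesis UW : forall v, rset U v -> hdom v.
Local Notation pnt p := (param i (rpt (p : rpoint U))).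

Let pntP (p : rpoint U) : [/\ cdom i (pnt p), qdom d (psi (pnt p)) &
  coord i (pnt p) = rpt p].
Proof. exact: hdomP (UW (rptP p)). Qed.

Lemma target_nonempty : exists v, (qcoord d @` qdom d) v.
Proof.
have [v Uv] := rset_neq0 U; have [_ dx _] := pntP (Rpoint Uv).
by exists (qcoord d (psi (param i v))); exists (psi (param i v)).
Qed.

Local Notation V := (@ambient_region R m I P (@sI_open _ _ s) (@sP_manifold _ _ s) d target_nonempty).

Lemma smooth_subset (W : set 'rV[R]_m) f : smooth_on W f ->
  (forall v, rset U v -> W v) -> smooth_on U f.
Proof. by move=> fs UW' w v Uv; apply: fs; exact: UW'. Qed.

Lemma loc_subproof : (forall v, rset U v -> rset V (loc psi i d v)) /\
  smooth_map_on U (loc psi i d).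
Proof.
have [_ [_ ls] _] := @spsi_isom _ _ s.
split=> [v Uv|k]; last exact: (smooth_subset (ls i d k) UW).
have [_ dx _] := pntP (Rpoint Uv).
by exists (psi (param i v)).
Qed.

Definition locm : smap U V := Smap loc_subproof.
Local Notation pbk := (pb locm).

Definition lpt (p : rpoint U) : rpoint V := Rpoint (loc_subproof.1 _ (rptP p)).

Lemma ev_pb p f : ev p (pbk f) = ev (lpt p) f.
Proof. exact: pbE (rptP p). Qed.

Lemma lptE p : rpt (lpt p) = qcoord d (psi (pnt p)).
Proof. by []. Qed.

Lemma head_lpt p : rpt (lpt p) 0 o = (psi (pnt p)).1.
Proof.
rewrite lptE /=; have -> : o = lshift m ord0 by exact: val_inj.
by rewrite row_mxEl mxE eqxx.
Qed.

Local Notation aG := (@amb_G R m I h P _ (@sI_open _ _ s) (@sh_smooth _ _ s) (@sP_manifold _ _ s)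
  (@sg0_riem _ _ s) d target_nonempty).
Local Notation aC := (@amb_C R m I h P _ (@sI_open _ _ s) (@sh_smooth _ _ s) (@sh_pos _ _ s)
  (@sP_manifold _ _ s) (@sg0_riem _ _ s) d target_nonempty).
Local Notation hfun := (@head_fun R m I P (@sI_open _ _ s) (@sP_manifold _ _ s) d target_nonempty _).

Lemma ev_head p f (fs : smooth_fun_on I f) : ev p (pbk (hfun fs)) = f (psi (pnt p)).1.
Proof. by rewrite ev_pb -head_lpt; exact: mksE (rptP (lpt p)). Qed.

Definition kJ : 'M[sfun U]_(m, 1 + m) := \matrix_(a, k) der a (smcoord locm k).
Definition kG : 'M[sfun U]_(1 + m) := map_mx pbk aG.
Definition kC (r : 'I_(1 + m)) : 'M[sfun U]_(1 + m) := map_mx pbk (aC r).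

Lemma N_smooth k : smooth_on U (fun v => N d (param i v) 0 k).
Proof.
have [_ Ns _ _] := @sN_normal _ _ s.
exact: (smooth_subset (Ns i d k) UW).
Qed.

Definition kN : 'rV[sfun U]_(1 + m) := \row_k mks (N_smooth k).

Lemma g_smooth a b : smooth_on U (fun v => gram g i v a b).
Proof.
have [_ _ gs _] := sg_riem s; apply: (smooth_subset (gs i a b)) => v Uv.
by have [ix _ vE] := pntP (Rpoint Uv); exists (param i v).
Qed.

Lemma g_sym v : rset U v -> (gram g i v)^T = gram g i v.
Proof.
move=> Uv; have [ix _ _] := pntP (Rpoint Uv).
by have [gT _ _ _] := sg_riem s; exact: gT.
Qed.

Lemma g_posdef v : rset U v -> posdef (gram g i v).
Proof.
move=> Uv; have [ix _ _] := pntP (Rpoint Uv).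
by have [_ gp _ _] := sg_riem s; exact: gp.
Qed.

Definition kg : 'M[sfun U]_m := Gm g_smooth.
Definition kq : 'M[sfun U]_m := Qm g_smooth g_sym g_posdef.
Definition khh : sfun U := pbk (hfun (@sh_smooth _ _ s)).
Definition kphi : sfun U := pbk (hfun (smooth_derive1 (@sh_smooth _ _ s))).
Definition keta : sfun U := pbk (hfun smooth_height_potential).
Definition kX : 'rV[sfun U]_(1 + m) := khh *: delta_mx 0 o.
Definition kA : 'M[sfun U]_m := shape_form der kG kC kJ kN.
Local Notation CF := (fun a => \sum_(r < 1 + m) kJ a r *: kC r).

Lemma chain_pb a f : der a (pbk f) = \sum_k kJ a k * pbk (der k f).
Proof. by rewrite der_pb; apply: eq_bigr => k _; rewrite mxE. Qed.

Lemma k_GT : kG^T = kG.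
Proof. rewrite /kG map_trmx; congr (map_mx _ _); apply: GmT => v Vv.
apply: warped_sym Vv; first exact: sP_manifold.
exact: sg0_riem. Qed.

Lemma k_CC r u : row r (kC u) = row u (kC r).
Proof. by rewrite /kC -!map_row CmC. Qed.

Lemma k_JC a b r : der a (kJ b r) = der b (kJ a r).
Proof. by rewrite !mxE derC. Qed.

Lemma k_CG : tcompat der CF kG.
Proof.
apply: (pullback_compat chain_pb).
exact: Cm_compat.
Qed.

Lemma ev_kJ p : map_mx (ev p) kJ = dpsi psi i d (pnt p).
Proof.
have [_ _ vE] := pntP p.
apply/matrixP => a k; rewrite !mxE vE; apply: ev_der => w.
exact: mksE (rptP w).
Qed.

Lemma ev_kG p : map_mx (ev p) kG = gQ d (psi (pnt p)).
Proof.
have [_ dx _] := pntP p.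
transitivity (gram gQ d (rpt (lpt p))); last by rewrite lptE /gram qparamK.
rewrite -[RHS](@ev_mksM R _ V _ _ _ (warped_smooth (@sI_open _ _ s) (@sh_smooth _ _ s) (@sP_manifold _ _ s)
  (@sg0_riem _ _ s) (d := d))).
by apply/matrixP => a b; rewrite [LHS]mxE [X in ev p X]mxE ev_pb [RHS]mxE.
Qed.

Lemma ev_kC p r a b : ev p (kC r a b) =
  christoffel (gram gQ d) b r a (qcoord d (psi (pnt p))).
Proof. by rewrite mxE ev_pb; exact: ev_Cm. Qed.

Lemma ev_kN p : map_mx (ev p) kN = N d (pnt p).
Proof. by apply/rowP => k; rewrite !mxE; exact: mksE (rptP p). Qed.

Lemma ev_kg p : map_mx (ev p) kg = g i (pnt p).
Proof. exact: ev_mksM. Qed.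

Lemma ev_kq p : map_mx (ev p) kq = invmx (g i (pnt p)).
Proof. by apply/matrixP => a b; rewrite mxE; exact: ev_Qm. Qed.

Lemma k_gE : kg = kJ *m kG *m kJ^T.
Proof.
apply: sfmx_ev_eq => p; have [ix dx _] := pntP p; have [_ _ iso] := @spsi_isom _ _ s.
rewrite ev_kg !map_mxM -map_trmx !ev_kJ ev_kG.
exact: iso.
Qed.

Lemma k_qg : kq *m kg = 1%:M. Proof. exact: QmGm. Qed.

Lemma k_NN : kN *m kG *m kN^T = 1%:M.
Proof.
apply: sfmx_ev_eq => p; have [ix dx _] := pntP p; have [_ _ NN _] := @sN_normal _ _ s.
rewrite !map_mxM -map_trmx !ev_kN ev_kG map_mx1.
by rewrite [LHS]mx11_scalar; congr (_%:M); exact: NN.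
Qed.

Lemma k_JN : kJ *m kG *m kN^T = 0.
Proof.
apply: sfmx_ev_eq => p; have [ix dx _] := pntP p; have [_ _ _ JN] := @sN_normal _ _ s.
rewrite !map_mxM -map_trmx !ev_kN ev_kG ev_kJ map_mx0.
exact: JN.
Qed.

Lemma k_conf a : tder der CF a kX = kphi *: row a kJ.
Proof.
have -> : kX = map_mx pbk (hfun (@sh_smooth _ _ s) *: delta_mx 0 o : 'rV_(1 + m)).
  by rewrite map_mxZ map_delta_mx.
rewrite (pullback_tder chain_pb).
under eq_bigr => r _ do rewrite amb_conformal map_mxZ map_delta_mx.
rewrite [row a kJ]row_sum_delta scaler_sumr; apply: eq_bigr => r _.
by rewrite [in RHS]rowmxE !scalerA mulrC.
Qed.

(** The metric dual of $\partial_t$ is dt, so pairing $h\partial_t$ with a tangent vector gives h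
    times the derivative of the height. *)
Lemma k_Df b : der b keta = (kJ *m kG *m kX^T) b 0.
Proof.
have Go : kG *m (delta_mx 0 o : 'rV_(1 + m))^T = (delta_mx 0 o)^T.
  apply: sfmx_ev_eq => p; rewrite map_mxM ev_kG -!map_trmx !map_delta_mx.
  rewrite trmx_delta -colE; apply/colP => k; rewrite [LHS]mxE [RHS]mxE.
  have oE : o = lshift m ord0 by exact: val_inj.
  rewrite /warped_metric eqxx andbT oE; case: (splitP k) => j kj.
    have -> : k = lshift m j by exact: val_inj.
    by rewrite block_mxEul mxE (inj_eq (@lshift_inj _ _)).
  have -> : k = rshift 1 j by exact: val_inj.
  by rewrite block_mxEdl mxE eq_rlshift.
rewrite /kX trmxZ -scalemxAr -mulmxA Go trmx_delta -colE scalemxE mxE mulrC.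
rewrite chain_pb (bigD1 o) //= big1 ?addr0 => [|k ko]; rewrite der_head_fun.
  rewrite eqxx mul1r; congr (_ * pbk _); apply: sfun_ev_eq => p.
  rewrite /ev [LHS](mksE _ (rptP p)) [RHS](mksE _ (rptP p)).
  have [_ ->//] : derivable height_potential (rpt p 0 o) 1 /\
    derive1 height_potential (rpt p 0 o) = h (rpt p 0 o).
  have Vp : (qcoord d @` qdom d) (rpt p) := rptP p.
  by move: Vp; rewrite interval_prod_image => -[Ip _]; exact: height_potentialE.
by rewrite (negbTE ko) mul0r [pbk 0]raddf0 mulr0.
Qed.

Lemma k_curvF a b : tcurv der CF a b = sfcst U kappa *:
  (kG *m (row b kJ)^T *m row a kJ - kG *m (row a kJ)^T *m row b kJ).
Proof.
rewrite -(pb_cst locm).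
apply: (pullback_constant_curv (@der_mul _ _ U) k_JC chain_pb).
exact: amb_curv (@scurv _ _ s).
Qed.

Lemma k_XX : (kX *m kG *m kX^T) 0 0 = khh ^+ 2.
Proof.
apply: sfun_ev_eq => p.
have -> : ev p ((kX *m kG *m kX^T) 0 0) = (map_mx (ev p) (kX *m kG *m kX^T)) 0 0.
  by rewrite [RHS]mxE.
rewrite !map_mxM -map_trmx ev_kG /kX map_mxZ map_delta_mx rmorphXn /=.
rewrite trmxZ -!scalemxAl -scalemxAr !scalemxE trmx_delta -colE -rowE.
rewrite [col _ _ _ _]mxE [row _ _ _ _]mxE.
have -> : o = lshift m ord0 by exact: val_inj.
by rewrite /warped_metric block_mxEul mxE mulr1 expr2.
Qed.

End Package.



(** * Independence of the charts *)

Section ChartIndependence.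
Context {R : realType} {m : nat} (s : soliton R m).
Local Notation I := (sI s).
Local Notation h := (sh s).
Local Notation M := (sM s).
Local Notation g := (@sg _ _ s).
Local Notation psi := (@spsi _ _ s).
Local Notation N := (@sN _ _ s).
Local Notation c := (sc s).
Local Notation Q := (interval_prod I (sP s)).
Local Notation gQ := (warped_metric I h (@sg0 _ _ s)).
Local Notation qdom d := (@cdom R _ Q d).
Local Notation qcoord d := (@coord R _ Q d).
Local Notation o := (ord0 : 'I_(1 + m)).
Local Notation H := (mean_curvature g gQ psi N).
Local Notation eta := (@eta R m s).
Local Notation phi := (@phi R m s).

(** This is <X, N>: only the t-component of [N] pairs with $h\partial_t$. *)
Definition theta (d : idx Q) (x : M) : R := h (psi x).1 * N d x 0 o.

Lemma inner_normal_part i d (x : M) w : cdom i x -> qdom d (psi x) ->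
  inner (gQ d (psi x)) (normal_part gQ psi i d x w) (N d x) =
  inner (gQ d (psi x)) w (N d x).
Proof.
move=> ix dx; have [_ _ _ /(_ i d x ix dx) JN] := @sN_normal _ _ s.
rewrite /inner /normal_part !mulmxBl; rewrite -mulmxA in JN.
by rewrite -!mulmxA JN !mulmx0 subr0.
Qed.

(** A change of chart in the product fixes the t-coordinate, and therefore the t-component of
    [N]. *)
Lemma theta_transition d d' (x : M) : qdom d (psi x) -> qdom d' (psi x) -> theta d' x = theta d x.
Proof.
move=> dx d'x; have [/(_ d d' x dx d'x) Nt _ _ _] := @sN_normal _ _ s.
have oE : o = lshift m ord0 by exact: val_inj.
have tE : (fun w => @transition R (1 + m) Q d d' w 0 o) = fun w : 'rV[R]_(1 + m) => w 0 o.
  apply/funext => w; rewrite /transition /= oE row_mxEl !mxE eqxx mulr1n.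
  by congr (w 0 _); exact: val_inj.
have dE k := @coord_is_derive R (1 + m) (qcoord d (psi x)) (delta_mx 0 k) o.
rewrite /theta; congr (_ * _); rewrite Nt mxE (bigD1 o) //= big1 => [|k ko].
  have [_ E] := dE o; rewrite addr0 mxE tE /partial E.
  by rewrite mxE !eqxx mulr1.
have [_ E] := dE k; rewrite mxE tE /partial E.
by rewrite mxE eqxx eq_sym (negbTE ko) mulr0.
Qed.

Lemma chart_atP (x : M) : cdom (chart_at x) x.
Proof. by have [_ _ /(_ x) + _ _] := @sM_manifold _ _ s. Qed.

Lemma target_chart_atP (x : M) : qdom (chart_at (psi x)) (psi x).
Proof.
have [/(_ x) [d [Ix _]] _ _] := @spsi_isom _ _ s.
by have [_ _ /(_ (psi x).2) + _ _] := @sP_manifold _ _ s; split.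
Qed.

Lemma inner_conformal d (x : M) : qdom d (psi x) ->
  inner (gQ d (psi x)) (h_dt I h (sP s) d (psi x)) (N d x) = theta d x.
Proof.
move=> dx; rewrite /inner /h_dt /theta -!scalemxAl scalemxE; congr (_ * _).
rewrite /warped_metric mul_row_block !mulmx0 !mul0mx !addr0 mulmx1.
rewrite -[N d x]hsubmxK tr_row_mx mul_row_col mul1mx mul0mx addr0 mxE.
have oE : o = lshift m ord0 by exact: val_inj.
by rewrite oE row_mxEl.
Qed.

Lemma mean_curvature_theta (x : M) : H x = c * theta (chart_at (psi x)) x.
Proof.
rewrite /mean_curvature -(@s_soliton _ _ s) /inner -!scalemxAl scalemxE.
congr (_ * _); rewrite [LHS]inner_normal_part; [|exact: chart_atP|exact: target_chart_atP].
exact/inner_conformal/target_chart_atP.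
Qed.

Lemma mean_curvature_theta_chart d (x : M) : qdom d (psi x) -> H x = c * theta d x.
Proof.
move=> dx; rewrite mean_curvature_theta; congr (_ * _).
exact: theta_transition dx (target_chart_atP x).
Qed.

Definition shape_at i d (x : M) : 'M[R]_m := sform i d x *m invmx (g i x).

(** Stated for the charts in which [mean_curvature] is defined; [mean_curvature_trace] reaches the
    other charts where H is nonzero. *)
Lemma mean_curvature_trace_at (x : M) :
  H x = \tr (shape_at (chart_at x) (chart_at (psi x)) x).
Proof.
have [gT _ _ _] := @sg_riem _ _ s; have gTx := gT _ _ (chart_atP x).
have qs a b : invmx (g (chart_at x) x) a b = invmx (g (chart_at x) x) b a.
  by rewrite -{1}gTx -trmx_inv mxE.
rewrite /mean_curvature /mean_curvature_vector /inner !mulmx_suml summxE.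
apply: eq_bigr => a _.
rewrite !mulmx_suml summxE [RHS]mxE; apply: eq_bigr => b _.
rewrite -!scalemxAl scalemxE mulrC qs; congr (_ * _).
by rewrite [RHS]mxE.
Qed.

Section Region.
Variables (i : idx M) (d : idx Q) (U : region R m).
Hypothesis UW : forall v, rset U v -> hdom i d v.
Variable p : rpoint U.
Local Notation y := (param i (rpt p)).

Let yP : [/\ cdom i y, qdom d (psi y) & coord i y = rpt p].
Proof. exact: hdomP (UW (rptP p)). Qed.

Lemma ev_kA_region : map_mx (ev p) (kA UW) = sform i d y.
Proof.
have [iy dy yE] := yP.
apply/matrixP => a b; rewrite [LHS]mxE [X in ev p X]mxE [RHS]mxE.
rewrite [RHS]inner_normal_part // /inner.
have -> : ev p (shape_col der (kG UW) (kC UW) (kJ UW) (kN UW) a b 0) =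
    (map_mx (ev p) (row b (hess_along der (kC UW) (kJ UW) a) *m kG UW *m (kN UW)^T)) 0 0.
  by rewrite [RHS]mxE /shape_col -!mulmxA -row_mul rowmxE.
rewrite !map_mxM -map_trmx ev_kG ev_kN; congr ((_ *m _ *m _) 0 0).
apply/rowP => k; transitivity (ev p (hess_along der (kC UW) (kJ UW) a b k)).
  by rewrite [LHS]mxE rowmxE.
rewrite [RHS]mxE /hess_along /tder addmxE evD yE; congr (_ + _).
  rewrite [X in ev p X]mxE; apply: ev_der => w.
  rewrite mxE; apply: ev_der => z; exact: mksE (rptP z).
rewrite ev_mulmx exchange_big; apply: eq_bigr => u _ /=.
rewrite summxE ev_sum mulr_sumr; apply: eq_bigr => r _.
have J e f : ev p (kJ UW e f) = dpsi psi i d y e f.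
  by have /matrixP/(_ e f) := ev_kJ UW p; rewrite mxE.
by rewrite scalemxE evM ev_kC !J; ring.
Qed.

Lemma ev_ktheta : ev p ((kN UW *m kG UW *m (kX UW)^T) 0 0) = theta d y.
Proof.
have [iy dy yE] := yP.
rewrite -(inner_conformal dy) innerC; last first.
  have E : (map_mx (ev p) (kG UW))^T = map_mx (ev p) (kG UW) by rewrite map_trmx k_GT.
  by rewrite ev_kG in E.
have -> : ev p ((kN UW *m kG UW *m (kX UW)^T) 0 0) =
  (map_mx (ev p) (kN UW *m kG UW *m (kX UW)^T)) 0 0 by rewrite [RHS]mxE.
rewrite !map_mxM -map_trmx ev_kN ev_kG /inner; congr ((_ *m _^T) 0 0).
rewrite /kX map_mxZ map_delta_mx /h_dt; congr (_ *: _); first exact: ev_head.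
apply/rowP => k; rewrite [LHS]mxE; have oE : o = lshift m ord0 by exact: val_inj.
rewrite eqxx /= oE; case: (splitP k) => j kj.
  have -> : k = lshift m j by exact: val_inj.
  by rewrite row_mxEl mxE (inj_eq (@lshift_inj _ _)) ord1.
have -> : k = rshift 1 j by exact: val_inj.
by rewrite row_mxEr mxE eq_rlshift.
Qed.

End Region.

Section Chart.
Variables (i : idx M) (d : idx Q) (x : M).
Hypotheses (ix : cdom i x) (dx : qdom d (psi x)).
Local Notation v := (coord i x).

Let hv : hdom i d v. Proof. exact: hdom_nonempty. Qed.
Definition chart_region : region R m :=
  @Region R m (hdom i d) (@hdom_open R m s i d) (ex_intro _ v hv).
Local Notation U := chart_region.
Let UW w : rset U w -> hdom i d w. Proof. by []. Qed.
Let p : rpoint U := @Rpoint R m U v hv.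
Let pE : param i (rpt p) = x.
Proof. by have [_ _ _ /(_ i)[_ _ _ _ E] _] := @sM_manifold _ _ s; exact: E. Qed.

Lemma ev_kA : map_mx (ev p) (kA UW) = sform i d x.
Proof. by rewrite ev_kA_region pE. Qed.

(** All quantities here except [sform] are independent of [d], so the identity pins down the second
    fundamental form wherever [theta] is nonzero. *)
Lemma hess_eta a b : partial a (partial b (eta \o param i)) v =
  \sum_k christoffel (gram g i) k a b v * partial k (eta \o param i) v
  + theta d x * sform i d x a b + phi x * g i x a b.
Proof.
have D1 e (w : rpoint U) : ev w (der e (keta UW)) = partial e (eta \o param i) (rpt w).
  by apply: ev_der => y; exact: ev_head.
have D2 : ev p (der a (der b (keta UW))) = partial a (partial b (eta \o param i)) v.
  by apply: ev_der => y; exact: D1.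
have := sr_hess (@der_mul _ _ U) (k_GT UW) (k_CC UW) (k_JC UW) (k_CG UW) (k_gE UW)
  (k_qg UW) (hlf2 U) (k_NN UW) (k_JN UW) (k_conf UW) (k_Df UW) a b.
move=> /(congr1 (ev p)); rewrite D2 => ->; rewrite !evD ev_sum !evM; congr (_ + _ + _).
- apply: eq_bigr => k _; rewrite evM D1; congr (_ * _).
  exact: (ev_Cm (g_smooth UW) (g_sym UW) (g_posdef UW)).
- have /matrixP/(_ a b) := ev_kA; rewrite mxE => ->; congr (_ * _).
  by rewrite ev_ktheta pE.
- congr (_ * _); first by rewrite ev_head pE.
  by have /matrixP/(_ a b) := ev_kg UW p; rewrite mxE pE.
Qed.

(** Row [a] is $\bar\nabla_{\partial_a}N$ in the chart [d]. *)
Definition normal_covd : 'M[R]_(m, 1 + m) :=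
  \matrix_(a, k) (partial a (fun w => N d (param i w) 0 k) v +
    \sum_u \sum_r N d x 0 u * (dpsi psi i d x a r * christoffel (gram gQ d) k r u (qcoord d (psi x)))).

Lemma weingarten_at : normal_covd = - (shape_at i d x *m dpsi psi i d x).
Proof.
apply/matrixP => a k.
have := sr_weingarten (@der_mul _ _ U) (k_GT UW) (k_CG UW) (k_gE UW)
  (k_qg UW) (hlf2 U) (k_NN UW) (k_JN UW) a.
move=> /rowP/(_ k)/(congr1 (ev p)) E.
have X : (shape_at i d x *m dpsi psi i d x) a k = ev p ((row a (kA UW *m kq UW) *m kJ UW) 0 k).
  rewrite -row_mul rowmxE.
  have /matrixP/(_ a k) : map_mx (ev p) (kA UW *m kq UW *m kJ UW) =
    shape_at i d x *m dpsi psi i d x by rewrite !map_mxM ev_kA ev_kJ ev_kq pE.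
  by rewrite [LHS]mxE => <-.
rewrite oppmxE X -evN; rewrite oppmxE in E; rewrite -E.
rewrite /tder addmxE evD [LHS]mxE; congr (_ + _).
  rewrite [X in ev p X]mxE; symmetry; apply: ev_der => w.
  by rewrite mxE; exact: mksE (rptP w).
rewrite ev_mulmx; apply: eq_bigr => u _.
rewrite summxE ev_sum mulr_sumr; apply: eq_bigr => r _.
have J e f : ev p (kJ UW e f) = dpsi psi i d x e f.
  by have /matrixP/(_ e f) := ev_kJ UW p; rewrite mxE pE.
have Nu : ev p (kN UW 0 u) = N d x 0 u.
  by have /matrixP/(_ 0 u) := ev_kN UW p; rewrite mxE pE.
by rewrite scalemxE evM ev_kC pE J Nu.
Qed.

End Chart.

Section Transition.
Variables (i i' : idx M) (d : idx Q) (x : M).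
Hypotheses (ix : cdom i x) (i'x : cdom i' x) (dx : qdom d (psi x)).
Local Notation T := (jac (transition i' i) (coord i' x)).
Let W : set 'rV[R]_m := coord i' @` (cdom i' `&` cdom i).

Let chart_of j : @is_chart R m M j. Proof. by have [_ _ _ /(_ j)] := @sM_manifold _ _ s. Qed.

Lemma transition_open : open W.
Proof.
have [Mo io ic pc Pi] := chart_of i'; have [Mo' _ _ _ _] := chart_of i.
have -> : W = [set v | (coord i' @` cdom i') v /\ cdom i (param i' v)].
  apply/seteqP; split=> v.
    by move=> [y [i'y iy] <-]; rewrite /= Pi //; split=> //; exists y.
  by move=> [[y i'y <-]]; rewrite /= Pi // => iy; exists y.
rewrite openE => v [iv dv].
have Vd : nbhs v [set w | cdom i (param i' w)].
  exact: (pc v (mem_set iv) _ (open_nbhs_nbhs (conj Mo' dv))).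
by apply: filterS2 (open_nbhs_nbhs (conj io iv)) Vd.
Qed.

Lemma chain_transition (f : M -> R) (V : set 'rV[R]_m) a : open V -> V (coord i x) ->
  smooth_on V (f \o param i) ->
  partial a (f \o param i') (coord i' x) =
    \sum_b T a b * partial b (f \o param i) (coord i x).
Proof.
move=> Vo Vx fs; have [_ _ _ _ Pi] := chart_of i; have [_ _ _ _ Pi'] := chart_of i'.
have Wx : W (coord i' x) by exists x.
have Fx : transition i' i (coord i' x) = coord i x by rewrite /transition /= Pi'.
have [_ _ _ _ ts] := @sM_manifold _ _ s.
have VF : V (transition i' i (coord i' x)) by rewrite Fx.
transitivity (partial a ((f \o param i) \o transition i' i) (coord i' x)).
  apply: (partial_eq _ transition_open Wx) => w [y [i'y iy] <-] /=.
  by rewrite /transition /= Pi' // Pi.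
rewrite (smooth_partial_comp a transition_open Vo Wx VF fs (ts i' i)) Fx.
by apply: eq_bigr => b _; rewrite mxE.
Qed.

Lemma dpsi_transition : dpsi psi i' d x = T *m dpsi psi i d x.
Proof.
apply/matrixP => a k; rewrite [LHS]mxE [RHS]mxE.
have [_ [_ ls] _] := @spsi_isom _ _ s.
have hx : hdom i d (coord i x) by exact: hdom_nonempty.
rewrite -[LHS]/(partial a ((fun y => qcoord d (psi y) 0 k) \o param i') (coord i' x)).
rewrite (chain_transition a (@hdom_open R m s i d) hx (ls i d k)).
by apply: eq_bigr => b _; rewrite [dpsi _ _ _ _ b k]mxE.
Qed.

Lemma normal_covd_transition : normal_covd i' d x = T *m normal_covd i d x.
Proof.
apply/matrixP => a k; rewrite [LHS]mxE [RHS]mxE.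
have [_ Ns _ _] := @sN_normal _ _ s.
have hx : hdom i d (coord i x) by exact: hdom_nonempty.
rewrite -[X in X + _ = _]/(partial a ((fun y => N d y 0 k) \o param i') (coord i' x)).
rewrite (chain_transition a (@hdom_open R m s i d) hx (Ns i d k)).
under [RHS]eq_bigr => b _ do rewrite [normal_covd _ _ _ _ _]mxE mulrDr.
rewrite big_split; congr (_ + _).
under [RHS]eq_bigr => b _ do rewrite mulr_sumr.
rewrite [RHS]exchange_big; apply: eq_bigr => u _ /=.
under [RHS]eq_bigr => b _ do rewrite mulr_sumr.
rewrite [RHS]exchange_big; apply: eq_bigr => r _ /=.
rewrite dpsi_transition mxE mulr_suml mulr_sumr; apply: eq_bigr => b _; ring.
Qed.

(* Weingarten's formula involves only first derivatives of the normal field, so a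
   change of chart requires the first-order chain rule only. *)
Lemma shape_transition : T \in unitmx /\ shape_at i' d x *m T = T *m shape_at i d x.
Proof.
have [gT gp _ /(_ i' i x i'x ix) gE] := @sg_riem _ _ s.
have gu j : cdom j x -> g j x \in unitmx.
  by move=> jx; apply: posdef_unit; [exact: gT|exact: gp].
split.
  by have := gu i' i'x; rewrite gE !unitmx_mul => /andP[/andP[]].
have [_ _ /(_ i d x ix dx) iso] := @spsi_isom _ _ s.
have := normal_covd_transition; rewrite (weingarten_at ix dx) (weingarten_at i'x dx).
rewrite dpsi_transition mulmxN => /oppr_inj E.
have K : dpsi psi i d x *m (gQ d (psi x) *m ((dpsi psi i d x)^T *m invmx (g i x))) = 1%:M.
  by rewrite !mulmxA -iso mulmxV ?gu.
have := congr1 (fun X => X *m (gQ d (psi x) *m ((dpsi psi i d x)^T *m invmx (g i x)))) E.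
by rewrite -!mulmxA K !mulmx1.
Qed.

Lemma shape_conj : shape_at i' d x = T *m shape_at i d x *m invmx T.
Proof. by have [Tu <-] := shape_transition; rewrite mulmxK. Qed.

Lemma shape_trace : \tr (shape_at i' d x) = \tr (shape_at i d x) /\
  \tr (shape_at i' d x *m shape_at i' d x) = \tr (shape_at i d x *m shape_at i d x).
Proof.
have [Tu _] := shape_transition; rewrite shape_conj.
split; first by rewrite mxtrace_mulC mulmxA mulVmx // mul1mx.
rewrite mxtrace_mulC !mulmxA mxtrace_mulC !mulmxA mulVmx // mul1mx.
by rewrite -!mulmxA (mulmxA (invmx T)) mulVmx // mul1mx.
Qed.

End Transition.

(* Where [theta] is nonzero the second fundamental form is read off [hess_eta], which
   does not involve the chart of the target. *)
Lemma sform_target i d d' (x : M) : cdom i x -> qdom d (psi x) -> qdom d' (psi x) ->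
  H x != 0 -> sform i d x = sform i d' x.
Proof.
move=> ix dx d'x; rewrite (mean_curvature_theta_chart dx) mulf_eq0 negb_or => /andP[_ t0].
apply/matrixP => a b; have := hess_eta ix dx a b.
rewrite (hess_eta ix d'x) (theta_transition dx d'x) => /addIr/addrI/(mulfI t0).
by move=> ->.
Qed.

Lemma mean_curvature_trace i d (x : M) : cdom i x -> qdom d (psi x) -> H x != 0 ->
  \tr (shape_at i d x) = H x.
Proof.
move=> ix dx Hx; rewrite mean_curvature_trace_at.
have [-> _] := shape_trace (chart_atP x) ix dx.
by rewrite /shape_at (sform_target (chart_atP x) dx (target_chart_atP x) Hx).
Qed.

Lemma weingartenE i (x : M) : cdom i x -> weingarten gQ psi N i x = sform i (chart_at (psi x)) x.
Proof. by []. Qed.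

Lemma sqnorm2_trace (G B : 'M[R]_m) : G^T = G -> B^T = B ->
  sqnorm2 G B = \tr (B *m invmx G *m (B *m invmx G)).
Proof.
move=> GT BT; rewrite /sqnorm2.
have qs a b : invmx G a b = invmx G b a by rewrite -{1}GT -trmx_inv mxE.
have Bs a b : B a b = B b a by rewrite -{1}BT mxE.
rewrite /mxtrace; apply: eq_bigr => a _; rewrite mxE.
transitivity (\sum_b' \sum_b \sum_a' (B a b * invmx G b b') * (B b' a' * invmx G a' a)).
  under eq_bigr => b _ do rewrite exchange_big.
  rewrite exchange_big; apply: eq_bigr => b' _; apply: eq_bigr => b _.
  apply: eq_bigr => a' _ /=; rewrite (qs a a') (Bs a' b'); ring.
apply: eq_bigr => b' _; rewrite [(B *m _) a b']mxE [(B *m _) b' a]mxE mulr_suml.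
by apply: eq_bigr => b _; rewrite mulr_sumr.
Qed.

Lemma sform_sym i d (x : M) : cdom i x -> qdom d (psi x) -> (sform i d x)^T = sform i d x.
Proof.
move=> ix dx; rewrite -(ev_kA ix dx) map_trmx; congr (map_mx _ _).
by apply: sr_AT; [exact: k_CC|exact: k_JC].
Qed.

Lemma sqnormA_trace i d (x : M) : cdom i x -> qdom d (psi x) -> H x != 0 ->
  \tr (shape_at i d x *m shape_at i d x) = sqnormA g gQ psi N x.
Proof.
move=> ix dx Hx; have [gT _ _ _] := @sg_riem _ _ s.
rewrite /sqnormA weingartenE; last exact: chart_atP.
rewrite sqnorm2_trace; [|exact/gT/chart_atP|exact/sform_sym/target_chart_atP/chart_atP].
have [_ ->] := shape_trace (chart_atP x) ix dx.
by rewrite /shape_at (sform_target (chart_atP x) dx (target_chart_atP x) Hx).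
Qed.

End ChartIndependence.



(** * The maximum principle for operators with smooth coefficients *)

Section SecondOrderOperator.
Context {R : realType} {n : nat} (U : region R n).
Variables (g a : 'M[sfun U]_n) (b : 'rV[sfun U]_n).

Definition sop (w : sfun U) : sfun U :=
  \sum_i \sum_j a i j * der i (der j w) + \sum_k b 0 k * der k w.

Let fa v : 'M[R]_n := \matrix_(i, j) a i j v.
Let fb v : 'rV[R]_n := \row_k b 0 k v.
Let fg v : 'M[R]_n := \matrix_(i, j) g i j v.

Let sop_lop (w : sfun U) v : rset U v -> sop w v = lop fa fb w v.
Proof.
move=> Uv; rewrite -[LHS]/(ev (Rpoint Uv) _) /sop evD !ev_sum /lop; congr (_ + _).
  by apply: eq_bigr => i _; rewrite ev_sum; apply: eq_bigr => j _; rewrite evM mxE.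
by apply: eq_bigr => i _; rewrite evM mxE.
Qed.

Lemma sopB (f k : sfun U) e (p : rpoint U) :
  ev p (sop (f - sfcst U e * k)) = ev p (sop f) - e * ev p (sop k).
Proof.
by rewrite /ev !(sop_lop _ (rptP p)) (lopB _ _ _ _ _ (rptP p)).
Qed.

Hypotheses (gT : g^T = g) (ag : a *m g = 1%:M).
Hypothesis gpos : forall p : rpoint U, posdef (map_mx (ev p) g).

Let fgE v (Uv : rset U v) : fg v = map_mx (ev (Rpoint Uv)) g.
Proof. by apply/matrixP => i j; rewrite !mxE. Qed.

Let faE v (Uv : rset U v) : fa v = map_mx (ev (Rpoint Uv)) a.
Proof. by apply/matrixP => i j; rewrite !mxE. Qed.

Let fgT v : rset U v -> (fg v)^T = fg v.
Proof. by move=> Uv; rewrite (fgE Uv) map_trmx gT. Qed.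
Let fgp v : rset U v -> posdef (fg v).
Proof. by move=> Uv; rewrite (fgE Uv). Qed.
Let fag v : rset U v -> fa v *m fg v = 1%:M.
Proof. by move=> Uv; rewrite (fgE Uv) (faE Uv) -map_mxM ag map_mx1. Qed.

Lemma sop_local_max (w : sfun U) (p : rpoint U) :
  (\forall x \near rpt p, w x <= w (rpt p)) -> ev p (sop w) <= 0.
Proof.
move=> wmax; have Uv := rptP p.
have [w1 w2] := elliptic_max Uv wmax (fgT Uv) (fgp Uv) (fag Uv).
rewrite /ev (sop_lop _ Uv) /lop [X in _ + X]big1 ?addr0 // => k _.
by rewrite w1 mulr0.
Qed.

Variables (w C : sfun U) (p : rpoint U).
Hypothesis w0 : forall q : rpoint U, 0 <= ev q w.
Hypothesis wsup : forall q : rpoint U, 0 < ev q w -> ev q (sop w) <= ev q C * ev q w.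

(** Hopf's principle wants uniform bounds for the traces of [g] and [a], the drift and the
    zero-order coefficient; by continuity they hold on a smaller neighbourhood of the point. *)
Lemma strong_min : ev p w = 0 -> \forall x \near rpt p, w x = 0.
Proof.
move=> wp; pose v := rpt p; have Uv : rset U v := rptP p.
pose F : sfun U := \tr g; pose A : sfun U := \tr a.
have near1 (f : sfun U) : \forall x \near v, `|f x| <= `|f v| + 1.
  have fc : {for v, continuous f} by exact: sf_continuous.
  have /cvgrPdist_le/(_ 1 ltr01) := fc.
  apply: filterS => x; rewrite distrC => fx.
  by rewrite -[f x](subrK (f v)) addrC (le_trans (ler_normD _ _)) // lerD2l.
pose Lam := `|F v| + 1 + (`|A v| + 1) + \sum_k (`|b 0 k v| + 1).
pose S := [set x | rset U x /\ [/\ `|F x| <= `|F v| + 1, `|A x| <= `|A v| + 1,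
  (forall k, `|b 0 k x| <= `|b 0 k v| + 1) & `|C x| <= `|C v| + 1]].
have nS : nbhs v S.
  apply: filterI; first exact: open_nbhs_nbhs (conj (rset_open U) Uv).
  near=> x; split; [by near: x; exact: near1|by near: x; exact: near1| |by near: x; exact: near1].
  by near: x; apply: filter_forall => k; exact: near1.
pose U' := @Region R n (interior S) (@open_interior _ S) (ex_intro _ v nS).
have U'S x : rset U' x -> S x by exact: interior_subset.
have U'U x : rset U' x -> rset U x by move=> /U'S[].
have ws : smooth_on U' w by move=> l x /U'U; exact: sfunS.
pose w' : sfun U' := mks ws.
have w'E x : rset U' x -> w' x = w x by exact: mksE.
have d1 k x : rset U' x -> der k w' x = der k w x.
  move=> Ux; rewrite (derE k w' Ux) (derE k w (U'U _ Ux)).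
  exact: (partial_eq _ (rset_open U') Ux).
have d2 j k x : rset U' x -> der j (der k w') x = der j (der k w) x.
  move=> Ux; rewrite (derE j _ Ux) (derE j _ (U'U _ Ux)).
  by apply: (partial_eq _ (rset_open U') Ux) => z; exact: d1.
have pos1 (t : R) : 0 <= `|t| + 1 by rewrite addr_ge0.
have sum0 : 0 <= \sum_k (`|b 0 k v| + 1) by apply: sumr_ge0.
have L1 : `|F v| + 1 <= Lam by rewrite /Lam -addrA lerDl addr_ge0.
have L2 : `|A v| + 1 <= Lam by rewrite /Lam addrAC lerDr addr_ge0.
have L3 k : `|b 0 k v| + 1 <= Lam.
  rewrite /Lam (bigD1 k) //= addrCA lerDl !addr_ge0 //.
  by apply: sumr_ge0.
have trE (X : 'M[sfun U]_n) x : rset U x -> \tr (\matrix_(i, j) X i j x) = (\tr X : sfun U) x.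
  move=> Ux; rewrite -[RHS]/(ev (Rpoint Ux) _) /mxtrace ev_sum.
  by apply: eq_bigr => k _; rewrite mxE.
have H1 x : rset U' x -> \tr (fg x) <= Lam.
  move=> Ux; rewrite /fg trE; last exact: U'U.
  by have [_ [H _ _ _]] := U'S _ Ux; apply: le_trans (ler_norm _) (le_trans H L1).
have H2 x : rset U' x -> \tr (fa x) <= Lam.
  move=> Ux; rewrite /fa trE; last exact: U'U.
  by have [_ [_ H _ _]] := U'S _ Ux; apply: le_trans (ler_norm _) (le_trans H L2).
have H3 x : rset U' x -> forall k, `|fb x 0 k| <= Lam.
  move=> Ux k; rewrite mxE.
  by have [_ [_ _ H _]] := U'S _ Ux; apply: le_trans (H k) (L3 k).
have H4 x : rset U' x -> 0 <= w' x.
  by move=> Ux; rewrite w'E //; exact: (w0 (Rpoint (U'U _ Ux))).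
have H5 x : rset U' x -> 0 < w' x -> lop fa fb w' x <= (`|C v| + 1) * w' x.
  move=> Ux; rewrite w'E // => wx.
  have -> : lop fa fb w' x = lop fa fb w x.
    rewrite /lop; apply: (congr2 (fun s t : R => s + t)).
      by apply: eq_bigr => j _; apply: eq_bigr => k _; rewrite (d2 _ _ _ Ux).
    by apply: eq_bigr => k _; rewrite (d1 _ _ Ux).
  rewrite -(sop_lop _ (U'U _ Ux)).
  apply: le_trans (@wsup (Rpoint (U'U _ Ux)) wx) _.
  apply: ler_wpM2r; first exact: ltW.
  by have [_ [_ _ _ H]] := U'S _ Ux; apply: le_trans (ler_norm _) H.
have wv : w' v = 0 by rewrite w'E.
have := @strong_min_local R n U' w' fa fg fb Lam (`|C v| + 1) (pos1 _)
  (fun x Ux => fgT (U'U x Ux)) (fun x Ux => fgp (U'U x Ux)) (fun x Ux => fag (U'U x Ux))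
  H1 H2 H3 H4 H5 v nS wv.
have nU' : nbhs v (rset U') by exact: nbhs_interior.
apply: filterS2 nU' => x Ux w'x; rewrite -w'E //.
Unshelve. all: by end_near.
Qed.

End SecondOrderOperator.



Definition nbhs_region {R : realType} {n : nat} (S : set 'rV[R]_n) v (nS : nbhs v S) :
  region R n := @Region R n (interior S) (@open_interior _ S) (ex_intro _ v nS).

Lemma nbhs_region_sub {R : realType} {n : nat} (S : set 'rV[R]_n) v (nS : nbhs v S) w :
  rset (nbhs_region nS) w -> S w.
Proof. exact: interior_subset. Qed.

(** * The drift Laplacian on the soliton *)

Section RegionFacts.
Context {R : realType} {m : nat} (s : soliton R m).
Local Notation I := (sI s).
Local Notation h := (sh s).
Local Notation M := (sM s).
Local Notation g := (@sg _ _ s).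
Local Notation psi := (@spsi _ _ s).
Local Notation N := (@sN _ _ s).
Local Notation c := (sc s).
Local Notation kappa := (skappa s).
Local Notation Q := (interval_prod I (sP s)).
Local Notation gQ := (warped_metric I h (@sg0 _ _ s)).
Local Notation qdom d := (@cdom R _ Q d).
Local Notation H := (mean_curvature g gQ psi N).
Local Notation A2 := (sqnormA g gQ psi N).
Local Notation eta := (@eta R m s).
Local Notation phi := (@phi R m s).

Lemma near_chart i (x : M) (S : set 'rV[R]_m) : cdom i x -> nbhs (coord i x) S ->
  \forall y \near x, cdom i y /\ S (coord i y).
Proof.
move=> ix nS; have [_ _ _ /(_ i)[Mo _ ic _ _] _] := @sM_manifold _ _ s.
have nc : nbhs x (coord i @^-1` S) := ic x (mem_set ix) _ nS.
by apply: filterS2 (open_nbhs_nbhs (conj Mo ix)) nc.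
Qed.

Lemma near_param i (x : M) (S : set M) : cdom i x -> nbhs x S ->
  \forall v \near coord i x, S (param i v).
Proof.
move=> ix nS; have [_ _ _ /(_ i)[_ _ _ pc Pi] _] := @sM_manifold _ _ s.
have iv : (coord i @` cdom i) (coord i x) by exists x.
by have := pc _ (mem_set iv) S; rewrite Pi //; apply.
Qed.

Definition driftR (i : idx M) (v : 'rV[R]_m) : 'rV[R]_m := \row_k
  (c * (\sum_b partial b (eta \o param i) v * invmx (gram g i v) b k)
   - \sum_a \sum_b invmx (gram g i v) a b * christoffel (gram g i) k a b v).

(** L in coordinates, written without a target chart or a region, so that identities obtained on
    different regions can be compared. *)
Definition Lap (i : idx M) (f : M -> R) (v : 'rV[R]_m) : R :=
  \sum_a \sum_b invmx (gram g i v) a b * partial a (partial b (f \o param i)) v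
  + \sum_k driftR i v 0 k * partial k (f \o param i) v.

Section Region.
Variables (i : idx M) (d : idx Q) (U : region R m).
Hypothesis UW : forall v, rset U v -> hdom i d v.
Local Notation pnt p := (param i (rpt (p : rpoint U))).

Lemma pntP (p : rpoint U) : [/\ cdom i (pnt p), qdom d (psi (pnt p)) &
  coord i (pnt p) = rpt p].
Proof. exact: hdomP (UW (rptP p)). Qed.

Definition kS : 'M[sfun U]_m := kA UW *m kq UW.
Definition kdf : 'cV[sfun U]_m := kJ UW *m kG UW *m (kX UW)^T.
Definition ktheta : sfun U := (kN UW *m kG UW *m (kX UW)^T) 0 0.
Definition kgam : 'I_m -> 'M[sfun U]_m := tgam der (kg UW) (kq UW) (hlf U).
Definition kdrift : 'rV[sfun U]_m := drift (kq UW) kgam (sfcst U c) kdf.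
Definition kH : sfun U := sfcst U c * ktheta.

Lemma ev_kS p : map_mx (ev p) kS = shape_at i d (pnt p).
Proof. by rewrite map_mxM ev_kA_region ev_kq. Qed.

Lemma ev_kH p : ev p kH = H (pnt p).
Proof.
have [_ dx _] := pntP p.
by rewrite evM ev_cst [ev p ktheta]ev_ktheta (mean_curvature_theta_chart dx).
Qed.

Lemma ev_der_keta p b : ev p (der b (keta UW)) = partial b (eta \o param i) (rpt p).
Proof. by apply: ev_der => y; exact: ev_head. Qed.

Lemma ev_kdf p b : ev p (kdf b 0) = partial b (eta \o param i) (rpt p).
Proof. by rewrite /kdf -k_Df ev_der_keta. Qed.

Lemma ev_kgam p a b k : ev p (kgam a b k) = christoffel (gram g i) k a b (rpt p).
Proof. exact: (ev_Cm (g_smooth UW) (g_sym UW) (g_posdef UW)). Qed.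

Lemma ev_kq_entry p a b : ev p (kq UW a b) = invmx (gram g i (rpt p)) a b.
Proof. by have /matrixP/(_ a b) := ev_kq UW p; rewrite mxE. Qed.

Lemma ev_kdrift p k : ev p (kdrift 0 k) = driftR i (rpt p) 0 k.
Proof.
rewrite [RHS]mxE /kdrift [X in ev p X]mxE evB evM ev_cst ev_mulmx; congr (c * _ - _).
  by apply: eq_bigr => b _; rewrite trmxE ev_kdf ev_kq_entry.
rewrite ev_sum; apply: eq_bigr => a _; rewrite ev_sum; apply: eq_bigr => b _.
by rewrite evM ev_kgam ev_kq_entry.
Qed.

Lemma ev_sop_drift (w : sfun U) (f : M -> R) p : (forall q, ev q w = f (pnt q)) ->
  ev p (sop (kq UW) kdrift w) = Lap i f (rpt p).
Proof.
move=> wf.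
have D1 b q : ev q (der b w) = partial b (f \o param i) (rpt q) by exact: ev_der.
rewrite /sop evD !ev_sum; apply: (congr2 (fun s t : R => s + t)).
  apply: eq_bigr => a _; rewrite ev_sum; apply: eq_bigr => b _.
  rewrite evM ev_kq_entry; congr (_ * _).
  by apply: ev_der => q; exact: D1.
by apply: eq_bigr => k _; rewrite evM ev_kdrift D1.
Qed.

Lemma kg_pos p : posdef (map_mx (ev p) (kg UW)).
Proof.
have [ix _ _] := pntP p; rewrite ev_kg; have [_ gp _ _] := @sg_riem _ _ s.
exact: gp.
Qed.

Lemma kg_sym : (kg UW)^T = kg UW.
Proof. by rewrite k_gE !trmx_mul trmxK k_GT mulmxA. Qed.

Hypothesis UH : forall v, rset U v -> H (param i v) != 0.

(** [kH] represents H on every region, but the trace of the shape operator in the chart [d] is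
    identified with H through [sform_target], hence where H is nonzero. *)
Lemma tr_kS : \tr kS = kH.
Proof.
apply: sfun_ev_eq => p; have [ix dx _] := pntP p; rewrite ev_kH.
rewrite -(mean_curvature_trace ix dx (UH (rptP p))) -ev_kS /mxtrace ev_sum.
by apply: eq_bigr => a _; rewrite [RHS]mxE.
Qed.

Lemma ev_trkS2 p : ev p (\tr (kS *m kS)) = A2 (pnt p).
Proof.
have [ix dx _] := pntP p.
rewrite -(sqnormA_trace ix dx (UH (rptP p))) -ev_kS -map_mxM /mxtrace ev_sum.
by apply: eq_bigr => a _; rewrite [RHS]mxE.
Qed.

Lemma ev_kphi p : ev p (kphi UW) = phi (pnt p).
Proof. exact: ev_head. Qed.

Let der_c a : der a (sfcst U c) = 0. Proof. exact: der_cst. Qed.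

Lemma Lap_mean_curvature_region p :
  Lap i H (rpt p) = - (c * phi (pnt p) + A2 (pnt p)) * H (pnt p).
Proof.
rewrite -(ev_sop_drift p ev_kH) -tr_kS.
have := sr_mean (@der_mul _ _ U) (@derC _ _ U) (k_GT UW) (k_CC UW) (k_JC UW) (k_CG UW)
  (k_gE UW) (k_qg UW) (hlf2 U) (k_NN UW) (k_JN UW) (k_conf UW) (k_curvF UW) der_c tr_kS.
rewrite -/kS dlap_drift => /(congr1 (ev p)).
rewrite -/(sop _ _ _) => ->; rewrite evM evN evD evM ev_cst ev_kphi ev_trkS2.
by rewrite tr_kS ev_kH.
Qed.

End Region.

Section Point.
Variables (i : idx M) (d : idx Q) (x : M).
Hypotheses (ix : cdom i x) (dx : qdom d (psi x)).

Let Pi y : cdom i y -> param i (coord i y) = y.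
Proof. by have [_ _ _ /(_ i)[_ _ _ _ E] _] := @sM_manifold _ _ s; exact: E. Qed.

Lemma hdom_nbhs : nbhs (coord i x) (hdom i d).
Proof. exact: open_nbhs_nbhs (conj (@hdom_open R m s i d) (hdom_nonempty ix dx)). Qed.

Local Notation U0 := (chart_region ix dx).
Let UW0 v : rset U0 v -> hdom i d v. Proof. by []. Qed.

Lemma nonzero_nbhs : H x != 0 ->
  nbhs (coord i x) [set v | hdom i d v /\ H (param i v) != 0].
Proof.
move=> Hx; pose p := @Rpoint R m U0 _ (hdom_nonempty ix dx).
have fc : {for coord i x, continuous (kH UW0)} := @sf_continuous R m U0 (kH UW0) _ (rptP p).
have E v (Uv : hdom i d v) : kH UW0 v = H (param i v).
  exact: (ev_kH UW0 (@Rpoint R m U0 v Uv)).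
have Hx0 : kH UW0 (coord i x) != 0 by rewrite E ?Pi //; exact: hdom_nonempty.
have ne : \forall v \near coord i x, kH UW0 v != 0 by exact: (cvgr_neq0 _ fc).
by apply: filterS2 hdom_nbhs ne => v hv; rewrite E.
Qed.

Lemma Lap_mean_curvature : H x != 0 ->
  Lap i H (coord i x) = - (c * phi x + A2 x) * H x.
Proof.
move=> Hx; have nS := nonzero_nbhs Hx.
have UW v : rset (nbhs_region nS) v -> hdom i d v by move=> Uv; have [] := nbhs_region_sub Uv.
have UH v : rset (nbhs_region nS) v -> H (param i v) != 0 by move=> Uv; have [] := nbhs_region_sub Uv.
pose p : rpoint (nbhs_region nS) := @Rpoint R m (nbhs_region nS) (coord i x) nS.
by have := Lap_mean_curvature_region UW UH p; rewrite /= Pi.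
Qed.

Lemma shape_selfadjoint : (shape_at i d x *m g i x)^T = shape_at i d x *m g i x.
Proof.
have [gT gp _ _] := @sg_riem _ _ s.
by rewrite /shape_at mulmxKV ?sform_sym //; apply: posdef_unit; [exact: gT|exact: gp].
Qed.

Lemma trace_sq_ge0 (X : 'M[R]_m) : (X *m g i x)^T = X *m g i x ->
  0 <= \tr (X *m X) /\ (\tr (X *m X) = 0 -> X = 0).
Proof.
have [gT gp _ _] := @sg_riem _ _ s.
have [E Eu EgE] := posdef_factor (gT _ _ ix) (gp _ _ ix).
exact: (selfadjoint_trsq1 (gT _ _ ix) Eu EgE).
Qed.

Lemma sqnormA_ge0 : H x != 0 -> 0 <= A2 x.
Proof.
move=> Hx; rewrite -(sqnormA_trace ix dx Hx).
by have [] := trace_sq_ge0 shape_selfadjoint.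
Qed.

End Point.

(** Where w = sg H is positive, |A|^2 >= 0 gives L w <= - c h' w, and [strong_min] asks for this
    inequality at such points only. *)
Lemma mean_curvature_zero_near (sg : R) (x : M) : sg != 0 -> (forall y, 0 <= sg * H y) ->
  H x = 0 -> \forall y \near x, H y = 0.
Proof.
move=> sg0 Hs Hx; set i := chart_at x; set d : idx Q := chart_at (psi x).
have ix : cdom i x by exact: chart_atP.
have dx : qdom d (psi x) by exact: target_chart_atP.
have [_ _ _ /(_ i)[_ _ _ _ Pi] _] := @sM_manifold _ _ s.
pose U := chart_region ix dx.
have UW v : rset U v -> hdom i d v by [].
(* Written as a difference so that [sopB] applies. *)
pose w : sfun U := 0 - sfcst U (- sg) * kH UW.
have wE q : ev q w = sg * H (param i (rpt q)).
  by rewrite evB ev0 evM ev_cst ev_kH mulNr sub0r opprK.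
pose p : rpoint U := @Rpoint R m U _ (hdom_nonempty ix dx).
have w0 q : 0 <= ev q w by rewrite wE.
have wsup q : 0 < ev q w ->
    ev q (sop (kq UW) (kdrift UW) w) <= ev q (- (sfcst U c * kphi UW)) * ev q w.
  rewrite wE => wq; have [iy dy yE] := pntP UW q; set y := param i (rpt q) in iy dy yE wq *.
  have Hy : H y != 0 by apply: contraTneq wq => ->; rewrite mulr0 ltxx.
  have s0 : ev q (sop (kq UW) (kdrift UW) 0) = 0.
    rewrite /sop evD !ev_sum !big1 ?addr0 // => [k _|a _].
      by rewrite raddf0 mulr0 ev0.
    by rewrite big1 ?ev0 // => b _; rewrite !raddf0 mulr0.
  rewrite sopB s0 (ev_sop_drift UW q (ev_kH UW)) -yE (Lap_mean_curvature iy dy Hy).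
  rewrite evN evM ev_cst ev_kphi -/y.
  have A0 := sqnormA_ge0 iy dy Hy.
  rewrite -subr_ge0; have -> : - (c * phi y) * (sg * H y) -
    (0 - - sg * (- (c * phi y + A2 y) * H y)) = A2 y * (sg * H y) by ring.
  by rewrite mulr_ge0 // ltW.
have wp : ev p w = 0 by rewrite wE /= Pi // Hx mulr0.
have gT := kg_sym UW; have qg := k_qg UW; have gp := kg_pos UW.
have nw := strong_min gT qg gp w0 wsup wp.
have nU : nbhs (coord i x) (hdom i d) := hdom_nbhs ix dx.
have nS : nbhs (coord i x) [set v | hdom i d v /\ w v = 0] by apply: filterS2 nU nw.
apply: filterS (near_chart ix nS) => y [iy [Uy wy]].
have := wE (@Rpoint R m U _ Uy); rewrite /= Pi // /ev /= wy => /esym/eqP.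
by rewrite mulf_eq0 (negbTE sg0) => /eqP.
Qed.

End RegionFacts.



(** * The operator L' where H is nonzero *)

Lemma eder_lower (A : comNzRingType) m (D : 'I_m -> {additive A -> A})
    (gam : 'I_m -> 'M[A]_m) (g S : 'M[A]_m) a :
  (forall a x y, D a (x * y) = D a x * y + x * D a y) -> tcompat D gam g ->
  eder D gam a S *m g =
    map_mx (D a) (S *m g) - gam a *m (S *m g) - (S *m g) *m (gam a)^T.
Proof.
move=> DM gamg; rewrite map_mxM_der // gamg /eder !(mulmxDl, mulmxDr, mulNmx) !mulmxA.
by mxring.
Qed.

Section TwistedFacts.
Context {R : realType} {m : nat} (s : soliton R m).
Local Notation I := (sI s).
Local Notation h := (sh s).
Local Notation M := (sM s).
Local Notation g := (@sg _ _ s).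
Local Notation psi := (@spsi _ _ s).
Local Notation N := (@sN _ _ s).
Local Notation c := (sc s).
Local Notation kappa := (skappa s).
Local Notation Q := (interval_prod I (sP s)).
Local Notation gQ := (warped_metric I h (@sg0 _ _ s)).
Local Notation qdom d := (@cdom R _ Q d).
Local Notation H := (mean_curvature g gQ psi N).
Local Notation A2 := (sqnormA g gQ psi N).
Local Notation eta := (@eta R m s).
Local Notation phi := (@phi R m s).

Definition ratio (x : M) : R := A2 x / H x ^+ 2.

Section Region.
Variables (i : idx M) (d : idx Q) (U : region R m).
Hypothesis UW : forall v, rset U v -> hdom i d v.
Hypothesis UH : forall v, rset U v -> H (param i v) != 0.
Local Notation pnt p := (param i (rpt (p : rpoint U))).
Local Notation kS := (kS UW).
Local Notation kgam := (kgam UW).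
Local Notation kdf := (kdf UW).

Lemma kH_neq0 v : rset U v -> kH UW v != 0.
Proof. by move=> Uv; have := ev_kH UW (Rpoint Uv); rewrite /ev /= => ->; exact: UH. Qed.

Definition kHi : sfun U := mks (@smoothV R m U (rset_open U) _ kH_neq0 (sfunS (kH UW))).

Lemma ev_kHi p : ev p kHi = (H (pnt p))^-1.
Proof. by rewrite -(ev_kH UW p); exact: mksE (rptP p). Qed.

Lemma tr_kS_Hi : \tr kS * kHi = 1.
Proof.
apply: sfun_ev_eq => p; rewrite (tr_kS UW UH) evM ev1 ev_kHi ev_kH divff //.
exact: UH (rptP p).
Qed.

Definition kB : 'M[sfun U]_m := kHi *: kS.
Definition kratio : sfun U := \tr (kB *m kB).
Definition kquot : sfun U := keta UW * kHi.
Definition kdr : 'rV[sfun U]_m := tdrift der (kq UW) kgam (sfcst U c) kdf kS kHi.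
Definition tsop : sfun U -> sfun U := sop (kq UW) kdr.

Lemma ev_kratio p : ev p kratio = ratio (pnt p).
Proof.
rewrite /kratio /kB -scalemxAl -scalemxAr !mxtraceZ !evM ev_kHi (ev_trkS2 UW UH).
by rewrite /ratio expr2 invfM; ring.
Qed.

Lemma ev_kquot p : ev p kquot = eta (pnt p) / H (pnt p).
Proof. by rewrite evM ev_kHi [ev p (keta UW)]ev_head. Qed.

Let der_c a : der a (sfcst U c) = 0. Proof. exact: der_cst. Qed.

Definition gradB p a : 'M[R]_m := map_mx (ev p) (eder der kgam a kB).

Lemma ev_tsop_ratio p : ev p (tsop kratio) =
  (\sum_a \sum_b invmx (g i (pnt p)) a b * \tr (gradB p a *m gradB p b)) *+ 2 +
  kappa * (m%:R * ratio (pnt p) - 1) *+ 2.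
Proof.
have := sr_trsq (@der_mul _ _ U) (@derC _ _ U) (k_GT UW) (k_CC UW) (k_JC UW) (k_CG UW)
  (k_gE UW) (k_qg UW) (hlf2 U) (k_NN UW) (k_JN UW) (k_conf UW) (k_curvF UW) der_c
  (tr_kS UW UH) tr_kS_Hi.
rewrite tlap_drift => /(congr1 (ev p)); rewrite -/(tsop _) => ->.
have evMn (f : sfun U) : ev p (f *+ 2) = ev p f *+ 2 by rewrite !mulr2n evD.
rewrite evD !evMn; congr (_ *+ 2 + _ *+ 2).
  rewrite ev_sum; apply: eq_bigr => a _; rewrite ev_sum; apply: eq_bigr => b _.
  rewrite evM (ev_kq_entry UW); congr (_ * _).
  rewrite /gradB -map_mxM /mxtrace ev_sum; apply: eq_bigr => k _.
  by rewrite [RHS]mxE.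
rewrite evM ev_cst evB ev1 evM -/kratio ev_kratio; congr (_ * (_ * _ - 1)).
have nat1 n : ev p n%:R = n%:R :> R.
  by elim: n => [|n IH]; [rewrite ev0|rewrite !mulrS evD ev1 IH].
exact: nat1.
Qed.

Lemma ev_tsop_quot p : ev p (tsop kquot) =
  (H (pnt p))^-1 * (m%:R * phi (pnt p) + c * h (psi (pnt p)).1 ^+ 2) +
  eta (pnt p) / H (pnt p) * (c * phi (pnt p) + A2 (pnt p)).
Proof.
have fE : keta UW = \tr kS * kquot.
  by rewrite /kquot mulrCA tr_kS_Hi mulr1.
have := sr_quotient (@der_mul _ _ U) (@derC _ _ U) (k_GT UW) (k_CC UW) (k_JC UW) (k_CG UW)
  (k_gE UW) (k_qg UW) (hlf2 U) (k_NN UW) (k_JN UW) (k_conf UW) (k_Df UW) (k_curvF UW) der_c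
  (tr_kS UW UH) (k_XX UW) tr_kS_Hi fE.
rewrite tlap_drift => /(congr1 (ev p)); rewrite -/(tsop _) => ->.
have nat1 n : ev p n%:R = n%:R :> R.
  by elim: n => [|n IH]; [rewrite ev0|rewrite !mulrS evD ev1 IH].
rewrite -[kA UW *m kq UW]/kS evD (evM p kHi) (evM p kquot) ev_kHi ev_kquot.
rewrite (evD p (m%:R * kphi UW)) (evM p m%:R) nat1 (ev_kphi UW) (evM p (sfcst U c)) ev_cst.
rewrite expr2 (evM p (khh UW) (khh UW)) [ev p (khh UW)]ev_head -expr2.
rewrite (evD p (sfcst U c * kphi UW)) (evM p (sfcst U c)) ev_cst (ev_kphi UW).
by rewrite (ev_trkS2 UW UH).
Qed.

Lemma gradB_sym p a : (gradB p a *m g i (pnt p))^T = gradB p a *m g i (pnt p).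
Proof.
rewrite -(ev_kg UW p) /gradB -map_mxM map_trmx; congr (map_mx _ _).
apply: sr_eder_sym; solve [exact: der_mul | exact: k_GT | exact: k_CC | exact: k_JC
  | exact: k_gE | exact: k_qg | exact: hlf2].
Qed.

Lemma grad_term p :
  0 <= \sum_a \sum_b invmx (g i (pnt p)) a b * \tr (gradB p a *m gradB p b) /\
  (\sum_a \sum_b invmx (g i (pnt p)) a b * \tr (gradB p a *m gradB p b) = 0 ->
    forall a, gradB p a = 0).
Proof.
have [iy _ _] := pntP UW p; have [gT gp _ _] := @sg_riem _ _ s.
have gu : g i (pnt p) \in unitmx by apply: posdef_unit; [exact: gT|exact: gp].
have [E Eu EgE] := posdef_factor (gT _ _ iy) (gp _ _ iy).
exact: (selfadjoint_trsq (gT _ _ iy) (mulVmx gu) Eu EgE (gradB_sym p)).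
Qed.

(** With lowered indices the tensor is - H^2 nabla (A / H). *)
Lemma gradH_tensor_region p : (forall a, gradB p a = 0) -> forall u a b,
  gradH_tensor g gQ psi N i (pnt p) u a b = 0.
Proof.
move=> B0 u a b; have [iy dy yE] := pntP UW p.
have Hy := UH (rptP p).
have wE q e f : ev q (kA UW e f) = weingarten gQ psi N i (pnt q) e f.
  have [iq dq _] := pntP UW q.
  rewrite weingartenE // -(sform_target iq dq (target_chart_atP _) (UH (rptP q))).
  by have /matrixP/(_ e f) := ev_kA_region UW q; rewrite mxE.
have SE : kS = kH UW *: kB by rewrite scalerA -(tr_kS UW UH) tr_kS_Hi scale1r.
have ES : eder der kgam u kS = der u (kH UW) *: kB + kH UW *: eder der kgam u kB.
  by rewrite {1}SE ederZ //; exact: der_mul.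
have compat : tcompat der kgam (kg UW).
  exact: (tgam_compat _ (kg_sym UW) (k_qg UW) (hlf2 U)).
have SgE : kS *m kg UW = kA UW by rewrite -[kS]/(kA UW *m kq UW) -mulmxA k_qg mulmx1.
have := eder_lower kS u (@der_mul _ _ U) compat; rewrite SgE ES.
move/(congr1 (fun X : 'M[sfun U]_m => ev p (X a b))).
have dH : ev p (der u (kH UW)) = partial u (H \o param i) (coord i (pnt p)).
  by rewrite yE; apply: ev_der => q; exact: ev_kH.
have -> : ev p (((der u (kH UW) *: kB + kH UW *: eder der kgam u kB) *m kg UW) a b) =
    (map_mx (ev p) (der u (kH UW) *: kB *m kg UW) +
     map_mx (ev p) (kH UW *: (eder der kgam u kB *m kg UW))) a b.
  by rewrite mulmxDl scalemxAl addmxE addmxE evD ![(map_mx _ _) a b]mxE.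
rewrite map_mxZ [map_mx _ (eder _ _ _ _ *m _)]map_mxM -/(gradB p u) B0 mul0mx scaler0 addr0.
have -> : der u (kH UW) *: kB *m kg UW = (der u (kH UW) * kHi) *: kA UW.
  by rewrite /kB scalerA -scalemxAl SgE.
have -> : (map_mx (ev p) ((der u (kH UW) * kHi) *: kA UW)) a b =
    partial u (H \o param i) (coord i (pnt p)) / H (pnt p) * weingarten gQ psi N i (pnt p) a b.
  by rewrite [LHS]mxE scalemxE evM (evM p (der u (kH UW))) dH ev_kHi wE.
rewrite addmxE oppmxE addmxE oppmxE !evB !ev_mulmx.
have -> : ev p ((map_mx (der u) (kA UW)) a b) =
    partial u (fun v => weingarten gQ psi N i (param i v) a b) (coord i (pnt p)).
  by rewrite mxE yE; apply: ev_der => q; exact: wE.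
move=> E; rewrite /gradH_tensor /nabla_weingarten big_split /= opprD addrA.
have -> : \sum_e christoffel (gram g i) e u a (coord i (pnt p)) * weingarten gQ psi N i (pnt p) e b
    = \sum_k ev p (kgam u a k) * ev p (kA UW k b).
  by apply: eq_bigr => e _; rewrite (ev_kgam UW) wE yE.
have -> : \sum_e christoffel (gram g i) e u b (coord i (pnt p)) * weingarten gQ psi N i (pnt p) a e
    = \sum_k ev p (kA UW a k) * ev p ((kgam u)^T k b).
  by apply: eq_bigr => e _; rewrite trmxE (ev_kgam UW) wE yE mulrC.
rewrite -E; field; exact: Hy.
Qed.

Hypothesis m0 : (0 < m)%N.
Hypothesis umbilic : forall v, rset U v -> shape_at i d (param i v) = (H (param i v) / m%:R)%:M.

Definition kE : sfun U := @sfcomp R m U [set: R] expR (sfcst U (c / m%:R) * keta UW)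
  smooth_expR (fun _ _ => Logic.I).

(** For an umbilical shape operator dH = c d theta = - (c H / m) d eta, so exp (c eta / m) is an
    integrating factor. *)
Lemma der_kH_kE a : der a (kH UW * kE) = 0.
Proof.
apply: sfun_ev_eq => p; rewrite ev0 der_mul evD (evM p (der a (kH UW))) (evM p (kH UW)).
have -> : ev p (der a kE) = ev p kE * (c / m%:R * ev p (der a (keta UW))).
  rewrite /ev /kE (der_sfcomp _ _ _ (rptP p)) derive1_expR sfcompE; last exact: rptP.
  congr (_ * _); rewrite der_mul der_cst mul0r add0r sfME; congr (_ * _).
  exact: sfcstE (rptP p).
have -> : ev p (der a (kH UW)) = - (c * (H (pnt p) / m%:R * ev p (der a (keta UW)))).
  rewrite /kH der_mul der_cst mul0r add0r evM ev_cst.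
  have := sr_dtheta (@der_mul _ _ U) (k_GT UW) (k_CG UW) (k_gE UW)
    (k_qg UW) (hlf2 U) (k_NN UW) (k_JN UW) (k_conf UW) a.
  move=> /(congr1 (ev p)) => ->; rewrite evN mulrN; congr (- (_ * _)).
  rewrite k_Df -[RHS](mulrC (ev p _)) mulrC.
  transitivity ((map_mx (ev p) (kS *m kdf)) a 0); first by rewrite [RHS]mxE.
  rewrite map_mxM ev_kS umbilic; last exact: rptP.
  by rewrite mul_scalar_mx scalemxE [(map_mx _ _) a 0]mxE.
rewrite ev_kH; field.
by rewrite pnatr_eq0 -lt0n.
Qed.

End Region.

Section Pinching.
Variables (x : M) (Hx : H x != 0).

(** The operator X = (m / H) S - 1 is self-adjoint with tr(X^2) = m (m u - 1), where u is [ratio];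
    both claims follow from the positivity of this trace form. *)
Lemma pinching : (0 < m)%N -> 1 <= m%:R * ratio x /\
  (m%:R * ratio x = 1 -> forall j e, cdom j x -> qdom e (psi x) ->
    shape_at j e x = (H x / m%:R)%:M).
Proof.
move=> m0.
have mR : (m%:R : R) != 0 by rewrite pnatr_eq0 -lt0n.
have trN (A : 'M[R]_m) : \tr (- A) = - \tr A by exact: raddfN.
have key j e : cdom j x -> qdom e (psi x) -> 1 <= m%:R * ratio x /\
    (m%:R * ratio x = 1 -> shape_at j e x = (H x / m%:R)%:M).
  move=> jx ex; pose S := shape_at j e x.
  pose X : 'M[R]_m := (m%:R / H x) *: S - 1%:M.
  have Xs : (X *m g j x)^T = X *m g j x.
    have [gT _ _ _] := @sg_riem _ _ s.
    rewrite /X mulmxBl -scalemxAl mul1mx linearB linearZ /= (shape_selfadjoint jx ex).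
    by rewrite gT.
  have trX : \tr (X *m X) = m%:R * (m%:R * ratio x - 1).
    rewrite /X mulmxBl mulmxBr mulmx1 mul1mx -scalemxAl -scalemxAr.
    rewrite !(mxtraceD, mxtraceZ, trN) (mean_curvature_trace jx ex Hx) (sqnormA_trace jx ex Hx).
    by rewrite mxtrace1 /ratio; field.
  have [X0 XE] := trace_sq_ge0 jx Xs.
  split.
    by move: X0; rewrite trX pmulr_rge0 ?ltr0n // subr_ge0.
  move=> u1; have /XE/eqP : \tr (X *m X) = 0 by rewrite trX u1 subrr mulr0.
  rewrite subr_eq0 => /eqP E.
  have -> : shape_at j e x = (H x / m%:R) *: ((m%:R / H x) *: S).
    by rewrite scalerA mulrA divfK // divff // scale1r.
  by rewrite E scalemx1.
split; first by have [] := key _ _ (chart_atP x) (target_chart_atP x).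
by move=> u1 j e jx ex; have [_] := key j e jx ex; exact.
Qed.

End Pinching.

Section Point.
Variables (x : M).
Hypotheses (Hx : H x != 0).
Let i := chart_at x.
Let d : idx Q := chart_at (psi x).
Let ix : cdom i x. Proof. exact: chart_atP. Qed.
Let dx : qdom d (psi x). Proof. exact: target_chart_atP. Qed.
Let Pi y : cdom i y -> param i (coord i y) = y.
Proof. by have [_ _ _ /(_ i)[_ _ _ _ E] _] := @sM_manifold _ _ s; exact: E. Qed.
Let v := coord i x.

Section Near.
Variable S : set M.
Hypothesis nS : nbhs x S.

Lemma good_nbhs : nbhs v [set w | [/\ hdom i d w, H (param i w) != 0 & S (param i w)]].
Proof.
have n1 := nonzero_nbhs ix dx Hx; have n2 := near_param ix nS.
by apply: filterS2 n1 n2 => w [].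
Qed.

Definition good_region : region R m := nbhs_region good_nbhs.

Lemma good_hdom w : rset good_region w -> hdom i d w.
Proof. by move=> Uw; have [] := nbhs_region_sub Uw. Qed.

Lemma good_neq0 w : rset good_region w -> H (param i w) != 0.
Proof. by move=> Uw; have [] := nbhs_region_sub Uw. Qed.

Lemma good_sub w : rset good_region w -> S (param i w).
Proof. by move=> Uw; have [] := nbhs_region_sub Uw. Qed.

Definition good_point : rpoint good_region := @Rpoint R m good_region v good_nbhs.

Lemma good_pointE : param i (rpt good_point) = x. Proof. exact: Pi. Qed.

(** [strong_min] with zero-order coefficient 0, carried over from coordinates to a neighbourhood in
    M. *)
Lemma strong_min_good (w : sfun good_region) (b : 'rV[sfun good_region]_m) :
  (forall q, 0 <= ev q w) -> (forall q, ev q (sop (kq good_hdom) b w) <= 0) ->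
  ev good_point w = 0 -> \forall y \near x, exists2 q, param i (rpt q) = y & ev q w = 0.
Proof.
move=> w0 wsup wx.
have ws q : 0 < ev q w -> ev q (sop (kq good_hdom) b w) <= ev q 0 * ev q w.
  by rewrite ev0 mul0r => _; exact: wsup.
have nw := strong_min (kg_sym good_hdom) (k_qg good_hdom) (kg_pos good_hdom) w0 ws wx.
have nU : nbhs v (rset good_region) by apply: nbhs_interior; exact: good_nbhs.
have nb : nbhs v [set z | rset good_region z /\ w z = 0] by apply: filterS2 nU nw.
apply: filterS (near_chart ix nb) => y [iy [Uy wy]].
by exists (@Rpoint R m good_region _ Uy) => //; exact: Pi.
Qed.

End Near.

(** At a maximum of u - t eta / H the operator L' takes a value <= 0 on this function, while L' u >=
    0; the claim is t L' (eta / H) >= 0. *)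
Lemma quotient_max (t : R) : (0 < m)%N -> 0 <= kappa ->
  (\forall y \near x, ratio y - t * (eta y / H y) <= ratio x - t * (eta x / H x)) ->
  0 <= t * ((H x)^-1 * (m%:R * phi x + c * h (psi x).1 ^+ 2) +
            eta x / H x * (c * phi x + A2 x)).
Proof.
move=> m0 k0 xmax; pose U := good_region xmax; pose UW := @good_hdom _ xmax.
pose UH := @good_neq0 _ xmax; pose p := good_point xmax; have pE := good_pointE xmax.
pose w := kratio UW UH - sfcst U t * kquot UW UH.
have wE q : ev q w = ratio (param i (rpt q)) - t * (eta (param i (rpt q)) / H (param i (rpt q))).
  by rewrite evB evM ev_cst ev_kratio ev_kquot.
have wmax : \forall z \near rpt p, w z <= w (rpt p).
  have nU : nbhs v (rset U) := nbhs_interior (good_nbhs xmax).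
  apply: filterS nU => z Uz.
  rewrite -[w z]/(ev (Rpoint Uz) w) -[w (rpt p)]/(ev p w) !wE pE /=.
  exact: (good_sub (nS := xmax) Uz).
have := @sop_local_max R m U (kg UW) (kq UW) (kdr UW UH) (kg_sym UW) (k_qg UW) (kg_pos UW) w p wmax.
rewrite /w sopB -/(tsop UW UH) -/(tsop UW UH) ev_tsop_ratio ev_tsop_quot pE subr_le0.
apply: le_trans; have [g0 _] := grad_term UW UH p; rewrite pE in g0.
rewrite addr_ge0 // mulrn_wge0 // mulr_ge0 // subr_ge0.
by have [] := pinching Hx m0.
Qed.

(** The function u(x) - u is nonnegative near [x], vanishes at [x] and is a supersolution of L', so
    the strong minimum principle applies. *)
Lemma ratio_max : (0 < m)%N -> 0 <= kappa -> (\forall y \near x, ratio y <= ratio x) ->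
  \forall y \near x, ratio y = ratio x.
Proof.
move=> m0 k0 xmax; pose U := good_region xmax; pose UW := @good_hdom _ xmax.
pose UH := @good_neq0 _ xmax; pose p := good_point xmax; have pE := good_pointE xmax.
pose w := sfcst U (ratio x) - sfcst U 1 * kratio UW UH.
have wE q : ev q w = ratio x - ratio (param i (rpt q)).
  by rewrite evB evM !ev_cst mul1r ev_kratio.
have w0 q : 0 <= ev q w by rewrite wE subr_ge0; exact: (good_sub (nS := xmax) (rptP q)).
have wsup q : ev q (sop (kq UW) (kdr UW UH) w) <= 0.
  rewrite sopB mul1r.
  have -> : ev q (sop (kq UW) (kdr UW UH) (sfcst U (ratio x))) = 0.
    rewrite /sop evD !ev_sum !big1 ?addr0 // => [k _|a _].
      by rewrite der_cst mulr0 ev0.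
    by rewrite big1 ?ev0 // => b _; rewrite der_cst raddf0 mulr0.
  rewrite sub0r oppr_le0 -/(tsop UW UH) ev_tsop_ratio.
  have [iq dq _] := pntP UW q; have [g0 _] := grad_term UW UH q.
  rewrite addr_ge0 // mulrn_wge0 // mulr_ge0 // subr_ge0.
  by have [] := pinching (UH _ (rptP q)) m0.
have := strong_min_good w0 wsup; rewrite wE pE subrr => /(_ erefl).
apply: filterS => y [q <-] /eqP; rewrite wE subr_eq0 => /eqP.
by [].
Qed.

(** Now L' u = 0 is a sum of two nonnegative terms, and both vanish. *)
Lemma ratio_const : (0 < m)%N -> 0 <= kappa -> (\forall y \near x, ratio y = ratio x) ->
  kappa * (m%:R * ratio x - 1) = 0 /\
  forall u a b, gradH_tensor g gQ psi N (chart_at x) x u a b = 0.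
Proof.
move=> m0 k0 xc; pose U := good_region xc; pose UW := @good_hdom _ xc.
pose UH := @good_neq0 _ xc; pose p := good_point xc; have pE := good_pointE xc.
have kE : kratio UW UH = sfcst U (ratio x).
  apply: sfun_ev_eq => q; rewrite ev_kratio ev_cst.
  exact: (good_sub (nS := xc) (rptP q)).
have := ev_tsop_ratio UW UH p; rewrite pE.
have -> : ev p (tsop UW UH (kratio UW UH)) = 0.
  rewrite kE /tsop /sop evD !ev_sum !big1 ?addr0 // => [k _|a _].
    by rewrite der_cst mulr0 ev0.
  by rewrite big1 ?ev0 // => b _; rewrite der_cst raddf0 mulr0.
have [g0 gE] := grad_term UW UH p; rewrite pE in g0 gE.
have u0 : 0 <= kappa * (m%:R * ratio x - 1).
  by rewrite mulr_ge0 // subr_ge0; have [] := pinching Hx m0.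
move/esym/eqP; rewrite paddr_eq0 ?mulrn_wge0 // !mulrn_eq0 /= => /andP[/eqP G0 /eqP K0].
split=> // u a b; have := @gradH_tensor_region i d U UW UH p (gE G0) u a b.
by rewrite pE.
Qed.

(** The difference [f] has zero derivative. That it vanishes near [x] comes from the strong minimum
    principle for f^2, with zero drift. *)
Lemma exp_const : (0 < m)%N -> (forall y, H y != 0 -> m%:R * ratio y = 1) ->
  \forall y \near x, H y * expR (c / m%:R * eta y) = H x * expR (c / m%:R * eta x).
Proof.
move=> m0 u1; have nT : nbhs x [set: M] by exact: filterT.
pose U := good_region nT; pose UW := @good_hdom _ nT.
pose UH := @good_neq0 _ nT; pose p := good_point nT; have pE := good_pointE nT.
have umb z : rset U z -> shape_at i d (param i z) = (H (param i z) / m%:R)%:M.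
  move=> Uz; have [iq dq _] := pntP UW (Rpoint Uz).
  have [_ E] := pinching (UH _ Uz) m0.
  exact: (E (u1 _ (UH _ Uz)) _ _ iq dq).
pose W0 := H x * expR (c / m%:R * eta x).
pose f := kH UW * kE UW - sfcst U W0.
have fE q : ev q f = H (param i (rpt q)) * expR (c / m%:R * eta (param i (rpt q))) - W0.
  rewrite evB (evM q (kH UW)) ev_cst ev_kH; congr (_ * _ - _).
  rewrite /ev /kE sfcompE; last exact: rptP.
  rewrite sfME sfcstE; last exact: rptP.
  by congr (expR (_ * _)); exact: ev_head.
have df a : der a f = 0 by rewrite derB (der_kH_kE UW m0 umb) der_cst subr0.
have dw a : der a (f * f) = 0 by rewrite der_mul df mul0r mulr0 addr0.
have w0 q : 0 <= ev q (f * f) by rewrite evM -expr2 sqr_ge0.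
have wsup q : ev q (sop (kq UW) 0 (f * f)) <= 0.
  rewrite /sop evD !ev_sum !big1 ?addr0 // => [k _|a _].
    by rewrite dw mulr0 ev0.
  by rewrite big1 ?ev0 // => b _; rewrite dw raddf0 mulr0.
have wp : ev p (f * f) = 0 by rewrite evM fE pE subrr mul0r.
apply: filterS (strong_min_good w0 wsup wp) => y [q <-] /eqP.
by rewrite evM mulf_eq0 orbb fE subr_eq0 => /eqP.
Qed.

End Point.

End TwistedFacts.



(** * The global argument *)

Lemma connected_forall (T : topologicalType) (S : T -> Prop) x0 : connected [set: T] ->
  S x0 -> (forall x, S x -> \forall y \near x, S y) ->
  (forall x, ~ S x -> \forall y \near x, ~ S y) -> forall x, S x.
Proof.
move=> Tc S0 So Sc.
suff E : [set x | S x] = [set: T] by move=> x; rewrite -[S x]/([set x | S x] x) E.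
apply: Tc; first by exists x0.
  exists [set x | S x]; last by rewrite setTI.
  by rewrite openE => x Sx; exact: So.
exists [set x | S x]; last by rewrite setTI.
rewrite -[X in closed X]setCK; apply: open_closedC.
by rewrite openE => x nSx; exact: Sc.
Qed.

Lemma interval_constant {R : realType} (I : set R) (f : R -> R) : is_interval I ->
  (forall t, I t -> is_derive t 1 f 0) -> forall a b, I a -> I b -> f a = f b.
Proof.
move=> I_itv df.
have key a b : a < b -> I a -> I b -> f a = f b.
  move=> ab Ia Ib; have sub x : a <= x <= b -> I x by exact: (I_itv _ _ Ia Ib).
  have dfx x : x \in `]a, b[%R -> is_derive x 1 f ((fun=> 0) x).
    by rewrite in_itv /= => /andP[ax xb]; apply: df; apply: sub; rewrite !ltW.
  have fc : {within `[a, b], continuous f}.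
    apply: continuous_in_subspaceT => x; rewrite inE /= in_itv /= => /sub/df[dx _].
    by have /derivable1_diffP := dx; exact: differentiable_continuous.
  have [e _] := MVT ab dfx fc.
  by rewrite mul0r => /eqP; rewrite subr_eq0 => /eqP ->.
move=> a b Ia Ib; case: (ltgtP a b) => [ab|ba|->//]; first exact: key.
by apply: esym; exact: key.
Qed.

Lemma is_derive_change {R : realType} (f k : R -> R) (t a b : R) :
  is_derive t 1 f a -> (forall u, f u = k u) -> a = b -> is_derive t 1 k b.
Proof. by move=> D /funext <- <-. Qed.

Lemma limf_esup_bound {R : realType} (T : topologicalType) (F : set_system T) (f : T -> R)
    (l : \bar R) : (limf_esup (fun x => (f x)%:E) F < l)%E ->
  exists2 V, F V & (ereal_sup [set (f x)%:E | x in V] < l)%E.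
Proof. by move=> /ereal_inf_lt[_ [V FV <-] Vl]; exists V. Qed.

Lemma ereal_sup_finite_bound {R : realType} (T : Type) (V : set T) (f : T -> R) :
  (ereal_sup [set (f x)%:E | x in V] < +oo)%E -> exists C, forall x, V x -> f x <= C.
Proof.
move=> Vl; have ub x : V x -> ((f x)%:E <= ereal_sup [set (f x)%:E | x in V])%E.
  by move=> Vx; apply: ereal_sup_ubound; exists x.
case E : (ereal_sup _) Vl ub => [r| |] // _ ub.
  by exists r => x Vx; have := ub x Vx; rewrite lee_fin.
by exists 0 => x Vx; have := ub x Vx.
Qed.

Lemma ereal_sup_negative_bound {R : realType} (T : Type) (V : set T) (f : T -> R) :
  (ereal_sup [set (f x)%:E | x in V] < 0)%E ->
  exists2 e, 0 < e & forall x, V x -> f x <= - e.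
Proof.
move=> Vl; have ub x : V x -> ((f x)%:E <= ereal_sup [set (f x)%:E | x in V])%E.
  by move=> Vx; apply: ereal_sup_ubound; exists x.
case E : (ereal_sup _) Vl ub => [r| |] // rl ub.
  exists (- r); first by rewrite oppr_gt0 -lte_fin.
  by move=> x Vx; have := ub x Vx; rewrite opprK lee_fin.
by exists 1 => // x Vx; have := ub x Vx.
Qed.

Section Global.
Context {R : realType} {m : nat} (s : soliton R m).
Local Notation I := (sI s).
Local Notation h := (sh s).
Local Notation M := (sM s).
Local Notation g := (@sg _ _ s).
Local Notation psi := (@spsi _ _ s).
Local Notation N := (@sN _ _ s).
Local Notation c := (sc s).
Local Notation kappa := (skappa s).
Local Notation Q := (interval_prod I (sP s)).
Local Notation gQ := (warped_metric I h (@sg0 _ _ s)).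
Local Notation qdom d := (@cdom R _ Q d).
Local Notation H := (mean_curvature g gQ psi N).
Local Notation A2 := (sqnormA g gQ psi N).
Local Notation eta := (@eta R m s).
Local Notation phi := (@phi R m s).
Local Notation ratio := (@ratio R m s).

Lemma continuous_of_sfun (x : M) (f : M -> R) (nS : nbhs x [set: M]) (Hx : H x != 0)
    (w : sfun (good_region Hx nS)) :
  (forall q, ev q w = f (param (chart_at x) (rpt q))) -> {for x, continuous f}.
Proof.
move=> wf; set i := chart_at x; have ix : cdom i x by exact: chart_atP.
have [_ _ _ /(_ i)[_ _ _ _ Pi] _] := @sM_manifold _ _ s.
apply/cvgrPdist_lt => e e0.
have wc : {for coord i x, continuous w}.
  exact: (@sf_continuous R m _ w _ (rptP (good_point Hx nS))).
have nw : \forall v \near coord i x, `|w (coord i x) - w v| < e.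
  by have /cvgrPdist_lt := wc; exact.
have nU : nbhs (coord i x) (rset (good_region Hx nS)) := nbhs_interior (good_nbhs Hx nS).
have nb : nbhs (coord i x) [set v | rset (good_region Hx nS) v /\
    `|w (coord i x) - w v| < e] by apply: filterS2 nU nw.
have wx : w (coord i x) = f x.
  by have := wf (good_point Hx nS); rewrite good_pointE.
apply: filterS (near_chart ix nb) => y [iy [Uy]].
by have := wf (@Rpoint R m (good_region Hx nS) _ Uy); rewrite /ev /= Pi // wx => ->.
Qed.

Lemma ratio_continuous x : H x != 0 -> {for x, continuous ratio}.
Proof.
move=> Hx; have nT : nbhs x [set: M] by exact: filterT.
apply: (@continuous_of_sfun x ratio nT Hx (kratio (@good_hdom _ _ _ _ Hx _ nT) (@good_neq0 _ _ _ _ Hx _ nT))).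
by move=> q; exact: ev_kratio.
Qed.

Lemma quotient_continuous x : H x != 0 -> {for x, continuous (fun y => eta y / H y)}.
Proof.
move=> Hx; have nT : nbhs x [set: M] by exact: filterT.
apply: (@continuous_of_sfun x _ nT Hx (kquot (@good_hdom _ _ _ _ Hx _ nT) (@good_neq0 _ _ _ _ Hx _ nT))).
by move=> q; exact: ev_kquot.
Qed.

Hypotheses (M_conn : connected [set: M]) (m0 : (0 < m)%N) (k0 : 0 <= kappa).

(** The zero set of H is open by [mean_curvature_zero_near] and closed by continuity. *)
Lemma mean_curvature_dichotomy (sg : R) : sg != 0 -> (forall y, 0 <= sg * H y) ->
  (forall x, H x = 0) \/ (forall x, H x != 0).
Proof.
move=> sg0 Hs; have [[x0 Hx0]|nz] := pselect (exists x, H x = 0); last first.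
  by right=> x; apply/eqP => Hx; apply: nz; exists x.
left; apply: (connected_forall M_conn Hx0) => x Hx.
  exact: mean_curvature_zero_near sg0 Hs Hx.
have ix : cdom (chart_at x) x by exact: chart_atP.
have Hx' : H x != 0 by apply/eqP.
have nb := nonzero_nbhs ix (target_chart_atP x) Hx'.
have [_ _ _ /(_ (chart_at x))[_ _ _ _ Pi] _] := @sM_manifold _ _ s.
apply: filterS (near_chart ix nb) => y [iy [_]].
by rewrite Pi // => /eqP.
Qed.

Section Nonzero.
Variable sg : R.
Hypotheses (sgH : forall x, `|H x| = sg * H x) (sg2 : sg * sg = 1).
Hypothesis Hn : forall x, H x != 0.
Variables (B C e : R) (K1 : set M).
Hypotheses (uB : forall x, ratio x <= B) (K1c : compact K1) (e0 : 0 < e).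
Hypothesis limC : forall x, ~ K1 x -> (m%:R * phi x + c * h (psi x).1 ^+ 2) / `|H x| <= C.
Hypothesis lime : forall x, ~ K1 x -> c * phi x + A2 x <= - e.
Hypothesis limq : forall D, exists2 K, compact K & forall x, ~ K x -> D < eta x / `|H x|.

Let gamma x := eta x / `|H x|.

(** As [sg] is the sign of H, dividing by |H| is dividing by the smooth function H up to this
    constant. *)
Let absV x : `|H x|^-1 = sg / H x.
Proof.
have s0 : sg != 0 by apply: contra_eq_neq sg2 => ->; rewrite mul0r eq_sym oner_eq0.
have sV : sg^-1 = sg by apply: (mulfI s0); rewrite divff.
by rewrite sgH invfM sV.
Qed.

Let gammaE x : gamma x = sg * (eta x / H x).
Proof. by rewrite /gamma absV mulrCA. Qed.

Let f (t : R) x := ratio x - t * gamma x.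

Let fc t (x : M) : {for x, continuous (f t)}.
Proof.
have -> : f t = fun x => ratio x - (t * sg) * (eta x / H x).
  by apply/funext => y; rewrite /f gammaE mulrA.
apply: cvgB; first exact: ratio_continuous.
by apply: cvgMr; exact: quotient_continuous.
Qed.

(** Outside a compact set t gamma outweighs the upper bound [B] of the ratio. *)
Let attains t (x0 : M) : 0 < t -> exists x, forall y, f t y <= f t x.
Proof.
move=> t0; have [K Kc Kq] := limq ((B - f t x0) / t).
have out y : ~ K y -> f t y < f t x0.
  move=> /Kq; rewrite ltr_pdivrMr // -/(gamma y) mulrC => H1; rewrite /f.
  by have := uB y; move: H1; rewrite {1}/f; lra.
have Kx0 : K x0 by apply: contrapT => /out; rewrite ltxx.
have [||x Kx xm] := @compact_min R M K (fun y => - f t y) _ Kc.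
- by exists x0.
- by move=> y _; apply: cvgN; exact: fc.
exists x => y; have [Ky|/out yK] := pselect (K y).
  by have := xm y Ky; rewrite lerN2.
by apply: ltW; apply: lt_le_trans yK _; have := xm x0 Kx0; rewrite lerN2.
Qed.

Lemma ratio_attains (x0 : M) : exists x, forall y, ratio y <= ratio x.
Proof.
(* Off [K1] and [K2] one has gamma > 0 and C < e gamma, hence L' gamma <= C - e gamma < 0, which
   [quotient_max] forbids at a maximum. *)
have [K2 K2c K2q] := limq (Num.max 0 (C / e)).
pose K := K1 `|` K2; have Kc : compact K by exact: compactU.
have max_in t x : 0 < t -> (forall y, f t y <= f t x) -> K x.
  move=> t0 xm; apply: contrapT => /not_orP[nK1 nK2].
  have near_max : \forall y \near x, ratio y - (t * sg) * (eta y / H y) <=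
      ratio x - (t * sg) * (eta x / H x).
    by apply: nearW => y; rewrite -!mulrA -!gammaE; exact: xm.
  have := quotient_max (Hn x) m0 k0 near_max.
  have -> : t * sg * ((H x)^-1 * (m%:R * phi x + c * h (psi x).1 ^+ 2) +
      eta x / H x * (c * phi x + A2 x)) =
    t * ((m%:R * phi x + c * h (psi x).1 ^+ 2) / `|H x| + gamma x * (c * phi x + A2 x)).
    by rewrite gammaE absV; ring.
  rewrite pmulr_rge0 // => ge0.
  have := K2q x nK2; rewrite -/(gamma x) gt_max => /andP[g0]; rewrite ltr_pdivrMr // => gC.
  have H1 := limC nK1; have H2 := lime nK1.
  have H3 : gamma x * (c * phi x + A2 x) <= gamma x * - e by rewrite ler_pM2l.
  by move: ge0 H1 H3 gC; lra.
have [x1 x1m] := attains x0 ltr01.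
have K0 : K !=set0 by exists x1; exact: max_in ltr01 x1m.
have [|x Kx xm] := @compact_min R M K (fun y => - ratio y) K0 Kc.
  by move=> y _; apply: cvgN; exact: ratio_continuous.
(* The minimum of gamma over [K] bounds the perturbation at the maximum points of all the functions
   [f t] at once. *)
have [|z Kz zm] := @compact_min R M K gamma K0 Kc.
  move=> y _; have -> : gamma = fun x => sg * (eta x / H x) by apply/funext => w; exact: gammaE.
  by apply: cvgMr; exact: quotient_continuous.
exists x => y; apply/ler_addgt0Pr => d d0.
(* With this [t] the values of gamma at [y] and [z] alter the comparison by at most [d]. *)
pose t := d / (`|gamma y| + `|gamma z| + 1).
have q0 : 0 < `|gamma y| + `|gamma z| + 1 by rewrite ltr_wpDl // addr_ge0.
have t0 : 0 < t by rewrite divr_gt0.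
have [w wm] := attains x0 t0; have Kw := max_in _ _ t0 wm.
have H1 := wm y; have H2 := zm w Kw; have H3 : ratio w <= ratio x.
  by have := xm w Kw; rewrite lerN2.
have H4 : t * gamma y <= t * `|gamma y| by rewrite ler_pM2l // ler_norm.
have H5 : - (t * `|gamma z|) <= t * gamma z.
  by rewrite -mulrN ler_pM2l // lerNl -normrN ler_norm.
have H6 : t * gamma z <= t * gamma w by rewrite ler_pM2l.
have H7 : t * (`|gamma y| + `|gamma z| + 1) = d by rewrite divfK // gt_eqF.
by move: H1; rewrite /f; move: H3 H4 H5 H6 H7 t0; rewrite !mulrDr mulr1; lra.
Qed.

(** The set where the maximum is attained is open by [ratio_max] and closed by continuity. *)
Lemma ratio_constant x y : ratio x = ratio y.
Proof.
have [z zm] := ratio_attains x.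
suff E w : ratio w = ratio z by rewrite !E.
apply: (connected_forall M_conn (S := fun w => ratio w = ratio z) erefl) => {}w wz.
  have := @ratio_max R m s w (Hn w) m0 k0; rewrite wz; apply.
  by apply: nearW => v; exact: zm.
have rc := ratio_continuous (Hn w).
have wlt : ratio w < ratio z by rewrite lt_neqAle zm andbT; apply/eqP.
have : \forall v \near w, ratio v < ratio z by exact: (cvgr_lt _ rc).
by apply: filterS => v vz E; move: vz; rewrite E ltxx.
Qed.

Lemma gradH_tensor_zero x u a b :
  gradH_tensor g gQ psi N (chart_at x) x u a b = 0.
Proof.
have [|_ E] := @ratio_const R m s x (Hn x) m0 k0; last exact: E.
by apply: nearW => y; exact: ratio_constant.
Qed.

Lemma kappa_zero : ~ compact [set: M] -> kappa = 0.
Proof.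
move=> Mnc; apply: contrapT => /eqP kn; have kp : 0 < kappa by rewrite lt_neqAle eq_sym kn.
have u1 y : H y != 0 -> m%:R * ratio y = 1.
  move=> Hy; have [|E _] := @ratio_const R m s y Hy m0 k0.
    by apply: nearW => z; exact: ratio_constant.
  by move/eqP: E; rewrite mulf_eq0 (negbTE kn) subr_eq0 => /eqP.
have [x0|M0] := pselect (exists x : M, True); last first.
  apply: Mnc; have -> : [set: M] = set0; last exact: compact0.
  by apply/seteqP; split=> // x _; apply: M0; exists x.
have {x0} [x0 _] := x0.
pose W y := H y * expR (c / m%:R * eta y).
have Wc y : W y = W x0.
  apply: (connected_forall M_conn (S := fun y => W y = W x0) erefl) => {}y Wy.
    by apply: filterS (exp_const (Hn y) m0 u1) => z; rewrite -Wy.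
  apply: filterS (exp_const (Hn y) m0 u1) => z Wz E; apply: Wy; rewrite -E.
  exact: (esym Wz).
have V0 : exists v, (@coord R _ Q (chart_at (psi x0)) @` qdom (chart_at (psi x0))) v.
  by exists (@coord R _ Q (chart_at (psi x0)) (psi x0)); exists (psi x0) => //;
    exact: target_chart_atP.
have h2 := amb_h2 (@sI_open _ _ s) (@sh_smooth _ _ s) (@sh_pos _ _ s) (@sP_manifold _ _ s)
  (@sg0_riem _ _ s) V0 (@scurv _ _ s) m0.
have Ih y : I (psi y).1 by have [/(_ y)[d []]] := @spsi_isom _ _ s.
have dh t : I t -> is_derive t 1 h (derive1 h t).
  by move=> It; apply: DeriveDef; [exact: (@sh_smooth _ _ s 0%N)|rewrite derive1E].
have dh' t : I t -> is_derive t 1 (derive1 h) (- (kappa * h t)).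
  move=> It; rewrite -(h2 _ It); apply: DeriveDef; first exact: (@sh_smooth _ _ s 1%N).
  exact: (esym (derive1E _ _)).
(* The energy h'^2 + kappa h^2 of the equation h'' = - kappa h is conserved; it bounds h'. *)
have dE t : I t -> is_derive t 1 (fun t => derive1 h t ^+ 2 + kappa * h t ^+ 2) 0.
  move=> It; have d1 := dh t It; have d2 := dh' t It.
  apply: (is_derive_change (is_deriveD (is_deriveM d2 d2) (is_deriveZ kappa (is_deriveM d1 d1)))).
    by move=> u; rewrite !expr2.
  by rewrite /GRing.scale /=; ring.
have It0 := @sIt0 _ _ s.
pose E0 := derive1 h (st0 s) ^+ 2 + kappa * h (st0 s) ^+ 2.
(* The inequality |h'| <= h'^2 + 1 avoids a square root. *)
have hb t : I t -> `|derive1 h t| <= E0 + 1.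
  move=> It; have := interval_constant (@sI_itv _ _ s) dE It It0; rewrite -/E0 => Et.
  have q1 : `|derive1 h t| ^+ 2 <= E0.
    by rewrite -Et real_normK ?num_real // lerDl mulr_ge0 // sqr_ge0.
  have q2 := sqr_ge0 (`|derive1 h t| - 1); move: q1 q2; set z := `|_|.
  have z0 : 0 <= z by exact: normr_ge0.
  by nra.
(* The function eta + h' / kappa of the height has derivative h + h'' / kappa = 0; thus the bound
   for h' bounds eta. *)
have dG t : I t -> is_derive t 1 (fun t => height_potential s t + kappa^-1 * derive1 h t) 0.
  move=> It; have [p1 p2] := height_potentialE It.
  have d1 : is_derive t 1 (height_potential s) (h t) := DeriveDef p1 (etrans (esym (derive1E _ _)) p2).
  apply: (is_derive_change (is_deriveD d1 (is_deriveZ kappa^-1 (dh' t It)))) => [u|]; first by [].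
  by rewrite /GRing.scale /= mulrN mulrA mulVf // mul1r subrr.
pose D := `|height_potential s (st0 s)| + kappa^-1 * ((E0 + 1) + (E0 + 1)).
have etaD y : `|eta y| <= D.
  have := interval_constant (@sI_itv _ _ s) dG (Ih y) It0; rewrite -/(eta y) => Ey.
  have -> : eta y = height_potential s (st0 s) +
      kappa^-1 * (derive1 h (st0 s) - derive1 h (psi y).1) by move: Ey; rewrite mulrBr; lra.
  rewrite /D (le_trans (ler_normD _ _)) // lerD2l normrM gtr0_norm ?invr_gt0 //.
  rewrite ler_pM2l ?invr_gt0 // (le_trans (ler_normB _ _)) // lerD //; exact: hb.
pose L := `|c / m%:R| * D.
have D0 : 0 <= D by apply: le_trans (etaD x0).
(* H exp (c eta / m) has the constant value [W x0], and the exponential is at most exp [L]. *)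
have Hlow y : `|W x0| / expR L <= `|H y|.
  rewrite ler_pdivrMr ?expR_gt0 // -(Wc y) /W normrM ler_pM2l ?normr_gt0 ?Hn //.
  rewrite gtr0_norm ?expR_gt0 // ler_expR (le_trans (ler_norm _)) // normrM.
  by apply: ler_wpM2l.
have W0 : 0 < `|W x0| / expR L.
  rewrite divr_gt0 ?expR_gt0 // normr_gt0 /W mulf_neq0 ?Hn // gt_eqF //.
  exact: expR_gt0.
(* Outside this [K] the quotient eta / |H| would exceed the bound just established, so [K] is all of
   M. *)
have [K Kc Kq] := limq (D / (`|W x0| / expR L)).
apply: Mnc; have -> // : [set: M] = K.
apply/seteqP; split=> // y _; apply: contrapT => /Kq; apply/negP; rewrite -leNgt.
rewrite ler_pdivrMr ?normr_gt0 ?Hn //; apply: (le_trans (le_trans (ler_norm _) (etaD y))).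
rewrite -{1}[D](@divfK _ (`|W x0| / expR L)) ?gt_eqF //.
by apply: ler_wpM2l => //; apply: divr_ge0 => //; exact: ltW.
Qed.

End Nonzero.

End Global.



Lemma sqnorm3_eq0 {R : realType} n (g : 'M[R]_n) (T : 'I_n -> 'I_n -> 'I_n -> R) :
  (forall a b e, T a b e = 0) -> sqnorm3 g T = 0.
Proof.
move=> T0; rewrite /sqnorm3 /=; apply: big1 => a _; apply: big1 => b _; apply: big1 => e _.
by apply: big1 => a' _; apply: big1 => b' _; apply: big1 => e' _; rewrite !T0 mulr0.
Qed.

Theorem theorem9p3 (R : realType) (m : nat)
    (I : set R) (h : R -> R) (t0 : R)
    (P : charted R m) (g0 : gram_field P)
    (I_open : open I) (I_itv : is_interval I) (It0 : I t0)
    (h_smooth : smooth_fun_on I h) (h_pos : forall t, I t -> 0 < h t)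
    (P_manifold : smooth_manifold P) (g0_riem : riemannian g0)
    (kappa : R) (kappa_ge0 : 0 <= kappa)
    (curv : constant_curvature (warped_metric I h g0) kappa)
    (M : charted R m) (g : gram_field M)
    (M_manifold : smooth_manifold M) (M_conn : connected [set: M])
    (g_riem : riemannian g) (M_complete : riem_complete g)
    (M_noncompact : ~ compact [set: M]) (M_orientable : orientable M)
    (psi : M -> interval_prod I P)
    (psi_isom : isometric_immersion g (warped_metric I h g0) psi)
    (N : @field_along R m (1 + m) M (interval_prod I P))
    (N_normal : unit_normal (warped_metric I h g0) psi N)
    (c : R)
    (soliton : mcf_soliton g (warped_metric I h g0) psi
                 (h_dt I h P) c) :
  let H : M -> R := mean_curvature g (warped_metric I h g0) psi N in
  let A2 : M -> R := sqnormA g (warped_metric I h g0) psi N in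
  let tau : M -> R := fun x => (psi x).1 in
  let eta : M -> R := fun x => oriented_integral t0 (tau x) h in
  (* where H vanishes the quotients by |H| are undefined; such points are ignored *)
  let Hnz : set M := [set x | H x != 0] in
  (forall x, 0 <= H x) \/ (forall x, H x <= 0) ->
  (fun x => eta x / `|H x|) @ within Hnz (at_infinity M) --> +oo ->
  (limf_esup (fun x => ((m%:R * derive1 h (tau x) + c * h (tau x) ^+ 2)
                        / `|H x|)%:E)
     (within Hnz (at_infinity M)) < +oo)%E ->
  (limf_esup (fun x => (c * derive1 h (tau x) + A2 x)%:E) (at_infinity M) < 0)%E ->
  (ereal_sup [set (A2 x / H x ^+ 2)%:E | x in Hnz] < +oo)%E ->
  (0 < kappa ->
     (forall x, H x = 0) \/
     (totally_umbilical g (warped_metric I h g0) psi N /\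
      exists2 a : R, a != 0 & forall x, H x = a)) /\
  (kappa = 0 ->
     forall x, sqnorm3 (g (chart_at x) x)
       (gradH_tensor g (warped_metric I h g0) psi N (chart_at x) x) = 0).
Proof.
move=> H A2 tau eta Hnz sign lq lC lA lB.
pose s := @Soliton R m I h t0 P g0 kappa M g psi N c I_open I_itv It0 h_smooth h_pos
  P_manifold g0_riem curv M_manifold g_riem psi_isom N_normal soliton.
(* If H vanishes identically, one term of the tensor has the factor dH = 0 and the other the factor
   H = 0. *)
have tensor0 x : (forall y, H y = 0) -> forall u a b,
    gradH_tensor g (warped_metric I h g0) psi N (chart_at x) x u a b = 0.
  move=> H0 u a b; rewrite /gradH_tensor -/(H x) H0 mul0r subr0.
  have -> : mean_curvature g (warped_metric I h g0) psi N \o param (chart_at x) = cst 0.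
    by apply/funext => v; exact: H0.
  by rewrite /partial derive_cst mul0r.
have flat : (forall y, H y = 0) ->
    (0 < kappa -> (forall x, H x = 0) \/
      (totally_umbilical g (warped_metric I h g0) psi N /\
       exists2 a : R, a != 0 & forall x, H x = a)) /\
    (kappa = 0 -> forall x, sqnorm3 (g (chart_at x) x)
      (gradH_tensor g (warped_metric I h g0) psi N (chart_at x) x) = 0).
  move=> H0; split=> [_|_ x]; first by left.
  by apply: sqnorm3_eq0 => u a b; exact: tensor0.
(* In dimension 0 the mean curvature vector is an empty sum, so H = 0. *)
have [m0|m0] := posnP m.
  apply: flat => y; rewrite /H /mean_curvature /mean_curvature_vector /inner.
  rewrite [\sum_a _]big1 ?mul0mx ?mxE // => a _.
  by have := ltn_ord a; rewrite [X in (_ < X)%N]m0.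
have [sg [sg0 Hs sg2 sgH]] : exists sg : R, [/\ sg != 0, forall y, 0 <= sg * H y,
    sg * sg = 1 & forall y, `|H y| = sg * H y].
  case: sign => Hs.
    exists 1; split; rewrite ?oner_neq0 ?mulr1 // => y; rewrite mul1r //.
    by rewrite ger0_norm.
  exists (-1); split; rewrite ?oppr_eq0 ?oner_neq0 ?mulrNN ?mulr1 // => y; rewrite mulN1r.
    by rewrite oppr_ge0.
  by rewrite ler0_norm.
have [|Hn] := @mean_curvature_dichotomy R m s M_conn sg sg0 Hs; first exact: flat.
have [VC [KC KCc KCV] /ereal_sup_finite_bound [C CP]] := limf_esup_bound lC.
have [VA [KA KAc KAV] /ereal_sup_negative_bound [e e0 eP]] := limf_esup_bound lA.
have [B BP] := ereal_sup_finite_bound lB.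
have uB x : @ratio R m s x <= B by exact: (BP x (Hn x)).
pose K1 := KC `|` KA; have K1c : compact K1 by exact: compactU.
have limC x : ~ K1 x -> (m%:R * @phi R m s x + c * h (psi x).1 ^+ 2) / `|H x| <= C.
  by move=> /not_orP[nK _]; apply: CP; exact: (KCV x nK (Hn x)).
have lime x : ~ K1 x -> c * @phi R m s x + A2 x <= - e.
  by move=> /not_orP[_ nK]; apply: eP; exact: (KAV x nK).
have limq D : exists2 K, compact K & forall x, ~ K x -> D < eta x / `|H x|.
  have nD : nbhs (+oo_R) [set y : R | D < y] by exists D; split=> //; exact: num_real.
  have [K Kc KV] := lq _ nD; exists K => // x nK.
  exact: (KV x nK (Hn x)).
split=> [k1|k1 x].
  have := @kappa_zero R m s M_conn m0 kappa_ge0 sg sgH sg2 Hn B C e K1 uB K1c e0 limC lime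
    limq M_noncompact.
  by move=> k1'; move: k1; rewrite [kappa]k1' ltxx.
apply: sqnorm3_eq0 => u a b.
exact: (@gradH_tensor_zero R m s M_conn m0 kappa_ge0 sg sgH sg2 Hn B C e K1 uB K1c e0 limC lime
    limq x u a b).
Qed.
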